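(* Let $A\in\mathcal{B}(\mathcal{H})$ be self-adjoint. Then $\mathcal{O}_A\subset A+\mathcal{B}_2(\mathcal{H})_h$ is a differentiable submanifold if and only if the spectrum of $A$ is finite.
   Context: $\mathcal{H}$ is an infinite dimensional (complex) Hilbert space, $\mathcal{B}_2(\mathcal{H})$ is the space of Hilbert-Schmidt operators with norm $\|a\|_2=Tr(a^*a)^{1/2}$, and $\mathcal{B}_2(\mathcal{H})_h$ is the real Hilbert space of its self-adjoint elements. $U_2(\mathcal{H})=\{u\text{ unitary}:u-1\in\mathcal{B}_2(\mathcal{H})\}$ and $\mathcal{O}_A=\{uAu^*:u\in U_2(\mathcal{H})\}$. Every element of $\mathcal{O}_A$ is of the form $A+k$ with $k\in\mathcal{B}_2(\mathcal{H})_h$, and $A+\mathcal{B}_2(\mathcal{H})_h$ is regarded as an affine Hilbert space (with the metric given by $\|\cdot\|_2$). *)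

(* Defs.v *)
From HB Require Import structures.
From mathcomp Require Import all_boot all_order all_algebra.
From mathcomp Require Import complex ring.
From mathcomp Require Import all_classical all_reals all_analysis.

Set Implicit Arguments.
Unset Strict Implicit.
Unset Printing Implicit Defensive.

Import Order.TTheory GRing.Theory Num.Theory Num.Def.
Import numFieldNormedType.Exports.

Local Open Scope classical_set_scope.
Local Open Scope ring_scope.
Local Open Scope complex_scope.

Section ContinuousLinear.
Context {K : numFieldType} {E F : normedModType K}.

Definition clinear_pred : {pred E -> F} :=
  [pred f | `[< linear f /\ continuous f >]].

Record clinear :=
  CLinear { clinear_fun :> E -> F; _ : clinear_fun \in clinear_pred }.

HB.instance Definition _ := [isSub for clinear_fun].
HB.instance Definition _ := [Choice of clinear by <:].

Lemma clinearP (f : clinear) : linear f /\ continuous f.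
Proof. by case: f => f /= /asboolP. Qed.

Lemma clinear_pred_submod_closed : submod_closed clinear_pred.
Proof.
split=> [|a f g /asboolP[fl fc] /asboolP[gl gc]]; apply/asboolP.
  split=> [a x y|]; first by rewrite /= scaler0 addr0.
  exact: cst_continuous.
split=> [b x y|x]; last first.
  by apply: continuousD; [apply: continuousZl_tmp; exact: fc|exact: gc].
rewrite /= !fctE fl gl !scalerDr !scalerA (mulrC a b).
by rewrite addrACA.
Qed.

HB.instance Definition _ :=
  GRing.isSubmodClosed.Build K (E -> F) clinear_pred clinear_pred_submod_closed.

HB.instance Definition _ := [SubChoice_isSubLmodule of clinear by <:].

HB.instance Definition _ (f : clinear) :=
  GRing.isLinear.Build K E F *:%R f (clinearP f).1.

End ContinuousLinear.
Arguments clinear {K} E F.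

Definition clinear_id {K : numFieldType} {E : normedModType K} : clinear E E.
Proof.
exists (fun x => x).
by apply/asboolP; split=> [a x y|x].
Defined.

Definition clinear_comp {K : numFieldType} {E F G : normedModType K}
  (f : clinear F G) (g : clinear E F) : clinear E G.
Proof.
exists (fun x => f (g x)).
apply/asboolP; split=> [a x y|x].
  by rewrite (clinearP g).1 (clinearP f).1.
by apply: continuous_comp; [exact: (clinearP g).2|exact: (clinearP f).2].
Defined.


Section OperatorNorm.
Context {R : realType} {E F : normedModType R}.
Implicit Types f g : clinear E F.

Definition opnorm f : R := sup [set `|f x| | x in [set x : E | `|x| <= 1]].

Lemma opnorm_has_sup f :
  has_sup [set `|f x| | x in [set x : E | `|x| <= 1]].
Proof.
split; first by exists `|f 0|; exists 0 => //=; rewrite normr0 ler01.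
have /linear_boundedP/pinfty_ex_gt0[r r0 fr] : bounded_near f (nbhs 0).
  by apply/linear_bounded_continuous; exact: (clinearP f).2.
exists r => _ [x /= x1 <-]; apply: (le_trans (fr x)).
by rewrite ler_piMr// ltW.
Qed.

Lemma opnorm_ub f x : `|x| <= 1 -> `|f x| <= opnorm f.
Proof.
by move=> x1; apply: ub_le_sup; [exact: (opnorm_has_sup f).2|exists x].
Qed.

Lemma opnorm_le f M : (forall x, `|x| <= 1 -> `|f x| <= M) -> opnorm f <= M.
Proof.
move=> fM; apply: ge_sup; first exact: (opnorm_has_sup f).1.
by move=> _ [x /= x1 <-]; exact: fM.
Qed.

Lemma ler_opnormD f g : opnorm (f + g) <= opnorm f + opnorm g.
Proof.
apply: opnorm_le => x x1; rewrite [(f + g) x]/(f x + g x).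
by rewrite (le_trans (ler_normD _ _))// lerD// opnorm_ub.
Qed.

Let ler_opnormZ a f : opnorm (a *: f) <= `|a| * opnorm f.
Proof.
apply: opnorm_le => x x1; rewrite [(a *: f) x]/(a *: f x) normrZ.
by rewrite ler_wpM2l// opnorm_ub.
Qed.

Lemma opnormZ a f : opnorm (a *: f) = `|a| * opnorm f.
Proof.
apply/eqP; rewrite eq_le ler_opnormZ/=; have [->|a0] := eqVneq a 0.
  rewrite normr0 mul0r (le_trans _ (@opnorm_ub _ 0 _))//.
  by rewrite normr0 ler01.
rewrite -ler_pdivlMl ?normr_gt0// -normfV.
by have := ler_opnormZ a^-1 (a *: f); rewrite scalerA mulVf// scale1r.
Qed.

Lemma opnorm_eq0 f : opnorm f = 0 -> f = 0.
Proof.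
move=> f0; apply: val_inj; apply/funext => x /=.
have [->|x0] := eqVneq x 0; first by rewrite linear0.
have : `|f (`|x|^-1 *: x)| <= 0.
  by rewrite -f0 opnorm_ub// normrZ normfV normr_id mulVf ?normr_eq0.
rewrite normr_le0 linearZ scaler_eq0 invr_eq0 normr_eq0 (negbTE x0)/=.
by move/eqP.
Qed.

HB.instance Definition _ := Lmodule_isNormed.Build R (clinear E F)
  ler_opnormD opnormZ opnorm_eq0.

End OperatorNorm.

Section Submanifold.
Context {R : realType}.

(** [is_diff] is Fréchet differentiability, and the derivative [df] is valued
    in the normed space of continuous linear maps. *)
Fixpoint is_Ck (n : nat) (E F : normedModType R) (U : set E) (f : E -> F)
    : Prop :=
  if n is n'.+1 then
    exists df : E -> clinear E F,
      (forall x, U x -> is_diff x f (df x)) /\ is_Ck n' U df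
  else forall x, U x -> {for x, continuous f}.

Definition smooth_on (E F : normedModType R) (U : set E) (f : E -> F) :=
  forall n, is_Ck n U f.

Definition diffeomorphism (E F : normedModType R) (U : set E) (V : set F)
    (phi : E -> F) :=
  exists psi : F -> E,
    [/\ phi @` U = V, psi @` V = U, (forall x, U x -> psi (phi x) = x),
        smooth_on U phi & smooth_on V psi].

Definition closed_subspace (E : normedModType R) (F : set E) :=
  [/\ closed F, F 0 & forall (a : R) x y, F x -> F y -> F (a *: x + y)].

(** Meant for a Hilbert space [E], where closed subspaces are automatically
    complemented. *)
Definition submanifold (E : normedModType R) (S : set E) :=
  forall p, S p -> exists (U V F : set E) (phi : E -> E),
    [/\ open U /\ U p, open V, closed_subspace F, diffeomorphism U V phi
      & phi @` (U `&` S) = V `&` F].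

End Submanifold.

HB.mixin Record isHilbert (R : realType) H & CompleteNormedModule R[i] H := {
  hdot : {dot H for (@Num.conj R[i])} ;
  hdotE : forall x : H, hdot x x = `|x| ^+ 2
}.

#[short(type="hilbertType")]
HB.structure Definition Hilbert (R : realType) :=
  {H of isHilbert R H & CompleteNormedModule R[i] H}.

Section HilbertSchmidt.
Context {R : realType} {H : hilbertType R}.

Local Notation "''[' u , v ]" := (@hdot R H u v) : ring_scope.

Definition orthonormal_basis (B : set H) :=
  [/\ forall e, B e -> '[e, e] = 1,
      forall e f, B e -> B f -> e <> f -> '[e, f] = 0
    & forall x, (forall e, B e -> '[x, e] = 0) -> x = 0].

Lemma hdotC (x y : H) : '[x, y] = Num.conj '[y, x].
Proof. by rewrite hermC expr0 mul1r. Qed.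

Lemma orthonormal_basis_exists : exists B, orthonormal_basis B.
Proof.
pose P (B : set H) := (forall e, B e -> '[e, e] = 1) /\
  (forall e f, B e -> B f -> e <> f -> '[e, f] = 0).
have [F FP Ftot|B [[B1 B0] Bmax]] := @Zorn_bigcup H P.
  split=> [e [X FX Xe]|e f [X FX Xe] [Y FY Yf]]; first exact: (FP X FX).1.
  have [XY|YX] := Ftot _ _ FX FY.
    by apply: (FP Y FY).2 => //; exact: XY.
  by apply: (FP X FX).2 => //; exact: YX.
exists B; split=> // x xB; apply/eqP/negPn/negP => x0.
have nx0 : `|x| != 0 by rewrite normr_eq0.
pose u := `|x|^-1 *: x.
have uB e : B e -> '[u, e] = 0 by move=> Be; rewrite linearZl_LR /= xB// mulr0.
have u1 : '[u, u] = 1.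
  by rewrite hdotE normrZ normfV normr_id mulVf// expr1n.
apply: (Bmax (B `|` [set u])); first split.
- by left.
- move=> BuB; have /uB/eqP : B u by apply: BuB; right.
  by rewrite u1 oner_eq0.
split=> [e [/B1//|->//]|e f [Be|->] [Bf|->] ef]; last by [].
- exact: B0.
- by rewrite hdotC uB// rmorph0.
- exact: uB.
Qed.

(** The choice of basis is immaterial: by Parseval, [hs_energy] below takes
    the same value for all orthonormal bases. *)
Definition hilbert_basis : set H := sval (cid orthonormal_basis_exists).

Lemma hilbert_basisP : orthonormal_basis hilbert_basis.
Proof. exact: svalP (cid orthonormal_basis_exists). Qed.

Local Notation BH := (clinear H H).
Implicit Types a b : BH.

(** [Tr (a^* a)], since [<a^* a e, e> = <a e, a e>]. *)
Definition hs_energy a : \bar R :=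
  (\esum_(e in hilbert_basis) (complex.Re '[a e, a e])%:E)%E.

Definition hilbert_schmidt a := (hs_energy a < +oo)%E.

Definition is_adjoint a b := forall x y, '[a x, y] = '[x, b y].

Definition self_adjoint a := is_adjoint a a.

Let rn (x : H) : R := complex.Re `|x|.

Let rnE x : (rn x)%:C = `|x|.
Proof. by rewrite RRe_real// normr_real. Qed.

Let rn_ge0 x : 0 <= rn x.
Proof. by rewrite -lecR rnE normr_ge0. Qed.

Let Re_hdot x : complex.Re '[x, x] = rn x ^+ 2.
Proof. by rewrite hdotE -rnE -rmorphXn. Qed.

Let rnD x y : rn (x + y) <= rn x + rn y.
Proof. by rewrite -lecR rmorphD/= !rnE ler_normD. Qed.

Let rnZ (k : R) x : rn (k%:C *: x) = `|k| * rn x.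
Proof.
apply: (@complexI R); rewrite rmorphM/= !rnE normrZ; congr (_ * _).
by rewrite normc_def /= expr0n/= addr0 sqrtr_sqr.
Qed.

Definition hs_norm a : R := Num.sqrt (fine (hs_energy a)).

Lemma hs_energy_ge0 a : (0 <= hs_energy a)%E.
Proof.
by apply: esum_ge0 => e _; rewrite Re_hdot lee_fin sqr_ge0.
Qed.

Lemma hs_norm_ge0 a : 0 <= hs_norm a.
Proof. exact: sqrtr_ge0. Qed.

Let energyE a : hilbert_schmidt a -> hs_energy a = (hs_norm a ^+ 2)%:E.
Proof.
move=> aHS; rewrite /hs_norm sqr_sqrtr ?fine_ge0 ?hs_energy_ge0//.
by rewrite fineK// ge0_fin_numE ?hs_energy_ge0.
Qed.

Let energy_le a (M : R) : 0 <= M ->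
  (forall A, finite_set A -> A `<=` hilbert_basis ->
    \sum_(e \in A) rn (a e) ^+ 2 <= M ^+ 2) ->
  hilbert_schmidt a /\ hs_norm a <= M.
Proof.
move=> M0 aM; have eM : (hs_energy a <= (M ^+ 2)%:E)%E.
  apply: ge_ereal_sup => _ [A [Af AB] <-].
  under eq_fsbigr do rewrite Re_hdot.
  by rewrite fsumEFin// lee_fin; exact: aM.
have aHS : hilbert_schmidt a by rewrite /hilbert_schmidt (le_lt_trans eM) ?ltry.
split=> //; rewrite -(@ler_pXn2r _ 2) ?nnegrE ?hs_norm_ge0//.
by rewrite -lee_fin -energyE.
Qed.

Let energy_ge a A : hilbert_schmidt a -> finite_set A -> A `<=` hilbert_basis ->
  \sum_(e \in A) rn (a e) ^+ 2 <= hs_norm a ^+ 2.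
Proof.
move=> aHS Af AB; rewrite -lee_fin -energyE// -fsumEFin//.
apply: ereal_sup_ubound; exists A => //.
by apply: eq_fsbigr => e _; rewrite Re_hdot.
Qed.

Let sum_sqrD (A : set H) (x y : H -> R) (s t : R) : finite_set A ->
  0 < s -> 0 < t ->
  \sum_(e \in A) x e ^+ 2 <= s ^+ 2 -> \sum_(e \in A) y e ^+ 2 <= t ^+ 2 ->
  \sum_(e \in A) (x e + y e) ^+ 2 <= (s + t) ^+ 2.
Proof.
move=> Af s0 t0 xs yt; rewrite !fsbig_finite//= in xs yt *.
have xy e :
    (x e + y e) ^+ 2 <= (1 + t / s) * x e ^+ 2 + (1 + s / t) * y e ^+ 2.
  rewrite -subr_ge0.
  have -> : (1 + t / s) * x e ^+ 2 + (1 + s / t) * y e ^+ 2 - (x e + y e) ^+ 2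
      = (t * x e - s * y e) ^+ 2 / (s * t).
    by field; rewrite !gt_eqF.
  by rewrite divr_ge0 ?sqr_ge0// mulr_ge0// ltW.
apply: (le_trans (ler_sum _ (fun e _ => xy e))).
rewrite big_split/= -!mulr_sumr.
have -> : (s + t) ^+ 2 = (1 + t / s) * s ^+ 2 + (1 + s / t) * t ^+ 2.
  by field; rewrite !gt_eqF.
by rewrite lerD// ler_wpM2l// addr_ge0// divr_ge0// ltW.
Qed.

Let hsD_bound a b (eps : R) : 0 < eps ->
  hilbert_schmidt a -> hilbert_schmidt b ->
  hilbert_schmidt (a + b) /\
  hs_norm (a + b) <= hs_norm a + eps + (hs_norm b + eps).
Proof.
move=> eps0 aHS bHS; have a0 := hs_norm_ge0 a; have b0 := hs_norm_ge0 b.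
apply: energy_le => [|A Af AB]; first by rewrite !addr_ge0// ltW.
apply: (@le_trans _ _ (\sum_(e \in A) (rn (a e) + rn (b e)) ^+ 2)).
  rewrite !fsbig_finite//=; apply: ler_sum => e _.
  by rewrite ler_pXn2r ?nnegrE ?addr_ge0 ?rn_ge0// rnD.
apply: sum_sqrD; rewrite // ?ltr_wpDl//.
  rewrite (le_trans (energy_ge aHS Af AB))//.
  by rewrite ler_pXn2r ?nnegrE ?lerDl ?addr_ge0// ltW.
rewrite (le_trans (energy_ge bHS Af AB))//.
by rewrite ler_pXn2r ?nnegrE ?lerDl ?addr_ge0// ltW.
Qed.

Lemma hilbert_schmidtD a b : hilbert_schmidt a -> hilbert_schmidt b ->
  hilbert_schmidt (a + b).
Proof. by move=> aHS bHS; have [] := @hsD_bound a b 1 ltr01 aHS bHS. Qed.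

Lemma ler_hs_normD a b : hilbert_schmidt a -> hilbert_schmidt b ->
  hs_norm (a + b) <= hs_norm a + hs_norm b.
Proof.
move=> aHS bHS; apply/ler_addgt0Pr => eps eps0.
have e20 : 0 < eps / 2 by rewrite divr_gt0.
have [_] := hsD_bound e20 aHS bHS.
by rewrite addrACA -splitr.
Qed.

Let hsZ_bound (k : R) a : hilbert_schmidt a ->
  hilbert_schmidt (k%:C *: a) /\ hs_norm (k%:C *: a) <= `|k| * hs_norm a.
Proof.
move=> aHS; apply: energy_le => [|A Af AB]; first by rewrite mulr_ge0 ?hs_norm_ge0.
rewrite exprMn; apply: (@le_trans _ _ (`|k| ^+ 2 * \sum_(e \in A) rn (a e) ^+ 2)).
  rewrite !fsbig_finite//= mulr_sumr; apply: ler_sum => e _.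
  by rewrite -exprMn -rnZ.
by rewrite ler_wpM2l ?sqr_ge0 ?energy_ge.
Qed.

Lemma hilbert_schmidtZ (k : R) a : hilbert_schmidt a ->
  hilbert_schmidt (k%:C *: a).
Proof. by move=> /(hsZ_bound k)[]. Qed.

Lemma hs_normZ (k : R) a : hilbert_schmidt a ->
  hs_norm (k%:C *: a) = `|k| * hs_norm a.
Proof.
move=> aHS; have [kaHS kaa] := hsZ_bound k aHS.
apply/eqP; rewrite eq_le kaa/=; have [->|k0] := eqVneq k 0.
  by rewrite normr0 mul0r hs_norm_ge0.
rewrite -ler_pdivlMl ?normr_gt0// -normfV.
have [_] := hsZ_bound k^-1 kaHS.
by rewrite scalerA -rmorphM/= mulVf// scale1r.
Qed.

Lemma hilbert_schmidt0 : hilbert_schmidt 0.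
Proof.
suff [] : hilbert_schmidt 0 /\ hs_norm 0 <= 0 by [].
apply: energy_le => // A Af AB; rewrite fsbig_finite//= big1 ?expr0n// => e _.
by rewrite /rn normr0 expr0n.
Qed.

Lemma hs_norm_eq0 a : hilbert_schmidt a -> hs_norm a = 0 ->
  forall e, hilbert_basis e -> a e = 0.
Proof.
move=> aHS a0 e Be; have := @energy_ge a [set e] aHS (finite_set1 e).
rewrite a0 fsbig_set1 expr0n/= => /(_ _)/wrap[|re]; first by move=> _ ->.
have /eqP rn0 : rn (a e) == 0 by rewrite -sqrf_eq0 eq_le re sqr_ge0.
by apply/eqP; rewrite -normr_eq0 -rnE rn0.
Qed.

(** [B_2(H)_h], made below into a normed space over [R] (not [R[i]]), with norm
    [hs_norm]. *)
Definition hs_sa_pred : {pred BH} :=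
  [pred a | `[< hilbert_schmidt a /\ self_adjoint a >]].

Record hs_sa := HsSa { hs_sa_val :> BH; _ : hs_sa_val \in hs_sa_pred }.

HB.instance Definition _ := [isSub for hs_sa_val].
HB.instance Definition _ := [Choice of hs_sa by <:].

Lemma hs_saP (a : hs_sa) : hilbert_schmidt a /\ self_adjoint a.
Proof. by case: a => a /= /asboolP. Qed.

Let sa_lin (k : R) a b : self_adjoint a -> self_adjoint b ->
  self_adjoint (k%:C *: a + b).
Proof.
move=> asa bsa x y.
have cE z : (k%:C *: a + b) z = k%:C *: a z + b z by [].
rewrite !cE.
rewrite linearDl linearDr linearZl_LR linearZr_LR/= asa bsa.
by congr (_ * _ + _); exact/esym/conjc_real.
Qed.

Let hs_sa_lin (k : R) a b : a \in hs_sa_pred -> b \in hs_sa_pred ->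
  k%:C *: a + b \in hs_sa_pred.
Proof.
move=> /asboolP[aHS asa] /asboolP[bHS bsa]; apply/asboolP; split.
  by apply: hilbert_schmidtD => //; exact: hilbert_schmidtZ.
exact: sa_lin.
Qed.

Let hs_sa0 : 0 \in hs_sa_pred.
Proof.
apply/asboolP; split; first exact: hilbert_schmidt0.
move=> x y; have c0 z : (0 : BH) z = 0 by [].
by rewrite !c0 linear0l linear0r.
Qed.

Lemma hs_sa_zmod_closed : zmod_closed hs_sa_pred.
Proof.
split=> // a b aP bP.
by have := hs_sa_lin (-1) bP aP; rewrite rmorphN1 scaleN1r addrC.
Qed.

HB.instance Definition _ :=
  GRing.isZmodClosed.Build BH hs_sa_pred hs_sa_zmod_closed.

HB.instance Definition _ := [SubChoice_isSubZmodule of hs_sa by <:].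

Lemma hs_sa_scale_subproof (k : R) (a : hs_sa) :
  k%:C *: (a : BH) \in hs_sa_pred.
Proof. by rewrite -[_ *: _]addr0; apply: hs_sa_lin; [exact: valP|]. Qed.

Definition hs_sa_scale (k : R) (a : hs_sa) := HsSa (hs_sa_scale_subproof k a).

Let hs_sa_scaleA (k l : R) (a : hs_sa) :
  hs_sa_scale k (hs_sa_scale l a) = hs_sa_scale (k * l) a.
Proof. by apply: val_inj; rewrite /= scalerA rmorphM. Qed.

Let hs_sa_scale1 : left_id 1 hs_sa_scale.
Proof. by move=> a; apply: val_inj; rewrite /= scale1r. Qed.

Let hs_sa_scaleDr : right_distributive hs_sa_scale +%R.
Proof. by move=> k a b; apply: val_inj; rewrite /= scalerDr. Qed.

Let hs_sa_scaleDl (a : hs_sa) : {morph hs_sa_scale^~ a : k l / k + l}.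
Proof. by move=> k l; apply: val_inj; rewrite /= rmorphD scalerDl. Qed.

HB.instance Definition _ := GRing.Zmodule_isLmodule.Build R hs_sa
  hs_sa_scaleA hs_sa_scale1 hs_sa_scaleDr hs_sa_scaleDl.

Let hs_sa_normD (a b : hs_sa) : hs_norm (a + b) <= hs_norm a + hs_norm b.
Proof. exact: ler_hs_normD (hs_saP a).1 (hs_saP b).1. Qed.

Let hs_sa_normZ (k : R) (a : hs_sa) : hs_norm (k *: a) = `|k| * hs_norm a.
Proof. exact: hs_normZ (hs_saP a).1. Qed.

Let hs_sa_norm_eq0 (a : hs_sa) : hs_norm a = 0 -> a = 0.
Proof.
move=> a0; have [aHS asa] := hs_saP a.
apply: val_inj; apply: val_inj; apply/funext => x /=.
have [_ _ Bmax] := hilbert_basisP; apply: Bmax => e Be.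
by rewrite asa (hs_norm_eq0 aHS a0 Be) linear0r.
Qed.

HB.instance Definition _ := Lmodule_isNormed.Build R hs_sa
  hs_sa_normD hs_sa_normZ hs_sa_norm_eq0.

Definition unitary (u : BH) :=
  exists2 v : BH, is_adjoint u v & cancel u v /\ cancel v u.

Definition U2 : set BH :=
  [set u | unitary u /\ hilbert_schmidt (u - clinear_id)].

Definition orbit2 (A : BH) : set BH :=
  [set X | exists u v : BH, [/\ U2 u, is_adjoint u v &
    X = clinear_comp u (clinear_comp A v)]].

Definition spectrum (A : BH) : set R[i] :=
  [set l | ~ exists S : BH,
    cancel (A - l *: clinear_id) S /\ cancel S (A - l *: clinear_id)].

(** [S] is a submanifold of the affine space [A + B_2(H)_h], which is
    identified with its space of translations via [k |-> A + k]. *)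
Definition affine_submanifold (A : BH) (S : set BH) :=
  (forall X, S X -> exists k : hs_sa, X = A + k) /\
  submanifold [set k : hs_sa | S (A + k)].

Definition infinite_dimensional :=
  forall (n : nat) (e : 'I_n -> H),
    exists x, forall c : 'I_n -> R[i], x <> \sum_i c i *: e i.

End HilbertSchmidt.
Arguments hs_sa {R} H.
Arguments infinite_dimensional {R} H.

(* Main.v *)
Require Import Defs.
From HB Require Import structures.
From mathcomp Require Import all_boot all_order all_algebra.
From mathcomp Require Import complex ring lra.
From mathcomp Require Import all_classical all_reals all_analysis.

(** Suppose that [O_A] is a submanifold. It is then locally closed near [A], hence a
    Baire space, and it is the union over [n] of the sets of all [u A u^*] with
    [|u - 1|_2 <= n]. If the spectrum is infinite, it has many points as close to
    each other as we like; exchanging many disjoint pairs of approximate eigenvectors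
    for such points moves [A] very little, but by an amount that no [u] with
    [|u - 1|_2 <= n] can reproduce. So these sets are nowhere dense in [O_A], a
    contradiction.

    Conversely, if the spectrum is finite then [m(A) = 0] for some
    [m = prod_r (X - r)] with distinct real roots [r], with spectral projections
    [p_r]. The map
    [phi(k) = k - sum_r p_r k p_r + sum_r m'(r)^(-1) p_r m(A + k) p_r]
    is strictly differentiable at [0] with derivative the identity, so it is a local
    diffeomorphism. When [k] is small, the following are equivalent: [A + k] is in
    [O_A]; [m(A + k) = 0]; the diagonal blocks [p_r m(A + k) p_r] vanish; the diagonal
    blocks of [phi(k)] vanish. The third implies the second because [m(A + k)]
    commutes with [A + k], and the second implies the first because
    [s = sum_r q_r p_r], with [q_r] the spectral projections of [A + k], is close to
    [1] and satisfies [(A + k) s = s A], so that its unitary part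
    [s (s^* s)^(-1/2)] conjugates [A] to [A + k]. *)

Set Implicit Arguments.
Unset Strict Implicit.
Unset Printing Implicit Defensive.

Import Order.TTheory GRing.Theory Num.Theory Num.Def.
Import numFieldNormedType.Exports.

Local Open Scope classical_set_scope.
Local Open Scope ring_scope.
Local Open Scope complex_scope.

(** No functional calculus enters: spectral values act only through approximate eigenvectors, and
    operators are built from polynomials and fixed points. In the first direction the order of
    choices matters. The bound on [|u - 1|_2] fixes the number of pairs; this number and the allowed
    displacement fix how close the spectral values must be; only then is the accuracy of the
    eigenvectors chosen, against the smallest gap between these values. In the converse, [m(A + k)]
    alone gives no chart. Since [m] vanishes at each [r], its derivative at [A] keeps only diagonal
    blocks, [k |-> sum_r m'(r) p_r k p_r], whereas [m(A + k)] itself has off-diagonal blocks in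
    general. Hence the compressions, the factors [m'(r)^(-1)] and the separate argument that
    recovers the off-diagonal blocks. All maps must stay inside the self-adjoint Hilbert-Schmidt
    operators, a real space not closed under composition, which is why products are symmetrized. *)

Section ZmoduleReflection.

(** Vectors and operators form additive groups without a ring structure here, so their identities
    are decided by comparing integer coefficients. *)
Inductive zterm :=
  | ZVar of nat
  | ZZero
  | ZAdd of zterm & zterm
  | ZOpp of zterm
  | ZMuln of zterm & nat.

Fixpoint zval (V : zmodType) (e : seq V) (t : zterm) : V :=
  match t with
  | ZVar i => e`_i
  | ZZero => 0
  | ZAdd s t => zval e s + zval e t
  | ZOpp s => - zval e s
  | ZMuln s n => zval e s *+ n
  end.

Fixpoint zcoef (t : zterm) (i : nat) : int :=
  match t with
  | ZVar j => (i == j)%:Z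
  | ZZero => 0
  | ZAdd s t => zcoef s i + zcoef t i
  | ZOpp s => - zcoef s i
  | ZMuln s n => zcoef s i *+ n
  end.

Lemma zval_coef (V : zmodType) (e : seq V) t :
  zval e t = \sum_(i < size e) e`_i *~ zcoef t i.
Proof.
elim: t => [j||s IHs t IHt|s IHs|s IHs n] /=.
- have [je|je] := ltnP j (size e); last first.
    rewrite nth_default// big1// => i _.
    by rewrite ltn_eqF ?mulr0z// (leq_trans _ je).
  rewrite (bigD1 (Ordinal je))//= eqxx mulr1z big1 ?addr0// => i /negbTE ij.
  by rewrite -val_eqE/= in ij; rewrite ij mulr0z.
- by rewrite big1// => i _; rewrite mulr0z.
- by rewrite IHs IHt -big_split; apply: eq_bigr => i _; rewrite mulrzDr.
- by rewrite IHs -sumrN; apply: eq_bigr => i _; rewrite mulrNz.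
- rewrite IHs -sumrMnl; apply: eq_bigr => i _.
  by rewrite -[in RHS]mulr_natr mulrzA mulrz_nat.
Qed.

Lemma zval_eq (V : zmodType) (e : seq V) s t :
  all (fun i => zcoef s i == zcoef t i) (iota 0 (size e)) ->
  zval e s = zval e t.
Proof.
move=> /allP st; rewrite !zval_coef; apply: eq_bigr => i _.
by have := st i; rewrite mem_iota add0n ltn_ord => /(_ isT)/eqP->.
Qed.

End ZmoduleReflection.

(** The [match constr:(tt)] wrappers run the tactic [same] while a term is being computed; its
    failure falls through to the search in the tail. *)
Ltac zmod_index same x e :=
  lazymatch e with
  | nil => constr:(@None nat)
  | cons ?y ?e' =>
    match constr:(tt) with
    | _ => let _ := match constr:(tt) with _ => same x y end in constr:(Some O)
    | _ =>
      lazymatch zmod_index same x e' with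
      | Some ?n => constr:(Some (S n))
      | None => constr:(@None nat)
      end
    end
  end.

Ltac zmod_atoms same t e :=
  lazymatch t with
  | (?a + ?b)%R => let e' := zmod_atoms same a e in zmod_atoms same b e'
  | (- ?a)%R => zmod_atoms same a e
  | (?a *+ ?n)%R => zmod_atoms same a e
  | 0%R => e
  | _ =>
    lazymatch zmod_index same t e with
    | Some _ => e
    | None => constr:(cons t e)
    end
  end.

Ltac zmod_reify same t e :=
  lazymatch t with
  | (?a + ?b)%R =>
    let a' := zmod_reify same a e in
    let b' := zmod_reify same b e in constr:(ZAdd a' b')
  | (- ?a)%R => let a' := zmod_reify same a e in constr:(ZOpp a')
  | (?a *+ ?n)%R => let a' := zmod_reify same a e in constr:(ZMuln a' n)
  | 0%R => constr:(ZZero)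
  | _ => lazymatch zmod_index same t e with Some ?n => constr:(ZVar n) end
  end.

Ltac zmod_with same :=
  lazymatch goal with
  | |- @eq ?V ?a ?b =>
    let e := zmod_atoms same a (@nil V) in
    let e := zmod_atoms same b e in
    let s := zmod_reify same a e in
    let t := zmod_reify same b e in
    apply: (@zval_eq _ e s t); vm_compute; reflexivity
  end.

(** Decides identities of additive groups; atoms are compared up to syntactic
    equality first, and up to unification (which may be slow) if this fails. *)
Ltac zmod := first
  [ zmod_with ltac:(fun x y => constr_eq x y)
  | zmod_with ltac:(fun x y => unify x y) ].

(** * Bounded linear and bilinear maps *)

Section BoundedLinear.
Context {K : numFieldType} {E F : normedModType K}.

Lemma clinear_bounded (f : clinear E F) :
  exists2 C : K, 0 < C & forall x, `|f x| <= C * `|x|.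
Proof.
have /linear_boundedP/pinfty_ex_gt0[r r0 fr] : bounded_near f (nbhs 0).
  by apply/linear_bounded_continuous; exact: (clinearP f).2.
by exists r.
Qed.

Lemma bounded_clinear_pred (f : E -> F) (C : K) : linear f -> 0 <= C ->
  (forall x, `|f x| <= C * `|x|) -> f \in clinear_pred.
Proof.
move=> fl C0 fC; apply/asboolP; split=> //.
pose g := GRing.isLinear.Build K E F *:%R f fl.
pose fL : {linear E -> F} := HB.pack f g.
apply: (@bounded_linear_continuous _ _ _ fL); apply/linear_boundedP.
exists C; split; first exact: ger0_real.
by move=> r Cr x; apply: le_trans (fC x) _; rewrite ler_wpM2r// ltW.
Qed.

Definition mk_clinear (f : E -> F) (C : K) (fl : linear f) (C0 : 0 <= C)
  (fC : forall x, `|f x| <= C * `|x|) : clinear E F :=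
  CLinear (bounded_clinear_pred fl C0 fC).

Lemma clinear_ext (f g : clinear E F) : (forall x, f x = g x) -> f = g.
Proof. by move=> fg; apply: val_inj; apply/funext. Qed.

Lemma clinearDE (f g : clinear E F) x : (f + g) x = f x + g x.
Proof. by []. Qed.

Lemma clinearNE (f : clinear E F) x : (- f) x = - f x.
Proof. by []. Qed.

Lemma clinearBE (f g : clinear E F) x : (f - g) x = f x - g x.
Proof. by []. Qed.

Lemma clinearZE (a : K) (f : clinear E F) x : (a *: f) x = a *: f x.
Proof. by []. Qed.

Lemma clinear0E x : (0 : clinear E F) x = 0.
Proof. by []. Qed.

Lemma clinD (f : clinear E F) x y : f (x + y) = f x + f y.
Proof. exact: linearD. Qed.

Lemma clinN (f : clinear E F) x : f (- x) = - f x.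
Proof. exact: linearN. Qed.

Lemma clinB (f : clinear E F) x y : f (x - y) = f x - f y.
Proof. exact: linearB. Qed.

Lemma clinZ (f : clinear E F) a x : f (a *: x) = a *: f x.
Proof. exact: linearZ. Qed.

Lemma clin0 (f : clinear E F) : f 0 = 0.
Proof. exact: linear0. Qed.

Lemma clin_sum (f : clinear E F) I (r : seq I) (P : pred I) (g : I -> E) :
  f (\sum_(i <- r | P i) g i) = \sum_(i <- r | P i) f (g i).
Proof. exact: linear_sum. Qed.

Lemma clinear_sumE I (r : seq I) (P : pred I) (f : I -> clinear E F) x :
  (\sum_(i <- r | P i) f i) x = \sum_(i <- r | P i) f i x.
Proof. by elim/big_rec2: _ => // i y z _ <-. Qed.

End BoundedLinear.

Lemma clinear_compE (K : numFieldType) (E F G : normedModType K)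
  (f : clinear F G) (g : clinear E F) x : clinear_comp f g x = f (g x).
Proof. by []. Qed.

Lemma clinear_idE (K : numFieldType) (E : normedModType K) (x : E) :
  clinear_id x = x.
Proof. by []. Qed.

Definition clinE :=
  (@clinear_compE, @clinear_idE, @clinearDE, @clinearNE, @clinearZE, @clinear0E,
   @clinD, @clinN, @clinZ, @clin0).

Section OperatorNormBounds.
Context {R : realType} {E F : normedModType R}.

Lemma clinear_norm_le (f : clinear E F) x : `|f x| <= `|f| * `|x|.
Proof.
have [->|x0] := eqVneq x 0; first by rewrite linear0 !normr0 mulr0.
have := @opnorm_ub _ _ _ f (`|x|^-1 *: x).
rewrite linearZ/= !normrZ normfV normr_id mulVf ?normr_eq0// => /(_ (lexx _)).
by rewrite ler_pdivrMl ?normr_gt0// mulrC.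
Qed.

Lemma clinear_norm_bound (f : clinear E F) (C : R) : 0 <= C ->
  (forall x, `|f x| <= C * `|x|) -> `|f| <= C.
Proof.
move=> C0 fC; apply: opnorm_le => x x1; apply: le_trans (fC x) _.
by rewrite ler_piMr.
Qed.

(** Trades the little-o of [is_diff] for an explicit estimate; conversely the estimate determines
    the differential by [diff_unique]. *)
Lemma is_diffP (f : E -> F) x (L : clinear E F) : is_diff x f L <->
  forall e : R, 0 < e ->
    \forall h \near (0 : E), `|f (h + x) - f x - L h| <= e * `|h|.
Proof.
split=> [[fx fL] e e0|fL].
  have := diff_locally fx; rewrite fL => /eqaddoP/(_ e e0); apply: filterS => h.
  by rewrite !fctE /= opprD addrA.
have fL' : f \o shift x = cst (f x) + L +o_ 0 id.
  apply/eqaddoP => e e0; apply: filterS (fL e e0) => h.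
  by rewrite !fctE /= opprD addrA.
have dL := diff_unique (clinearP L).2 fL'.
split=> //; apply/diff_locallyP; rewrite dL; split=> //.
exact: (clinearP L).2.
Qed.

End OperatorNormBounds.

Section Bilinear.
Context {R : realType}.

(** A predicate on curried maps, so that evaluation, composition of operators and the Jordan product
    share one product rule. *)
Record bilinear_bounded (E F G : normedModType R) (b : E -> F -> G) : Prop :=
  BilinearBounded {
    bilinearl : forall y, linear (b^~ y);
    bilinearr : forall x, linear (b x);
    bilinear_bound : exists2 C : R, 0 < C &
      forall x y, `|b x y| <= C * `|x| * `|y| }.

Section Theory.
Context {E F G : normedModType R} {b : E -> F -> G}.
Hypothesis bb : bilinear_bounded b.

Lemma bilinearDl x x' y : b (x + x') y = b x y + b x' y.
Proof. by have := bilinearl bb y 1 x x'; rewrite !scale1r. Qed.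

Lemma bilinearDr x y y' : b x (y + y') = b x y + b x y'.
Proof. by have := bilinearr bb x 1 y y'; rewrite !scale1r. Qed.

Lemma bilinearNl x y : b (- x) y = - b x y.
Proof.
have := bilinearl bb y (-1) x x; rewrite !scaleN1r !addNr => b0.
by apply/eqP; rewrite -subr_eq0 opprK -bilinearDl addNr b0.
Qed.

Lemma bilinearNr x y : b x (- y) = - b x y.
Proof.
have := bilinearr bb x (-1) y y; rewrite !scaleN1r !addNr => b0.
by apply/eqP; rewrite -subr_eq0 opprK -bilinearDr addNr b0.
Qed.

Lemma bilinearBl x x' y : b (x - x') y = b x y - b x' y.
Proof. by rewrite bilinearDl bilinearNl. Qed.

Lemma bilinearBr x y y' : b x (y - y') = b x y - b x y'.
Proof. by rewrite bilinearDr bilinearNr. Qed.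

Lemma bilinear_cont (X : normedModType R) (f : X -> E) (g : X -> F) x :
  {for x, continuous f} -> {for x, continuous g} ->
  {for x, continuous (fun y => b (f y) (g y))}.
Proof.
move=> /cvgrPdist_le fc /cvgrPdist_le gc; apply/cvgrPdist_le => e e0.
have [C C0 bC] := bilinear_bound bb.
(* [K] collects the coefficients of [e / K] in the final estimate, where [|g y|] is at most
   [|g x| + 1]; the last [+ 1] makes it positive. *)
pose K := C * (`|g x| + 1 + `|f x|) + 1.
have K0 : 0 < K by rewrite ltr_wpDl// mulr_ge0 ?ltW// !addr_ge0.
have eK0 : 0 < e / K by rewrite divr_gt0.
near=> y.
have fxy : `|f x - f y| <= e / K by near: y; exact: fc.
have gxy : `|g x - g y| <= e / K by near: y; exact: gc.
have gxy1 : `|g x - g y| <= 1 by near: y; exact: gc.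
have gy : `|g y| <= `|g x| + 1.
  by rewrite -[g y](subKr (g x)) (le_trans (ler_normB _ _))// lerD2l.
have -> : b (f x) (g x) - b (f y) (g y) =
    b (f x - f y) (g y) + b (f x) (g x - g y).
  by rewrite bilinearBl bilinearBr; zmod.
apply: le_trans (ler_normD _ _) _; apply: le_trans (lerD (bC _ _) (bC _ _)) _.
have h1 : C * (`|f x - f y| * `|g y|) <= C * (e / K * (`|g x| + 1)).
  by rewrite ler_pM2l// ler_pM.
have h2 : C * (`|f x| * `|g x - g y|) <= C * (`|f x| * (e / K)).
  by rewrite ler_pM2l// ler_wpM2l.
have -> : e = e / K * K by rewrite divfK// gt_eqF.
by rewrite {2}/K; lra.
Unshelve. all: by end_near. Qed.

Section Post.
Context {X : normedModType R}.

Fact bilinear_compl_subproof (L : clinear X E) (y : F) :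
  (fun h => b (L h) y) \in clinear_pred.
Proof.
have [C C0 bC] := bilinear_bound bb.
apply: (@bounded_clinear_pred _ _ _ _ (C * `|L| * `|y|)).
- by move=> a x x'; rewrite linearP (bilinearl bb y).
- by rewrite !mulr_ge0// ltW.
move=> x; apply: le_trans (bC _ _) _.
by rewrite [leRHS]mulrAC ler_wpM2r// -mulrA ler_wpM2l ?clinear_norm_le// ltW.
Qed.

Definition bilinear_compl L y : clinear X G := CLinear (bilinear_compl_subproof L y).

Fact bilinear_compr_subproof (x : E) (L : clinear X F) :
  (fun h => b x (L h)) \in clinear_pred.
Proof.
have [C C0 bC] := bilinear_bound bb.
apply: (@bounded_clinear_pred _ _ _ _ (C * `|x| * `|L|)).
- by move=> a y y'; rewrite linearP (bilinearr bb x).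
- by rewrite !mulr_ge0// ltW.
move=> y; apply: le_trans (bC _ _) _.
by rewrite -!mulrA !ler_wpM2l ?clinear_norm_le// ltW.
Qed.

Definition bilinear_compr x L : clinear X G := CLinear (bilinear_compr_subproof x L).

(** Each half of the product rule is again bounded bilinear, in a derivative and the other factor;
    this is what lets [is_Ck_bilinear] induct on the order with the bilinear map generalized. *)
Lemma bilinear_compl_bounded : bilinear_bounded bilinear_compl.
Proof.
split=> [y a L L'|L a y y'|].
- by apply: clinear_ext => h; rewrite /= (bilinearl bb).
- by apply: clinear_ext => h; rewrite /= (bilinearr bb).
have [C C0 bC] := bilinear_bound bb; exists C => // L y.
apply: clinear_norm_bound => [|h /=]; first by rewrite !mulr_ge0// ltW.
apply: le_trans (bC _ _) _.
by rewrite [leRHS]mulrAC ler_wpM2r// -mulrA ler_wpM2l ?clinear_norm_le// ltW.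
Qed.

Lemma bilinear_compr_bounded : bilinear_bounded bilinear_compr.
Proof.
split=> [L a x x'|x a L L'|].
- by apply: clinear_ext => h; rewrite /= (bilinearl bb).
- by apply: clinear_ext => h; rewrite /= (bilinearr bb).
have [C C0 bC] := bilinear_bound bb; exists C => // x L.
apply: clinear_norm_bound => [|h /=]; first by rewrite !mulr_ge0// ltW.
apply: le_trans (bC _ _) _.
by rewrite -!mulrA !ler_wpM2l ?clinear_norm_le// ltW.
Qed.

Lemma is_diff_bilinear (f : X -> E) (g : X -> F) x
    (L : clinear X E) (M : clinear X F) :
  is_diff x f L -> is_diff x g M ->
  is_diff x (fun y => b (f y) (g y))
    (bilinear_compl L (g x) + bilinear_compr (f x) M).
Proof.
move=> fL gM.
have /cvgrPdist_le gc : {for x, continuous g}.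
  by apply: differentiable_continuous; exact: ex_diff.
move/is_diffP : fL => fL; move/is_diffP : gM => gM; apply/is_diffP => e e0.
have [C C0 bC] := bilinear_bound bb.
pose K := C * (`|g x| + 1 + `|L| + `|f x|) + 1.
have K0 : 0 < K by rewrite ltr_wpDl// mulr_ge0 ?ltW// !addr_ge0.
have eK0 : 0 < e / K by rewrite divr_gt0.
have gxh r : 0 < r -> \forall h \near (0 : X), `|g x - g (h + x)| <= r.
  move=> /gc /nbhs0P; apply: filterS => k; rewrite (addrC k); exact.
near=> h; rewrite clinearDE /=.
have fh : `|f (h + x) - f x - L h| <= e / K * `|h| by near: h; exact: fL.
have gh : `|g (h + x) - g x - M h| <= e / K * `|h| by near: h; exact: gM.
have g1 : `|g (h + x) - g x| <= e / K by rewrite distrC; near: h; exact: gxh.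
have g2 : `|g (h + x) - g x| <= 1 by rewrite distrC; near: h; exact: gxh.
have gy : `|g (h + x)| <= `|g x| + 1.
  by rewrite -[g (h + x)](subrK (g x)) addrC (le_trans (ler_normD _ _))// lerD2l.
have -> : b (f (h + x)) (g (h + x)) - b (f x) (g x) - (b (L h) (g x) + b (f x) (M h))
  = b (f (h + x) - f x - L h) (g (h + x)) + b (L h) (g (h + x) - g x)
    + b (f x) (g (h + x) - g x - M h).
  by rewrite !bilinearBl !bilinearBr; zmod.
have Lh := clinear_norm_le L h.
have h1 : `|b (f (h + x) - f x - L h) (g (h + x))| <=
    C * (e / K * `|h|) * (`|g x| + 1).
  by apply: le_trans (bC _ _) _; rewrite ler_pM// ?mulr_ge0 ?ler_pM2l// ltW.
have h2 : `|b (L h) (g (h + x) - g x)| <= C * (`|L| * `|h|) * (e / K).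
  by apply: le_trans (bC _ _) _; rewrite ler_pM// ?mulr_ge0 ?ler_pM2l// ltW.
have h3 : `|b (f x) (g (h + x) - g x - M h)| <= C * `|f x| * (e / K * `|h|).
  by apply: le_trans (bC _ _) _; rewrite ler_wpM2l// ?mulr_ge0 ?ler_pM2l// ltW.
apply: le_trans (ler_normD _ _) _.
apply: le_trans (lerD (ler_normD _ _) (lexx _)) _.
have -> : e * `|h| = e / K * K * `|h| by rewrite divfK// gt_eqF.
apply: le_trans (lerD (lerD h1 h2) h3) _.
have t0 : 0 <= e / K * `|h| by rewrite mulr_ge0// ltW.
move: t0; set t := e / K; rewrite /K => t0.
by lra.
Unshelve. all: by end_near. Qed.

End Post.
End Theory.
End Bilinear.

(** * Calculus of [C^n] maps *)

Section CkMaps.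
Context {R : realType}.
Implicit Types E F G X : normedModType R.

Lemma is_diff_continuous E F (f : E -> F) x df :
  is_diff x f df -> {for x, continuous f}.
Proof. by move=> ?; apply: differentiable_continuous; exact: ex_diff. Qed.

Lemma is_CkW n E F (U : set E) (f : E -> F) : is_Ck n.+1 U f -> is_Ck n U f.
Proof.
elim: n F f => [|n IH] F f [df [fdf dfC]].
  by move=> x Ux; exact: is_diff_continuous (fdf x Ux).
by exists df; split=> //; exact: IH.
Qed.

Lemma is_Ck_continuous n E F (U : set E) (f : E -> F) x :
  is_Ck n U f -> U x -> {for x, continuous f}.
Proof.
by elim: n => [|n IH] in F f *; [exact|move/is_CkW; exact: IH].
Qed.

Lemma is_Ck_sub n E F (U V : set E) (f : E -> F) :
  V `<=` U -> is_Ck n U f -> is_Ck n V f.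
Proof.
move=> VU; elim: n F f => [|n IH] F f; first by move=> fc x /VU; exact: fc.
by move=> [df [fdf dfC]]; exists df; split; [move=> x /VU; exact: fdf|exact: IH].
Qed.

Lemma is_Ck_cst n E F (U : set E) (a : F) : is_Ck n U (fun=> a).
Proof.
elim: n F a => [|n IH] F a; first by move=> x _; exact: cst_continuous.
by exists (fun=> 0); split=> [x _|]; [exact: is_diff_cst|exact: IH].
Qed.

Lemma is_diff_clinear E F (L : clinear E F) x : is_diff x L L.
Proof.
apply/is_diffP => e e0; near=> h.
by rewrite linearD addrK subrr normr0 mulr_ge0// ltW.
Unshelve. all: by end_near. Qed.

Lemma is_Ck_clinear n E F (U : set E) (L : clinear E F) : is_Ck n U L.
Proof.
case: n => [|n]; first by move=> x _; exact: (clinearP L).2.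
by exists (fun=> L); split=> [x _|]; [exact: is_diff_clinear|exact: is_Ck_cst].
Qed.

Lemma is_CkD n E F (U : set E) (f g : E -> F) :
  is_Ck n U f -> is_Ck n U g -> is_Ck n U (fun x => f x + g x).
Proof.
elim: n F f g => [|n IH] F f g.
  by move=> fc gc x Ux; apply: continuousD; [exact: fc|exact: gc].
move=> [df [fdf dfC]] [dg [gdg dgC]]; exists (fun x => df x + dg x); split.
  by move=> x Ux; apply: is_diffD; [exact: fdf|exact: gdg].
exact: IH.
Qed.

Lemma is_Ck_bilinear n E F G X (b : E -> F -> G) (U : set X)
    (f : X -> E) (g : X -> F) : bilinear_bounded b ->
  is_Ck n U f -> is_Ck n U g -> is_Ck n U (fun x => b (f x) (g x)).
Proof.
elim: n E F G b f g => [|n IH] E F G b f g bb fC gC.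
  by move=> x Ux; apply: bilinear_cont; [|exact: fC|exact: gC].
have [df [fdf dfC]] := fC; have [dg [gdg dgC]] := gC.
exists (fun x => bilinear_compl bb (df x) (g x) + bilinear_compr bb (f x) (dg x)).
split=> [x Ux|]; first by apply: is_diff_bilinear; [exact: fdf|exact: gdg].
apply: is_CkD; apply: IH => //; try exact: is_CkW.
- exact: bilinear_compl_bounded.
- exact: bilinear_compr_bounded.
Qed.

Lemma eval_bilinear E F : bilinear_bounded (fun (L : clinear E F) (x : E) => L x).
Proof.
split=> [x a L M|L a x y|]; [by []|exact: linearP|].
by exists 1 => // L x; rewrite mul1r clinear_norm_le.
Qed.

Lemma clinear_comp_bilinear E F G :
  bilinear_bounded (@clinear_comp _ E F G).
Proof.
split=> [M a L L'|L a M M'|].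
- by apply: clinear_ext.
- by apply: clinear_ext => x; rewrite /= linearP.
exists 1 => // L M; rewrite mul1r.
apply: clinear_norm_bound => [|x /=]; first by rewrite mulr_ge0.
apply: le_trans (clinear_norm_le _ _) _.
by rewrite -mulrA ler_wpM2l// clinear_norm_le.
Qed.

Lemma is_Ck_post n E F X (U : set X) (L : clinear E F) (f : X -> E) :
  is_Ck n U f -> is_Ck n U (fun x => L (f x)).
Proof.
move=> fC; apply: (is_Ck_bilinear (@eval_bilinear E F)) => //.
exact: is_Ck_cst.
Qed.

(** The chain rule gives a derivative that is bounded bilinear in [dg \o f] and [df]; the first of
    these is handled by the induction hypothesis. *)
Lemma is_Ck_comp n E F G (U : set E) (V : set F) (f : E -> F) (g : F -> G) :
  (forall x, U x -> V (f x)) ->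
  is_Ck n U f -> is_Ck n V g -> is_Ck n U (fun x => g (f x)).
Proof.
move=> UV; elim: n G g => [|n IH] G g.
  move=> fC gC x Ux; apply: (@continuous_comp _ _ _ f g); first exact: fC.
  by apply: gC; exact: UV.
move=> fC [dg [gdg dgC]]; have [df [fdf dfC]] := fC.
exists (fun x => clinear_comp (dg (f x)) (df x)); split=> [x Ux|].
  by apply: (@is_diff_comp _ _ _ _ f _ g); [exact: fdf|apply: gdg; exact: UV].
apply: (is_Ck_bilinear (@clinear_comp_bilinear E F G)) => //.
by apply: IH => //; exact: is_CkW.
Qed.

Section Inverse.
Context {E X : normedModType R} (U : set X) (L J : X -> clinear E E) (C : R).
Hypothesis JL : forall y, U y -> clinear_comp (J y) (L y) = clinear_id.
Hypothesis LJ : forall y, U y -> clinear_comp (L y) (J y) = clinear_id.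
Hypothesis JC : forall y, U y -> `|J y| <= C.

Let LJE y e : U y -> L y (J y e) = e.
Proof. by move=> /LJ /(congr1 (fun f : clinear E E => f e)). Qed.

Let JLE y e : U y -> J y (L y e) = e.
Proof. by move=> /JL /(congr1 (fun f : clinear E E => f e)). Qed.

(** The resolvent identity [J y - J x = - J y (L y - L x) J x]. *)
Lemma inverse_dist x y : U x -> U y ->
  `|J y - J x| <= C * (`|L y - L x| * C).
Proof.
move=> Ux Uy; have C0 : 0 <= C by exact: le_trans (JC Ux).
apply: clinear_norm_bound => [|e]; first by rewrite !mulr_ge0.
have -> : (J y - J x) e = - J y ((L y - L x) (J x e)).
  by rewrite !clinearBE linearB/= JLE// LJE// opprB.
rewrite normrN (le_trans (clinear_norm_le _ _))// -!mulrA ler_pM ?JC//.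
rewrite (le_trans (clinear_norm_le _ _))// ler_wpM2l//.
by rewrite (le_trans (clinear_norm_le _ _))// ler_wpM2r// JC.
Qed.

Hypothesis oU : open U.

Let Unear x : U x -> \forall y \near x, U y.
Proof. by move=> Ux; exact: open_nbhs_nbhs. Qed.

Lemma inverse_continuous x : U x ->
  {for x, continuous L} -> {for x, continuous J}.
Proof.
move=> Ux /cvgrPdist_le Lc; apply/cvgrPdist_le => e e0.
have C0 : 0 <= C by exact: le_trans (JC Ux).
have K0 : 0 < C * C + 1 by rewrite ltr_wpDl// mulr_ge0.
near=> y.
have Uy : U y by near: y; exact: Unear.
have Lxy : `|L x - L y| <= e / (C * C + 1).
  by near: y; apply: Lc; rewrite divr_gt0.
apply: le_trans (inverse_dist Uy Ux) _.
rewrite mulrCA (le_trans (ler_wpM2r _ Lxy)) ?mulr_ge0//.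
by rewrite mulrAC ler_pdivrMr// ler_pM2l// lerDl.
Unshelve. all: by end_near. Qed.

Lemma is_diff_inverse x (dL : clinear X (clinear E E)) : U x ->
  is_diff x L dL ->
  is_diff x J (- bilinear_compr (@clinear_comp_bilinear E E E) (J x)
    (bilinear_compl (@clinear_comp_bilinear E E E) dL (J x))).
Proof.
move=> Ux LdL; have C0 : 0 <= C by exact: le_trans (JC Ux).
have Lc := is_diff_continuous LdL.
have Uhx0 : \forall h \near (0 : X), U (h + x).
  have /nbhs0P := Unear Ux.
  by apply: filterS => h; rewrite (addrC h).
have Ldist r : 0 < r -> \forall h \near (0 : X), `|L (h + x) - L x| <= r.
  move: Lc => /cvgrPdist_le Lc /Lc /nbhs0P; apply: filterS => h.
  by rewrite (addrC h) distrC.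
have JD h : U (h + x) ->
    `|J (h + x) - J x| <= C * (`|L (h + x) - L x| * C).
  exact: inverse_dist.
apply/is_diffP => e e0; pose K := C * C + C * C * C * `|dL| + 1.
have K0 : 0 < K by rewrite ltr_wpDl// addr_ge0 ?mulr_ge0.
have eK0 : 0 < e / K by rewrite divr_gt0.
move/is_diffP : LdL => LdL; near=> h.
have Uhx : U (h + x) by near: h.
have Lh : `|L (h + x) - L x| <= e / K by near: h; exact: Ldist.
have dLh : `|L (h + x) - L x - dL h| <= e / K * `|h|.
  by near: h; exact: LdL.
apply: clinear_norm_bound => [|v]; first by rewrite mulr_ge0// ltW.
have -> : (J (h + x) - J x - (- bilinear_compr (@clinear_comp_bilinear E E E) (J x)
    (bilinear_compl (@clinear_comp_bilinear E E E) dL (J x))) h) v =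
   - J (h + x) ((L (h + x) - L x - dL h) (J x v)) -
   (J (h + x) - J x) (dL h (J x v)).
  rewrite !clinearBE !clinearNE /= !linearB/= JLE// LJE//.
  by zmod.
apply: le_trans (ler_normB _ _) _; rewrite normrN.
have h1 : `|J (h + x) ((L (h + x) - L x - dL h) (J x v))| <=
    C * (e / K * `|h| * (C * `|v|)).
  rewrite (le_trans (clinear_norm_le _ _))// ler_pM ?JC//.
  rewrite (le_trans (clinear_norm_le _ _))// ler_pM//.
  by rewrite (le_trans (clinear_norm_le _ _))// ler_wpM2r// JC.
have h2 : `|(J (h + x) - J x) (dL h (J x v))| <=
    C * (e / K * C) * (`|dL| * `|h| * (C * `|v|)).
  rewrite (le_trans (clinear_norm_le _ _))// ler_pM//.
    by rewrite (le_trans (JD _ Uhx))// ler_wpM2l// ler_wpM2r.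
  rewrite (le_trans (clinear_norm_le _ _))// ler_pM// ?clinear_norm_le//.
  by rewrite (le_trans (clinear_norm_le _ _))// ler_wpM2r// JC.
apply: le_trans (lerD h1 h2) _.
have -> : e * `|h| * `|v| = e / K * K * `|h| * `|v| by rewrite divfK// gt_eqF.
have : 0 <= e / K * `|h| * `|v| by rewrite mulr_ge0// mulr_ge0// ltW.
set t := e / K; rewrite /K => t0.
by lra.
Unshelve. all: by end_near. Qed.

(** The derivative of [J] is a product of [J], the derivative of [L] and [J] again, so each order of
    smoothness of [J] yields the next one. *)
Lemma is_Ck_inverse n : is_Ck n U L -> is_Ck n U J.
Proof.
elim: n => [|n IH] LC; first by move=> x Ux; exact: inverse_continuous (LC x Ux).
have [dL [LdL dLC]] := LC; have JCn := IH (is_CkW LC).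
eexists; split=> [x Ux|]; first exact: is_diff_inverse (LdL x Ux).
(* Negation as postcomposition with a continuous linear map, the form that [is_Ck_post] accepts. *)
pose N := - (@clinear_id _ (clinear X (clinear E E))).
apply: (@is_Ck_post _ _ _ _ _ N).
apply: (is_Ck_bilinear (bilinear_compr_bounded _)) => //.
exact: (is_Ck_bilinear (bilinear_compl_bounded _)).
Qed.

End Inverse.

End CkMaps.

(** * The inverse function theorem *)

Section InverseFunction.
Context {R : realType} {E : completeNormedModType R}.

Lemma contraction_fixpoint (D : set E) (f : E -> E) (c : R) :
  closed D -> D !=set0 -> (forall x, D x -> D (f x)) -> 0 <= c < 1 ->
  (forall x y, D x -> D y -> `|f x - f y| <= c * `|x - y|) ->
  exists2 x, D x & f x = x.
Proof.
move=> Dc D0 Df /andP[c0 c1] fc.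
pose fD : {fun D >-> D} := HB.pack f (isFun.Build E E D D f Df).
have [|//|//|x Dx xE] := @banach_fixed_point R E D fD.
  exists (NngNum c0); split=> //= -[x y] [Dx Dy] /=.
  exact: fc.
by exists x.
Qed.

Lemma is_diff_norm_le (F : normedModType R) (f : E -> F) x (L : clinear E F)
    (c : R) : 0 <= c -> is_diff x f L ->
  (\forall h \near (0 : E), `|f (h + x) - f x| <= c * `|h|) -> `|L| <= c.
Proof.
move=> c0 /is_diffP fL fc; apply/ler_addgt0Pr => e e0.
have /nbhs_norm0P[d /= d0 Ld] : \forall h \near (0 : E), `|L h| <= (c + e) * `|h|.
  near=> h.
  have fh : `|f (h + x) - f x| <= c * `|h| by near: h.
  have fLh : `|f (h + x) - f x - L h| <= e * `|h| by near: h; exact: fL.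
  rewrite mulrDl -[L h](subKr (f (h + x) - f x)).
  by rewrite (le_trans (ler_normB _ _))// lerD.
apply: clinear_norm_bound => [|h]; first by rewrite addr_ge0// ltW.
have [->|h0] := eqVneq h 0; first by rewrite clin0 !normr0 mulr0.
(* The estimate holds only near [0]; by homogeneity it is enough to test a small multiple of [h]. *)
have [k k0 hk] : exists2 k : R, 0 < k & k * `|h| < d.
  exists (d / 2 / `|h|); first by rewrite !divr_gt0// normr_gt0.
  by rewrite divfK ?normr_eq0// ltr_pdivrMr// ltr_pMr// ltr1n.
have : `|L (k *: h)| <= (c + e) * `|k *: h|.
  by apply: Ld; rewrite /= normrZ (gtr0_norm k0).
by rewrite clinZ !normrZ (gtr0_norm k0) mulrCA ler_pM2l.
Unshelve. all: by end_near. Qed.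

(** In place of a Neumann series, solutions are fixed points of [x |-> y - Q x], a contraction of
    ratio 1/2. The lower bound [|x| <= 2 |x + Q x|] gives both injectivity and the norm of [J]. *)
Lemma pert_id_inverse (Q : clinear E E) : `|Q| <= 2^-1 ->
  exists J : clinear E E,
    [/\ clinear_comp J (clinear_id + Q) = clinear_id,
        clinear_comp (clinear_id + Q) J = clinear_id & `|J| <= 2].
Proof.
move=> Q2; pose L := clinear_id + Q.
have LE x : L x = x + Q x by [].
have Ql x : `|Q x| <= 2^-1 * `|x|.
  by apply: le_trans (clinear_norm_le _ _) _; rewrite ler_wpM2r.
have Llow x : `|x| <= 2 * `|L x|.
  have : `|x| <= `|L x| + `|Q x|.
    by rewrite -{1}[x](addrK (Q x)) LE ler_normB.
  have := Ql x; lra.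
have Linj x y : L x = L y -> x = y.
  move=> xy; apply/eqP; rewrite -subr_eq0 -normr_le0.
  apply: le_trans (Llow _) _.
  have -> : L (x - y) = L x - L y by exact: clinB.
  by rewrite xy subrr normr0 mulr0.
have Lsurj y : exists x, L x = y.
  have [||//||x z _ _|x _ xE] :=
    @contraction_fixpoint setT (fun x => y - Q x) 2^-1.
  - exact: closedT.
  - by exists 0.
  - by lra.
  - have -> : y - Q x - (y - Q z) = Q (z - x).
      by rewrite clinB; zmod.
    by rewrite (distrC x) Ql.
  by exists x; rewrite LE -{1}xE subrK.
pose J y := sval (cid (Lsurj y)).
have LJ y : L (J y) = y by rewrite /J; case: cid.
have Jlin : linear J.
  by move=> a x y; apply: Linj; rewrite clinD clinZ !LJ.
have Jb x : `|J x| <= 2 * `|x| by rewrite -{2}(LJ x) Llow.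
exists (mk_clinear Jlin (ler0n R 2) Jb); split.
- by apply: clinear_ext => x; exact: Linj (LJ (L x)).
- by apply: clinear_ext => x; exact: LJ x.
- exact: clinear_norm_bound.
Qed.


Section LocalInverse.
Variables (q : E -> E) (r : R).
Hypotheses (r0 : 0 < r) (qC : smooth_on setT q) (q0 : q 0 = 0).
Hypothesis qr : forall x y, `|x| < r -> `|y| < r ->
  `|q x - q y| <= 2^-1 * `|x - y|.

Let phi x := x + q x.
(** Why radius [r / 2] in the target: a solution of [phi x = y] is found with [|x| <= 2 |y|], so
    preimages of points of [V] stay strictly inside the ball of radius [r]. Outside [V] the map
    [psi] may take the default value [0]. *)
Let U := [set x : E | `|x| < r /\ `|phi x| < r / 2].
Let V := [set y : E | `|y| < r / 2].
Let psi y := xget 0 [set x : E | `|x| < r /\ phi x = y].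

Let q_cont : continuous q.
Proof. by move=> x; exact: (qC 0). Qed.

Let phi_cont : continuous phi.
Proof. by move=> x; apply: continuousD; [exact: id|exact: q_cont]. Qed.

Let normball (F : normedModType R) (c : R) : open [set x : F | `|x| < c].
Proof.
apply: (@open_comp _ _ (fun x : F => `|x|) [set t | t < c]).
  by move=> x _; exact: norm_continuous.
exact: open_lt.
Qed.

Let openV : open V. Proof. exact: normball. Qed.

Let openU : open U.
Proof.
have -> : U = [set x | `|x| < r] `&` phi @^-1` V by [].
by apply: openI; [exact: normball|apply: open_comp => // x _; exact: phi_cont].
Qed.

Let phi_low x y : `|x| < r -> `|y| < r -> `|x - y| <= 2 * `|phi x - phi y|.
Proof.
move=> xr yr; have := qr xr yr.
have : `|x - y| <= `|phi x - phi y| + `|q x - q y|.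
  have {1}-> : x - y = phi x - phi y - (q x - q y) by rewrite /phi; zmod.
  exact: ler_normB.
lra.
Qed.

Let phi_surj y : V y -> exists2 x, `|x| < r & phi x = y.
Proof.
rewrite /V /= => yr; pose D := [set x : E | `|x| <= 2 * `|y|].
have Dr x : D x -> `|x| < r by rewrite /D /=; lra.
have q2 x : `|x| < r -> `|q x| <= 2^-1 * `|x|.
  by move=> xr; have := qr xr (y := 0); rewrite q0 !subr0 normr0; apply.
have [||x Dx|||x Dx xE] := @contraction_fixpoint D (fun x => y - q x) 2^-1.
- apply: (@closed_comp _ _ (fun x : E => `|x|) [set t | t <= 2 * `|y|]).
    by move=> x _; exact: norm_continuous.
  exact: closed_le.
- by exists 0; rewrite /D /= normr0 mulr_ge0.
- have := q2 x (Dr x Dx); have := ler_normB y (q x).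
  by move: Dx; rewrite /D /=; lra.
- by lra.
- move=> x z Dx Dz; have -> : y - q x - (y - q z) = q z - q x by zmod.
  by rewrite distrC qr//; exact: Dr.
exists x; first exact: Dr.
by rewrite /phi -{1}xE subrK.
Qed.

Let psiP y : V y -> `|psi y| < r /\ phi (psi y) = y.
Proof.
move=> /phi_surj[x xr xy].
by have := @xgetPex _ 0 [set x : E | `|x| < r /\ phi x = y]; apply; exists x.
Qed.

Let phiK x : U x -> psi (phi x) = x.
Proof.
move=> [xr phixr]; have [pr pE] := psiP phixr.
apply/eqP; rewrite -subr_eq0 -normr_le0.
by apply: le_trans (phi_low pr xr) _; rewrite pE subrr normr0 mulr0.
Qed.

Let psiU y : V y -> U (psi y).
Proof. by move=> Vy; have [pr pE] := psiP Vy; split=> //; rewrite pE. Qed.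

Let psi_dist y z : V y -> V z -> `|psi y - psi z| <= 2 * `|y - z|.
Proof.
move=> Vy Vz; have [yr yE] := psiP Vy; have [zr zE] := psiP Vz.
by rewrite -{2}yE -{2}zE; exact: phi_low.
Qed.

Let Vnear y : V y -> \forall z \near y, V z.
Proof. by move=> Vy; exact: open_nbhs_nbhs. Qed.

Let psi_cont y : V y -> {for y, continuous psi}.
Proof.
move=> Vy; apply/cvgrPdist_le => e e0; near=> z.
have Vz : V z by near: z; exact: Vnear.
apply: le_trans (psi_dist Vy Vz) _.
rewrite -ler_pdivlMl//; near: z.
have /cvgrPdist_le : (id : E -> E) @ y --> y by exact: cvg_id.
by apply; rewrite mulr_gt0// invr_gt0.
Unshelve. all: by end_near. Qed.

(** The Lipschitz constant 1/2 of [q] bounds [dq] by 1/2 throughout the ball, so [1 + dq] is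
    invertible there with inverses bounded by 2, and these inverses are the derivatives of [psi]. *)
Lemma local_diffeomorphism :
  [/\ open U, U 0, open V & diffeomorphism U V phi].
Proof.
have V0 : V 0 by rewrite /V /= normr0 divr_gt0.
have U0 : U 0 by split; rewrite /= ?/phi ?q0 ?addr0 normr0 ?divr_gt0.
split=> //; exists psi; split=> //.
- apply/seteqP; split=> [_ [x [_ ?] <-//]|y Vy].
  by exists (psi y); [exact: psiU|exact: (psiP Vy).2].
- apply/seteqP; split=> [_ [y Vy <-]|x Ux]; first exact: psiU.
  by exists (phi x); [exact: Ux.2|exact: phiK].
- move=> n; apply: is_CkD; first exact: (@is_Ck_clinear _ n _ _ _ clinear_id).
  by apply: is_Ck_sub (qC n).
have [dq [qdq _]] := qC 1.
have dq2 x : `|x| < r -> `|dq x| <= 2^-1.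
  move=> xr; apply: (is_diff_norm_le _ (qdq x I)) => //.
  have /nbhs0P : \forall z \near x, `|z| < r.
    by apply: open_nbhs_nbhs; split => //; exact: normball.
  apply: filterS => h hr.
  by rewrite (addrC h) (le_trans (qr hr xr))// [x + h]addrC addrK.
(* The value [0] outside the ball only makes [J] total for [choice]. *)
have Jex x : exists J : clinear E E, `|x| < r ->
    [/\ clinear_comp J (clinear_id + dq x) = clinear_id,
        clinear_comp (clinear_id + dq x) J = clinear_id & `|J| <= 2].
  have [xr|_] := ltP `|x| r; last by exists 0.
  by have [J JP] := pert_id_inverse (dq2 _ xr); exists J.
have [J JP] := choice Jex.
have phid x : is_diff x phi (clinear_id + dq x).
  by apply: is_diffD; exact: qdq.
have psid y : V y -> is_diff y psi (J (psi y)).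
  move=> Vy; have [pr pE] := psiP Vy; have [JL LJ J2] := JP _ pr.
  apply/is_diffP => e e0.
  have e40 : 0 < e / 4 by rewrite divr_gt0.
  have /is_diffP/(_ _ e40)/nbhs_norm0P[d /= d0 dphi] := phid (psi y).
  have d20 : 0 < d / 2 by rewrite divr_gt0.
  have hV : \forall h \near (0 : E), V (h + y).
    have /nbhs0P := Vnear Vy.
    by apply: filterS => h; rewrite (addrC h).
  near=> h.
  have Vhy : V (h + y) by near: h.
  have hd : `|h| < d / 2.
    by near: h; apply/nbhs_norm0P; exists (d / 2).
  pose k := psi (h + y) - psi y.
  have kh : `|k| <= 2 * `|h|.
    by apply: le_trans (psi_dist Vhy Vy) _; rewrite addrK.
  have := dphi k; rewrite /= subrK pE (psiP Vhy).2 addrK.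
  have -> : h - (clinear_id + dq (psi y)) k =
      (clinear_id + dq (psi y)) (J (psi y) h - k).
    have LJh : (clinear_id + dq (psi y)) (J (psi y) h) = h.
      exact: (congr1 (fun f : clinear E E => f h) LJ).
    by rewrite [RHS]clinB LJh.
  move=> /(_ _)/wrap[|hk]; first by lra.
  rewrite distrC.
  have -> : J (psi y) h - k =
      J (psi y) ((clinear_id + dq (psi y)) (J (psi y) h - k)).
    exact/esym/(congr1 (fun f : clinear E E => f (J (psi y) h - k)) JL).
  apply: le_trans (clinear_norm_le _ _) _.
  apply: le_trans (ler_pM _ _ J2 hk) _ => //.
  have : e * `|k| <= e * (2 * `|h|) by rewrite ler_wpM2l// ltW.
  by lra.
(* The derivative [J (psi y)] inverts [1 + dq (psi y)], which is of class [C^n] as soon as [psi] is;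
   so [psi] gains one order at each turn. *)
elim=> [|n IH]; first exact: psi_cont.
exists (fun y => J (psi y)); split=> //.
apply: (@is_Ck_inverse _ E E V (fun y => clinear_id + dq (psi y)) _ 2) => //.
- by move=> y /psiP[/JP[]].
- by move=> y /psiP[/JP[]].
- by move=> y /psiP[/JP[]].
apply: is_CkD; first exact: is_Ck_cst.
have [dq' [qdq' dqC']] := qC n.+1.
(* The derivative witnessing the higher order is a priori another map; uniqueness of differentials
   identifies the two. *)
have <- : dq' = dq.
  apply/funext => x; apply: clinear_ext => h.
  by have [_ <-] := qdq' x I; have [_ <-] := qdq x I.
exact: (@is_Ck_comp _ n _ _ _ V setT).
Unshelve. all: by end_near. Qed.

End LocalInverse.

End InverseFunction.

(** * Hilbert spaces and Parseval *)

Section HilbertNorm.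
Context {R : realType}.
Implicit Types c d : R[i].

(** Norms of a normed module over [R[i]] are themselves elements of [R[i]]; [cabs] and [nrm] move
    them to [R], where the order is total and [lra] applies. *)
Definition cabs c : R := complex.Re `|c|.

Lemma cabsE c : (cabs c)%:C = `|c|.
Proof. by rewrite RRe_real// normr_real. Qed.

Lemma cabs_ge0 c : 0 <= cabs c.
Proof. by rewrite -lecR cabsE normr_ge0. Qed.

Lemma cabs0 : cabs 0 = 0.
Proof. by apply: (@complexI R); rewrite cabsE normr0. Qed.

Lemma cabsM c d : cabs (c * d) = cabs c * cabs d.
Proof. by apply: (@complexI R); rewrite rmorphM/= !cabsE normrM. Qed.

Lemma cabsD c d : cabs (c + d) <= cabs c + cabs d.
Proof. by rewrite -lecR rmorphD/= !cabsE ler_normD. Qed.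

Lemma cabsN c : cabs (- c) = cabs c.
Proof. by rewrite /cabs normrN. Qed.

Lemma cabsB c d : cabs (c - d) <= cabs c + cabs d.
Proof. by rewrite (le_trans (cabsD _ _))// cabsN. Qed.

Lemma cabs_conj c : cabs (Num.conj c) = cabs c.
Proof. by rewrite /cabs norm_conjC. Qed.

Lemma cabs_real (k : R) : cabs k%:C = `|k|.
Proof.
by apply: (@complexI R); rewrite cabsE normc_def/= expr0n/= addr0 sqrtr_sqr.
Qed.

Lemma cabs_sqr c : (cabs c ^+ 2)%:C = c * Num.conj c.
Proof. by rewrite rmorphXn/= cabsE normCK. Qed.

Lemma cabs_eq0 c : (cabs c == 0) = (c == 0).
Proof. by rewrite -(inj_eq (@complexI R)) cabsE normr_eq0. Qed.

Lemma Re_le_cabs c : complex.Re c <= cabs c.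
Proof.
rewrite -lecR cabsE normc_def lecR (le_trans (ler_norm _))//.
by rewrite -sqrtr_sqr ler_wsqrtr// lerDl sqr_ge0.
Qed.

Lemma Im_le_cabs c : `|complex.Im c| <= cabs c.
Proof.
rewrite -lecR cabsE normc_def lecR.
by rewrite -sqrtr_sqr ler_wsqrtr// lerDr sqr_ge0.
Qed.

Section Norm.
Context {V : normedModType R[i]}.
Implicit Types x y : V.

Definition nrm x : R := complex.Re `|x|.

Lemma nrmE x : (nrm x)%:C = `|x|.
Proof. by rewrite RRe_real// normr_real. Qed.

Lemma nrm_ge0 x : 0 <= nrm x.
Proof. by rewrite -lecR nrmE normr_ge0. Qed.

Lemma nrm0 : nrm 0 = 0.
Proof. by apply: (@complexI R); rewrite nrmE normr0. Qed.

Lemma nrm_eq0 x : (nrm x == 0) = (x == 0).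
Proof. by rewrite -(inj_eq (@complexI R)) nrmE normr_eq0. Qed.

Lemma nrm_gt0 x : (0 < nrm x) = (x != 0).
Proof. by rewrite lt_def nrm_ge0 nrm_eq0 andbT. Qed.

Lemma nrmD x y : nrm (x + y) <= nrm x + nrm y.
Proof. by rewrite -lecR rmorphD/= !nrmE ler_normD. Qed.

Lemma nrmN x : nrm (- x) = nrm x.
Proof. by rewrite /nrm normrN. Qed.

Lemma nrmB x y : nrm (x - y) <= nrm x + nrm y.
Proof. by rewrite (le_trans (nrmD _ _))// nrmN. Qed.

Lemma nrmC x y : nrm (x - y) = nrm (y - x).
Proof. by rewrite -nrmN opprB. Qed.

Lemma nrmZ c x : nrm (c *: x) = cabs c * nrm x.
Proof. by apply: (@complexI R); rewrite rmorphM/= nrmE cabsE nrmE normrZ. Qed.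

Lemma nrmZr (k : R) x : nrm (k%:C *: x) = `|k| * nrm x.
Proof. by rewrite nrmZ cabs_real. Qed.

Lemma cvg_nrmP {T} (F : set_system T) {FF : Filter F} (f : T -> V) y :
  f @ F --> y <-> forall e : R, 0 < e -> \forall t \near F, nrm (y - f t) <= e.
Proof.
rewrite cvgrPdist_le; split=> fy e e0.
  have /fy : 0 < e%:C by rewrite ltcR.
  by apply: filterS => t; rewrite -nrmE lecR.
have [k eE] : exists k, e = k%:C by apply/complex_realP/gtr0_real.
move: e0; rewrite eE ltcR => /fy.
by apply: filterS => t; rewrite -nrmE lecR.
Qed.

End Norm.

Lemma clinear_nrm_bounded {V W : normedModType R[i]} (a : clinear V W) :
  exists2 C : R, 0 < C & forall x, nrm (a x) <= C * nrm x.
Proof.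
have [C C0 aC] := clinear_bounded a.
have [k CE] : exists k, C = k%:C by apply/complex_realP/gtr0_real.
rewrite CE in C0 aC; exists k; first by rewrite -ltcR.
by move=> x; rewrite -lecR rmorphM/= !nrmE.
Qed.

Lemma nrm_clinear_pred {V W : normedModType R[i]} (f : V -> W) (C : R) :
  linear f -> 0 <= C -> (forall x, nrm (f x) <= C * nrm x) ->
  f \in clinear_pred.
Proof.
move=> fl C0 fC; apply: (@bounded_clinear_pred _ _ _ _ C%:C) => //.
  by rewrite lecR.
by move=> x; rewrite -!nrmE -rmorphM/= lecR.
Qed.

End HilbertNorm.

Local Notation "''[' u , v ]" := (@hdot _ _ u v) : ring_scope.

Section HilbertDot.
Context {R : realType} {H : hilbertType R}.
Implicit Types x y z : H.
Local Notation BH := (clinear H H).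
Implicit Types a b : BH.

Lemma hdot0l x : '[0, x] = 0. Proof. exact: linear0l. Qed.
Lemma hdot0r x : '[x, 0] = 0. Proof. exact: linear0r. Qed.
Lemma hdotDl x y z : '[x + y, z] = '[x, z] + '[y, z].
Proof. exact: linearDl. Qed.
Lemma hdotDr x y z : '[x, y + z] = '[x, y] + '[x, z].
Proof. exact: linearDr. Qed.
Lemma hdotNl x y : '[- x, y] = - '[x, y]. Proof. exact: linearNl. Qed.
Lemma hdotNr x y : '[x, - y] = - '[x, y]. Proof. exact: linearNr. Qed.
Lemma hdotBl x y z : '[x - y, z] = '[x, z] - '[y, z].
Proof. exact: linearBl. Qed.
Lemma hdotBr x y z : '[x, y - z] = '[x, y] - '[x, z].
Proof. exact: linearBr. Qed.
Lemma hdotZl c x y : '[c *: x, y] = c * '[x, y].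
Proof. exact: linearZl_LR. Qed.
Lemma hdotZr c x y : '[x, c *: y] = Num.conj c * '[x, y].
Proof. by rewrite linearZr_LR. Qed.

Lemma hdot_suml I (r : seq I) (P : pred I) (F : I -> H) y :
  '[\sum_(i <- r | P i) F i, y] = \sum_(i <- r | P i) '[F i, y].
Proof. by elim/big_rec2: _ => [|i s t _ <-]; rewrite (hdot0l,hdotDl). Qed.

Lemma hdot_sumr I (r : seq I) (P : pred I) (F : I -> H) y :
  '[y, \sum_(i <- r | P i) F i] = \sum_(i <- r | P i) '[y, F i].
Proof. by elim/big_rec2: _ => [|i s t _ <-]; rewrite (hdot0r,hdotDr). Qed.

Lemma hdot_nrm x : '[x, x] = (nrm x ^+ 2)%:C.
Proof. by rewrite hdotE -nrmE -rmorphXn. Qed.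

Lemma hdot_ext x y : (forall z, '[x, z] = '[y, z]) -> x = y.
Proof.
move=> xy; apply/eqP; rewrite -subr_eq0 -nrm_eq0 -sqrf_eq0.
by rewrite -(inj_eq (@complexI R)) -hdot_nrm hdotBl xy subrr.
Qed.

Lemma cabs_hdotC x y : cabs '[x, y] = cabs '[y, x].
Proof. by rewrite hdotC cabs_conj. Qed.

(** The squared norm of [|y|^2 x - <x, y> y] equals [|y|^2] times the difference of the squared
    sides. *)
Lemma cauchy_schwarz x y : cabs '[x, y] <= nrm x * nrm y.
Proof.
have [->|y0] := eqVneq y 0; first by rewrite hdot0r cabs0 mulr_ge0 ?nrm_ge0.
have ny : 0 < nrm y by rewrite nrm_gt0.
rewrite -(@ler_pXn2r _ 2) ?nnegrE ?mulr_ge0 ?nrm_ge0 ?cabs_ge0//.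
have : 0 <= nrm ((nrm y ^+ 2)%:C *: x - '[x, y] *: y) ^+ 2 by rewrite sqr_ge0.
have -> : nrm ((nrm y ^+ 2)%:C *: x - '[x, y] *: y) ^+ 2 =
    nrm y ^+ 2 * ((nrm x * nrm y) ^+ 2 - cabs '[x, y] ^+ 2).
  apply: (@complexI R); rewrite -[LHS]hdot_nrm hdotBl !hdotBr !hdotZl !hdotZr.
  rewrite !hdot_nrm [RHS]rmorphM [X in _ = _ * X]rmorphB exprMn.
  rewrite [X in _ = _ * (X - _)]rmorphM/= cabs_sqr (hdotC y x).
  rewrite [Num.conj (_)%:C]conjc_real.
  set n := (_)%:C; set m := (_)%:C; set d := '[x, y]; set d' := Num.conj d.
  by ring.
by rewrite pmulr_rge0 ?exprn_gt0// subr_ge0.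
Qed.

Lemma nrmD_sqr x y :
  nrm (x + y) ^+ 2 = nrm x ^+ 2 + nrm y ^+ 2 + 2 * complex.Re '[x, y].
Proof.
apply: (@complexI R); rewrite -hdot_nrm hdotDl !hdotDr !hdot_nrm.
have E : (2 * complex.Re '[x, y])%:C = '[x, y] + Num.conj '[x, y].
  by rewrite rmorphM/= (_ : 2%:C = 2) ?rmorph_nat// -addcJ.
rewrite (hdotC y x) [RHS]rmorphD/= E [(_ + _)%:C]rmorphD/=.
by ring.
Qed.

Lemma nrmB_sqr x y :
  nrm (x - y) ^+ 2 = nrm x ^+ 2 + nrm y ^+ 2 - 2 * complex.Re '[x, y].
Proof. by rewrite nrmD_sqr nrmN hdotNr raddfN mulrN. Qed.

Lemma is_adjoint_sym a b : is_adjoint a b -> is_adjoint b a.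
Proof. by move=> ab x y; rewrite hdotC -ab -hdotC. Qed.

Lemma is_adjoint_uniq a b b' : is_adjoint a b -> is_adjoint a b' -> b = b'.
Proof.
move=> /is_adjoint_sym ab /is_adjoint_sym ab'; apply: clinear_ext => x.
by apply: hdot_ext => y; rewrite ab ab'.
Qed.

Lemma is_adjointD a a' b b' : is_adjoint a a' -> is_adjoint b b' ->
  is_adjoint (a + b) (a' + b').
Proof. by move=> aa bb x y; rewrite !clinearDE hdotDl hdotDr aa bb. Qed.

Lemma is_adjointN a a' : is_adjoint a a' -> is_adjoint (- a) (- a').
Proof. by move=> aa x y; rewrite !clinearNE hdotNl hdotNr aa. Qed.

Lemma is_adjointB a a' b b' : is_adjoint a a' -> is_adjoint b b' ->
  is_adjoint (a - b) (a' - b').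
Proof. by move=> aa bb; apply: is_adjointD => //; exact: is_adjointN. Qed.

Lemma is_adjointZ c a a' : is_adjoint a a' ->
  is_adjoint (c *: a) (Num.conj c *: a').
Proof. by move=> aa x y; rewrite !clinearZE hdotZl hdotZr conjCK aa. Qed.

Lemma is_adjoint_id : is_adjoint (@clinear_id _ H) clinear_id.
Proof. by []. Qed.

Lemma is_adjoint0 : is_adjoint (0 : BH) 0.
Proof. by move=> x y; rewrite !clinear0E hdot0l hdot0r. Qed.

Lemma is_adjoint_comp a a' b b' : is_adjoint a a' -> is_adjoint b b' ->
  is_adjoint (clinear_comp a b) (clinear_comp b' a').
Proof. by move=> aa bb x y; rewrite /= aa bb. Qed.

Lemma is_adjoint_sum I (r : seq I) (P : pred I) (f g : I -> BH) :
  (forall i, P i -> is_adjoint (f i) (g i)) ->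
  is_adjoint (\sum_(i <- r | P i) f i) (\sum_(i <- r | P i) g i).
Proof.
move=> fg; elim/big_rec2: _ => [|i s t Pi]; first exact: is_adjoint0.
by apply: is_adjointD; exact: fg.
Qed.

End HilbertDot.

Section HilbertComplete.
Context {R : realType} {V : completeNormedModType R[i]}.

Lemma nrm_cauchy_cvg {T} (F : set_system T) {FF : ProperFilter F} (f : T -> V) :
  (forall e : R, 0 < e -> exists x, \forall t \near F, nrm (x - f t) < e) ->
  exists y : V, f @ F --> y.
Proof.
move=> fc; apply/cvg_ex/cauchy_cvgP/cauchy_exP => e e0.
have [k eE] : exists k, e = k%:C by apply/complex_realP/gtr0_real.
move: e0; rewrite eE ltcR => /fc[x xF]; exists x.
apply: filterS xF => t; rewrite -ball_normE/=.
by rewrite -nrmE ltcR.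
Qed.

Lemma nrm_cauchy_seq (u : nat -> V) :
  (forall e : R, 0 < e -> exists N, forall n, (N <= n)%N -> nrm (u N - u n) < e) ->
  exists y, forall e : R, 0 < e -> exists N, forall n, (N <= n)%N -> nrm (y - u n) <= e.
Proof.
move=> uc; have [e e0|y uy] := @nrm_cauchy_cvg _ \oo _ u.
  have [N uN] := uc e e0; exists (u N); exists N => // n; exact: uN.
exists y => e e0; move/cvg_nrmP : uy => /(_ e e0)[N _ uN].
by exists N => n; exact: uN.
Qed.

End HilbertComplete.

(** * Bessel's inequality and Parseval's identity through finite subfamilies *)

Section Parseval.
Context {R : realType} {H : hilbertType R}.
Implicit Types x y z : H.
Variable B : set H.
Hypothesis oB : orthonormal_basis B.

Let B1 e : B e -> '[e, e] = 1. Proof. by case: oB => + _ _; exact. Qed.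

Let B0 e f : B e -> B f -> e <> f -> '[e, f] = 0.
Proof. by case: oB => _ + _; exact. Qed.

Definition basis_seq (s : seq H) := uniq s /\ forall e, e \in s -> B e.

Lemma basis_seq_cat s t : basis_seq s -> basis_seq t ->
  basis_seq (undup (s ++ t)).
Proof.
move=> [us sB] [ut tB]; split; first exact: undup_uniq.
by move=> e; rewrite mem_undup mem_cat => /orP[/sB|/tB].
Qed.

Lemma hdot_osum (c : H -> R[i]) s e : basis_seq s -> B e ->
  '[\sum_(f <- s) c f *: f, e] = if e \in s then c e else 0.
Proof.
move=> [us sB] Be; rewrite hdot_suml; case: ifPn => es; last first.
  rewrite big_seq big1// => f fs; rewrite hdotZl B0 ?mulr0//; first exact: sB.
  by move=> fe; rewrite -fe fs in es.
rewrite (bigD1_seq e)//= hdotZl B1// mulr1 big_seq_cond big1 ?addr0// => f.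
by move=> /andP[fs /eqP fe]; rewrite hdotZl B0 ?mulr0//; exact: sB.
Qed.

Definition oproj s x := \sum_(e <- s) '[x, e] *: e.

Lemma oproj_dist s x : basis_seq s ->
  nrm (x - oproj s x) ^+ 2 = nrm x ^+ 2 - \sum_(e <- s) cabs '[x, e] ^+ 2.
Proof.
move=> sb; have h1 : '[x, oproj s x] = (\sum_(e <- s) cabs '[x, e] ^+ 2)%:C.
  rewrite hdot_sumr rmorph_sum; apply: eq_bigr => e _.
  by rewrite hdotZr mulrC [RHS]cabs_sqr.
have h2 : '[oproj s x, oproj s x] = (\sum_(e <- s) cabs '[x, e] ^+ 2)%:C.
  rewrite {2}/oproj hdot_sumr rmorph_sum big_seq [RHS]big_seq.
  apply: eq_bigr => e es; have Be := sb.2 _ es.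
  by rewrite hdotZr hdot_osum// es mulrC [RHS]cabs_sqr.
rewrite nrmB_sqr h1 /=; have /complexI -> : (nrm (oproj s x) ^+ 2)%:C =
    (\sum_(e <- s) cabs '[x, e] ^+ 2)%:C by rewrite -h2 hdot_nrm.
by lra.
Qed.

Lemma basis_bessel s x : basis_seq s ->
  \sum_(e <- s) cabs '[x, e] ^+ 2 <= nrm x ^+ 2.
Proof.
by move=> sb; rewrite -subr_ge0 -oproj_dist// sqr_ge0.
Qed.

Lemma oproj_sub s t x : basis_seq s -> basis_seq t -> {subset s <= t} ->
  nrm (oproj t x - oproj s x) ^+ 2 =
  \sum_(e <- t) cabs '[x, e] ^+ 2 - \sum_(e <- s) cabs '[x, e] ^+ 2.
Proof.
move=> sb tb st; have ptx e : e \in t -> '[oproj t x, e] = '[x, e].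
  by move=> et; rewrite hdot_osum// ?et//; exact: tb.2.
have -> : oproj s x = oproj s (oproj t x).
  by rewrite /oproj; apply: eq_big_seq => e /st/ptx ->.
rewrite oproj_dist//; congr (_ - _); last first.
  by apply: eq_big_seq => e /st/ptx ->.
apply: (@complexI R); rewrite -hdot_nrm {2}/oproj hdot_sumr rmorph_sum.
by apply: eq_big_seq => e et; rewrite hdotZr ptx// mulrC [RHS]cabs_sqr.
Qed.

(** Projections onto finite families with Bessel sum within [d n ^+ 2] of the supremum form a Cauchy
    sequence. What their limit leaves of [x] is orthogonal to the whole basis, hence zero. The
    finite form with an error [eps] is the one that [hs_bessel] consumes. *)
Lemma parseval x (eps : R) : 0 < eps -> exists2 s, basis_seq s &
  nrm x ^+ 2 <= \sum_(e <- s) cabs '[x, e] ^+ 2 + eps.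
Proof.
move=> eps0; pose S := [set \sum_(e <- s) cabs '[x, e] ^+ 2 | s in basis_seq].
have Ssup : has_sup S.
  split; first by exists 0, [::]; rewrite ?big_nil//; split.
  by exists (nrm x ^+ 2) => _ [s sb <-]; exact: basis_bessel.
have Sub s : basis_seq s -> \sum_(e <- s) cabs '[x, e] ^+ 2 <= sup S.
  by move=> sb; apply: ub_le_sup; [exact: Ssup.2|exists s].
pose d (n : nat) : R := n.+1%:R^-1.
have d0 n : 0 < d n by rewrite invr_gt0.
have dmono n m : (n <= m)%N -> d m <= d n.
  by move=> nm; rewrite lef_pV2 ?posrE// ler_nat.
have dlim (e : R) : 0 < e -> exists N, d N < e.
  move=> e0; have [N _ Ne] := near_infty_natSinv_lt (PosNum e0).
  by exists N; exact: Ne (leqnn N).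
have sex n : exists s, basis_seq s /\
    sup S - d n ^+ 2 < \sum_(e <- s) cabs '[x, e] ^+ 2.
  have [_ [s sb <-] sS] := sup_adherent (exprn_gt0 2 (d0 n)) Ssup.
  by exists s.
have [s sP] := choice sex; pose y n := oproj (s n) x.
have y_union n t : basis_seq t -> {subset s n <= t} ->
    nrm (oproj t x - y n) <= d n.
  move=> tb st; have [sb sS] := sP n.
  rewrite -(@ler_pXn2r _ 2) ?nnegrE ?nrm_ge0 ?(ltW (d0 _))//.
  by rewrite oproj_sub//; have := Sub t tb; lra.
have y_dist n m : nrm (y n - y m) <= d n + d m.
  pose t := undup (s n ++ s m).
  have tb : basis_seq t by apply: basis_seq_cat; [exact: (sP n).1|exact: (sP m).1].
  have -> : y n - y m = (oproj t x - y m) - (oproj t x - y n) by zmod.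
  apply: le_trans (nrmB _ _) _; rewrite addrC lerD// y_union// => e es.
    by rewrite mem_undup mem_cat es.
  by rewrite mem_undup mem_cat es orbT.
have [l yl] : exists l, forall e : R, 0 < e ->
    exists N, forall n, (N <= n)%N -> nrm (l - y n) <= e.
  apply: nrm_cauchy_seq => e e0; have [|N Ne] := dlim (e / 2).
    by rewrite divr_gt0.
  exists N => n Nn; apply: le_lt_trans (y_dist _ _) _.
  by have := dmono _ _ Nn; lra.
have xl : x = l.
  apply/eqP; rewrite -subr_eq0; apply/eqP; case: oB => _ _; apply => e Be.
  apply/eqP; rewrite -cabs_eq0 eq_le cabs_ge0 andbT; apply/ler_addgt0Pr => r r0.
  rewrite add0r; have r20 : 0 < r / 2 by rewrite divr_gt0.
  have [N1 yN] := yl (r / 2) r20; have [N2 dN] := dlim (r / 2) r20.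
  pose n := maxn N1 N2.
  have -> : '[x - l, e] = '[x - y n, e] - '[l - y n, e].
    by rewrite -hdotBl; congr '[_, _]; zmod.
  apply: le_trans (cabsB _ _) _.
  have h1 : cabs '[l - y n, e] <= r / 2.
    apply: le_trans (cauchy_schwarz _ _) _.
    have -> : nrm e = 1.
      apply/eqP; rewrite -(@eqrXn2 _ 2) ?nrm_ge0// expr1n.
      by rewrite -(inj_eq (@complexI R)) -hdot_nrm B1.
    by rewrite mulr1; apply: yN; rewrite leq_maxl.
  suff : cabs '[x - y n, e] <= d n.
    by have := dmono _ _ (leq_maxr N1 N2); rewrite -/n; lra.
  have [sb sS] := sP n; rewrite hdotBl hdot_osum//.
  case: ifPn => es; first by rewrite subrr cabs0 ltW.
  (* Adding [e] to the family cannot push the Bessel sum beyond its supremum, so the coefficient of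
     [x] at [e] is at most [d n]. *)
  have eb : basis_seq (e :: s n).
    split; first by rewrite /= es sb.1.
    by move=> f; rewrite inE => /predU1P[->//|]; exact: sb.2.
  rewrite subr0 -(@ler_pXn2r _ 2) ?nnegrE ?cabs_ge0 ?(ltW (d0 _))//.
  by have := Sub _ eb; rewrite big_cons; lra.
have [r r0 rE] : exists2 r : R, 0 < r & r ^+ 2 <= eps.
  exists (Num.sqrt eps); first by rewrite sqrtr_gt0.
  by rewrite sqr_sqrtr// ltW.
have [N yN] := yl r r0; exists (s N); first exact: (sP N).1.
have := yN N (leqnn N); rewrite -xl => xyN.
rewrite -lerBlDl -oproj_dist; last exact: (sP N).1.
apply: le_trans rE; rewrite ler_pXn2r ?nnegrE ?nrm_ge0//; exact: ltW.
Qed.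

End Parseval.

(** * Hilbert-Schmidt operators *)

Section HilbertSchmidtTheory.
Context {R : realType} {H : hilbertType R}.
Implicit Types x y z : H.
Local Notation BH := (clinear H H).
Implicit Types a b u v : BH.
Local Notation B := (@hilbert_basis R H).

Let oB : orthonormal_basis B := hilbert_basisP.

Lemma hs_energyE a : hilbert_schmidt a -> hs_energy a = (hs_norm a ^+ 2)%:E.
Proof.
move=> aHS; rewrite /hs_norm sqr_sqrtr ?fine_ge0 ?hs_energy_ge0//.
by rewrite fineK// ge0_fin_numE ?hs_energy_ge0.
Qed.

Let Re_nrm x : complex.Re '[x, x] = nrm x ^+ 2.
Proof. by rewrite hdot_nrm. Qed.

(** Replaces the extended sum by sums over finite lists, the form in which Hilbert-Schmidt estimates
    are proved below. *)
Lemma hs_normP a (M : R) : 0 <= M ->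
  (hilbert_schmidt a /\ hs_norm a <= M) <->
  forall s, basis_seq B s -> \sum_(e <- s) nrm (a e) ^+ 2 <= M ^+ 2.
Proof.
move=> M0; split=> [[aHS aM] s [us sB]|aM].
  rewrite (@le_trans _ _ (hs_norm a ^+ 2))//; last first.
    by rewrite ler_pXn2r ?nnegrE ?hs_norm_ge0.
  rewrite -lee_fin -hs_energyE//; apply: ereal_sup_ubound.
  exists [set` s]; first by split=> //; exact: finite_seq.
  rewrite -fsbig_seq// -sumEFin; apply: eq_bigr => e _.
  by rewrite Re_nrm.
have eM : (hs_energy a <= (M ^+ 2)%:E)%E.
  apply: ge_ereal_sup => _ [A [Af AB] <-].
  rewrite fsbig_finite//= sumEFin lee_fin.
  under eq_bigr do rewrite Re_nrm.
  apply: aM; split; first exact: finmap.fset_uniq.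
  by move=> e; rewrite in_fset_set// inE; exact: AB.
have aHS : hilbert_schmidt a by rewrite /hilbert_schmidt (le_lt_trans eM) ?ltry.
split=> //; rewrite -(@ler_pXn2r _ 2) ?nnegrE ?hs_norm_ge0//.
by rewrite -lee_fin -hs_energyE.
Qed.

Let sum_sub (T : eqType) (s t : seq T) (F : T -> R) : uniq s -> uniq t ->
  {subset s <= t} -> (forall i, 0 <= F i) ->
  \sum_(i <- s) F i <= \sum_(i <- t) F i.
Proof.
move=> us ut st F0; rewrite [leRHS](bigID (mem s))/= -[X in _ <= X + _]big_filter.
rewrite [X in _ <= X + _](perm_big s)/=; first by rewrite lerDl sumr_ge0.
apply: uniq_perm; rewrite ?filter_uniq// => i; rewrite mem_filter.
by apply: andb_idr; exact: st.
Qed.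

(* Expanding [b (f i)] in the basis and exchanging the two summations turns
   the sum into one over the basis of the Bessel sums of the [a e]. *)
Lemma hs_bessel a b I (r : seq I) (f : I -> H) (K : R) :
  is_adjoint a b -> hilbert_schmidt a ->
  (forall z, \sum_(i <- r) cabs '[z, f i] ^+ 2 <= K * nrm z ^+ 2) ->
  \sum_(i <- r) nrm (b (f i)) ^+ 2 <= K * hs_norm a ^+ 2.
Proof.
move=> ab aHS fK; have adjE x y : cabs '[b x, y] = cabs '[a y, x].
  by rewrite ab cabs_hdotC.
(* A negative [K] forces all norms to vanish, and then both sides are zero. *)
have K0 : 0 <= K \/ forall z, nrm z = 0.
  have [K0|K0] := leP 0 K; first by left.
  right => z; apply/eqP; rewrite -sqrf_eq0 eq_le sqr_ge0 andbT.
  rewrite -(ler_nM2l K0) mulr0; apply: le_trans (fK z).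
  by apply: sumr_ge0 => i _; exact: sqr_ge0.
case: K0 => [K0|n0]; last first.
  rewrite big1 => [|i _]; last by rewrite n0 expr0n.
  suff -> : hs_norm a = 0 by rewrite expr0n mulr0.
  apply/eqP; rewrite eq_le hs_norm_ge0 andbT.
  have [_] := hs_normP a (lexx 0); move=> [] // s _.
  by rewrite big1 ?sqr_ge0// => e _; rewrite n0 expr0n.
have texp : forall (eps : R), 0 < eps -> exists2 t, basis_seq B t &
    \sum_(i <- r) nrm (b (f i)) ^+ 2 <=
    \sum_(i <- r) \sum_(e <- t) cabs '[b (f i), e] ^+ 2 + eps.
  elim: r {fK} => [|i r IH] eps eps0.
    by exists [::]; rewrite ?big_nil ?add0r ?ltW//; split.
  have e20 : 0 < eps / 2 by rewrite divr_gt0.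
  have [s sb sle] := parseval oB (b (f i)) e20; have [t tb tle] := IH _ e20.
  exists (undup (s ++ t)); first exact: basis_seq_cat.
  rewrite !big_cons [eps]splitr addrACA lerD//.
    apply: le_trans sle _; rewrite lerD2r; apply: sum_sub.
    + exact: sb.1.
    + exact: undup_uniq.
    + by move=> e es; rewrite mem_undup mem_cat es.
    + by move=> e; exact: sqr_ge0.
  apply: le_trans tle _; rewrite lerD2r; apply: ler_sum => j _; apply: sum_sub.
  + exact: tb.1.
  + exact: undup_uniq.
  + by move=> e es; rewrite mem_undup mem_cat es orbT.
  + by move=> e; exact: sqr_ge0.
apply/ler_addgt0Pr => eps eps0; have [t tb tle] := texp eps eps0.
apply: le_trans tle _; rewrite lerD2r exchange_big/=.
apply: (@le_trans _ _ (\sum_(e <- t) K * nrm (a e) ^+ 2)).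
  apply: ler_sum => e _; apply: le_trans (fK (a e)).
  by apply: ler_sum => i _; rewrite adjE.
rewrite -mulr_sumr ler_wpM2l//.
by have [+ _] := hs_normP a (hs_norm_ge0 a); apply.
Qed.

(** [hs_bessel] for families of basis vectors, where Bessel's inequality gives [K = 1]. *)
Lemma hs_adjoint a b : is_adjoint a b -> hilbert_schmidt a ->
  hilbert_schmidt b /\ hs_norm b <= hs_norm a.
Proof.
move=> ab aHS; apply/hs_normP; first exact: hs_norm_ge0.
move=> s sb; rewrite -[leRHS]mul1r; apply: (hs_bessel ab aHS) => z.
by rewrite mul1r; exact: (basis_bessel oB).
Qed.

Lemma hs_norm_adjoint a b : is_adjoint a b -> hilbert_schmidt a ->
  hs_norm b = hs_norm a.
Proof.
move=> ab aHS; have [bHS ba] := hs_adjoint ab aHS.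
have [_ ab'] := hs_adjoint (is_adjoint_sym ab) bHS.
by apply/eqP; rewrite eq_le ba.
Qed.

(** [hs_bessel] for the one-element family [[:: x]], where Cauchy-Schwarz gives [K = |x|^2]. *)
Lemma hs_norm_op a b x : is_adjoint a b -> hilbert_schmidt a ->
  nrm (a x) <= hs_norm a * nrm x.
Proof.
move=> ab aHS; have [bHS ba] := hs_adjoint ab aHS.
rewrite -(hs_norm_adjoint ab aHS) -(@ler_pXn2r _ 2) ?nnegrE ?mulr_ge0 ?nrm_ge0 ?hs_norm_ge0//.
have := @hs_bessel b a _ [:: x] id (nrm x ^+ 2) (is_adjoint_sym ab) bHS.
rewrite big_seq1 mulrC exprMn; apply => z; rewrite big_seq1 -exprMn mulrC.
by rewrite ler_pXn2r ?nnegrE ?mulr_ge0 ?nrm_ge0 ?cabs_ge0// cauchy_schwarz.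
Qed.

Lemma hs_compl u a (C : R) : 0 <= C -> (forall x, nrm (u x) <= C * nrm x) ->
  hilbert_schmidt a -> hilbert_schmidt (clinear_comp u a) /\
    hs_norm (clinear_comp u a) <= C * hs_norm a.
Proof.
move=> C0 uC aHS; apply/hs_normP; first by rewrite mulr_ge0 ?hs_norm_ge0.
move=> s sb; rewrite exprMn.
apply: (@le_trans _ _ (C ^+ 2 * \sum_(e <- s) nrm (a e) ^+ 2)).
  rewrite mulr_sumr; apply: ler_sum => e _; rewrite -exprMn.
  by rewrite ler_pXn2r ?nnegrE ?mulr_ge0 ?nrm_ge0//; exact: uC.
rewrite ler_wpM2l ?sqr_ge0//.
by have [+ _] := hs_normP a (hs_norm_ge0 a); apply.
Qed.

(** Adjoints turn right multiplication by [v] into left multiplication by [v'], which is why the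
    bound is asked of [v']. *)
Lemma hs_compr a a' v v' (C : R) : is_adjoint a a' -> is_adjoint v v' ->
  0 <= C -> (forall x, nrm (v' x) <= C * nrm x) ->
  hilbert_schmidt a -> hilbert_schmidt (clinear_comp a v) /\
    hs_norm (clinear_comp a v) <= C * hs_norm a.
Proof.
move=> aa vv C0 vC aHS; have [a'HS a'a] := hs_adjoint aa aHS.
have [va'HS va'] := hs_compl C0 vC a'HS.
have avadj := is_adjoint_comp aa vv.
have [avHS av] := hs_adjoint (is_adjoint_sym avadj) va'HS.
by split=> //; rewrite (le_trans av)// (le_trans va')// ler_wpM2l.
Qed.

Lemma hs_normN a : hilbert_schmidt a ->
  hilbert_schmidt (- a) /\ hs_norm (- a) = hs_norm a.
Proof.
move=> aHS; have -> : - a = (-1 : R)%:C *: a.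
  by rewrite rmorphN rmorph1 scaleN1r.
by split; [exact: hilbert_schmidtZ|rewrite hs_normZ// normrN normr1 mul1r].
Qed.

Lemma hilbert_schmidtB a b : hilbert_schmidt a -> hilbert_schmidt b ->
  hilbert_schmidt (a - b).
Proof. by move=> aHS bHS; apply: hilbert_schmidtD => //; case: (hs_normN bHS). Qed.

Lemma ler_hs_normB a b : hilbert_schmidt a -> hilbert_schmidt b ->
  hs_norm (a - b) <= hs_norm a + hs_norm b.
Proof.
move=> aHS bHS; have [nbHS nb] := hs_normN bHS.
by rewrite (le_trans (ler_hs_normD aHS nbHS))// nb.
Qed.

Lemma hs_norm0 : hs_norm (0 : BH) = 0.
Proof.
have [_ aM] := hs_normP (0 : BH) (lexx 0).
apply/eqP; rewrite eq_le hs_norm_ge0 andbT; apply: (aM _).2 => s _.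
by rewrite big1 ?sqr_ge0// => e _; rewrite clinear0E nrm0 expr0n.
Qed.

Lemma hs_sum I (r : seq I) (P : pred I) (f : I -> BH) :
  (forall i, P i -> hilbert_schmidt (f i)) ->
  hilbert_schmidt (\sum_(i <- r | P i) f i) /\
  hs_norm (\sum_(i <- r | P i) f i) <= \sum_(i <- r | P i) hs_norm (f i).
Proof.
move=> fHS; elim: r => [|i r [IHS IH]].
  rewrite !big_nil; split; first exact: hilbert_schmidt0.
  by rewrite hs_norm0; exact: lexx.
rewrite !big_cons; case: ifP => // Pi; split.
  by apply: hilbert_schmidtD => //; exact: fHS.
by rewrite (le_trans (ler_hs_normD (fHS i Pi) IHS))// lerD2l.
Qed.

Lemma hs_sa_normE (k : hs_sa H) : `|k| = hs_norm k.
Proof. by []. Qed.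

Lemma hs_sa_op (k : hs_sa H) x : nrm (k x) <= `|k| * nrm x.
Proof. by have [kHS ksa] := hs_saP k; exact: hs_norm_op ksa kHS. Qed.

Lemma hs_sa_addE (k l : hs_sa H) : (k + l : hs_sa H) = (k : BH) + (l : BH) :> BH.
Proof. by []. Qed.

Lemma hs_sa_oppE (k : hs_sa H) : (- k : hs_sa H) = - (k : BH) :> BH.
Proof. by []. Qed.

Lemma hs_sa_scaleE (r : R) (k : hs_sa H) : (r *: k : hs_sa H) = r%:C *: (k : BH) :> BH.
Proof. by []. Qed.

Lemma hs_sa_inj (k l : hs_sa H) : k = l :> BH -> k = l.
Proof. by move=> kl; exact: val_inj. Qed.

Lemma hs_sa_pack a : hilbert_schmidt a -> self_adjoint a ->
  exists k : hs_sa H, k = a :> BH.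
Proof.
move=> aHS asa; have ap : a \in @hs_sa_pred R H by apply/asboolP.
by exists (HsSa ap).
Qed.

(** Pointwise limits exist because the Hilbert-Schmidt norm dominates the operator norm. Finite
    square sums pass to the limit with a bound independent of the list, so the limit is
    Hilbert-Schmidt and the convergence takes place in [hs_norm]. *)
Lemma hs_sa_cauchy_cvg (F : set_system (hs_sa H)) :
  ProperFilter F -> cauchy F -> cvg F.
Proof.
move=> FF /cauchyP Fc.
have Fnear (e : R) : 0 < e -> exists k0 : hs_sa H, \forall k \near F, `|k0 - k| < e.
  by move=> /Fc[k0 k0F]; exists k0; move: k0F; rewrite -ball_normE.
have Lex x : exists y : H, (fun k : hs_sa H => k x) @ F --> y.
  apply: nrm_cauchy_cvg => e e0.
  have d0 : 0 < e / (nrm x + 1) by rewrite divr_gt0// ltr_wpDl ?nrm_ge0.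
  have [k0 k0F] := Fnear _ d0; exists (k0 x); apply: filterS k0F => k kk.
  have -> : k0 x - k x = (k0 - k : hs_sa H) x by [].
  apply: le_lt_trans (hs_sa_op _ _) _.
  apply: le_lt_trans (ler_wpM2r (nrm_ge0 _) (ltW kk)) _.
  rewrite mulrAC ltr_pdivrMr ?ltr_wpDl ?nrm_ge0//.
  by rewrite ltr_pM2l// ltrDl.
have [L LP] := choice Lex.
have Lnear x (e : R) : 0 < e -> \forall k \near F, nrm (L x - (k : hs_sa H) x) <= e.
  by move=> e0; have /cvg_nrmP := LP x; exact.
have nrm0P (z : H) : (forall e : R, 0 < e -> nrm z <= e) -> z = 0.
  move=> ze; apply/eqP; rewrite -nrm_eq0 eq_le nrm_ge0 andbT.
  by apply/ler_addgt0Pr => e e0; rewrite add0r ze.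
have Llin : linear L.
  move=> c x y; apply/eqP; rewrite -subr_eq0; apply/eqP/nrm0P => e e0.
  have e30 : 0 < e / 3 by rewrite divr_gt0.
  have ce0 : 0 < e / 3 / (cabs c + 1).
    by rewrite divr_gt0// ltr_wpDl ?cabs_ge0.
  near F => k.
  have h1 : nrm (L (c *: x + y) - k (c *: x + y)) <= e / 3.
    by near: k; exact: Lnear.
  have h2 : nrm (L x - k x) <= e / 3 / (cabs c + 1).
    by near: k; exact: Lnear.
  have h3 : nrm (L y - k y) <= e / 3 by near: k; exact: Lnear.
  have -> : L (c *: x + y) - (c *: L x + L y) =
     (L (c *: x + y) - k (c *: x + y)) - (c *: (L x - k x) + (L y - k y)).
    by rewrite clinD clinZ scalerBr; zmod.
  apply: le_trans (nrmB _ _) _.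
  have h4 := nrmD (c *: (L x - k x)) (L y - k y).
  have h5 : nrm (c *: (L x - k x)) <= e / 3.
    rewrite nrmZ; apply: le_trans (ler_wpM2l (cabs_ge0 _) h2) _.
    rewrite mulrCA ler_piMr ?(ltW e30)//.
    by rewrite ler_pdivrMr ?mul1r ?lerDl// ltr_wpDl ?cabs_ge0.
  by lra.
have Lsum s (e : R) : 0 < e ->
    \forall k \near F, \sum_(f <- s) nrm (L f - (k : hs_sa H) f) ^+ 2 <= e.
  elim: s e => [|f s IH] e e0; first by near=> k; rewrite big_nil ltW.
  have e20 : 0 < e / 2 by rewrite divr_gt0.
  near=> k; rewrite big_cons [e]splitr lerD//; last by near: k; exact: IH.
  have Lf : nrm (L f - k f) <= Num.sqrt (e / 2).
    by near: k; apply: Lnear; rewrite sqrtr_gt0.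
  rewrite -[leRHS](sqr_sqrtr (ltW e20)).
  by rewrite ler_pXn2r ?nnegrE ?nrm_ge0 ?sqrtr_ge0.
(* The factor 2 comes from [(a + b)^2 <= 2 a^2 + 2 b^2], applied termwise with both sums at most
   [e ^+ 2]. *)
have Fdist (k0 : hs_sa H) (e : R) s : 0 < e -> (\forall k \near F, `|k0 - k| < e) ->
    basis_seq B s -> \sum_(f <- s) nrm (L f - k0 f) ^+ 2 <= (2 * e) ^+ 2.
  move=> e0 k0F sb; near F => k.
  have h1 : \sum_(f <- s) nrm (L f - k f) ^+ 2 <= e ^+ 2.
    by near: k; apply: Lsum; rewrite exprn_gt0.
  have h2 : \sum_(f <- s) nrm (k f - k0 f) ^+ 2 <= e ^+ 2.
    have [+ _] := hs_normP (k - k0 : hs_sa H) (ltW e0); apply=> //.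
    split; first exact: (hs_saP _).1.
    have k0k : `|k0 - k| < e by near: k.
    by rewrite -hs_sa_normE distrC ltW.
  have : \sum_(f <- s) nrm (L f - k0 f) ^+ 2 <=
      2 * \sum_(f <- s) nrm (L f - k f) ^+ 2 + 2 * \sum_(f <- s) nrm (k f - k0 f) ^+ 2.
    rewrite -mulrDr -big_split/= mulr_sumr; apply: ler_sum => f _.
    have -> : L f - k0 f = (L f - k f) + (k f - k0 f) by zmod.
    have := nrmD (L f - k f) (k f - k0 f).
    have := nrm_ge0 (L f - k f + (k f - k0 f)).
    have := nrm_ge0 (L f - k f); have := nrm_ge0 (k f - k0 f).
    set p := nrm _; set q := nrm (L f - k f); set r := nrm (_ + _) => p0 q0 r0 rpq.
    have : r ^+ 2 <= (q + p) ^+ 2 by rewrite ler_pXn2r ?nnegrE ?addr_ge0.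
    have := sqr_ge0 (p - q); lra.
  lra.
have Lk0 (k0 : hs_sa H) (e : R) x : 0 < e -> (\forall k \near F, `|k0 - k| < e) ->
    nrm (L x - k0 x) <= e * nrm x.
  move=> e0 k0F; apply/ler_addgt0Pr => d d0; near F => k.
  have h1 : nrm (L x - k x) <= d by near: k; exact: Lnear.
  have kk0 : `|k - k0| <= e by rewrite distrC ltW//; near: k.
  have h2 : nrm ((k - k0 : hs_sa H) x) <= e * nrm x.
    by apply: le_trans (hs_sa_op _ _) _; rewrite ler_wpM2r ?nrm_ge0.
  have -> : L x - k0 x = (L x - k x) + (k - k0 : hs_sa H) x.
    have E : (k - k0 : hs_sa H) x = k x - k0 x by [].
    by rewrite E; zmod.
  by apply: le_trans (nrmD _ _) _; lra.
have [k1 k1F] := Fnear 1 ltr01.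
have Lp : L \in @clinear_pred _ H H.
  apply: (@nrm_clinear_pred _ _ _ _ (1 + `|k1|)) => // x.
  have := Lk0 k1 1 x ltr01 k1F; have := hs_sa_op k1 x.
  have : nrm (L x) <= nrm (L x - k1 x) + nrm (k1 x).
    by rewrite -{1}[L x](subrK (k1 x)) nrmD.
  lra.
pose LC : BH := CLinear Lp.
have LCk0 (k0 : hs_sa H) (e : R) : 0 < e -> (\forall k \near F, `|k0 - k| < e) ->
    hilbert_schmidt (LC - k0) /\ hs_norm (LC - k0) <= 2 * e.
  move=> e0 k0F; apply/hs_normP; first by rewrite mulr_ge0// ltW.
  by move=> s sb; exact: Fdist.
have LCsa : self_adjoint LC.
  move=> x y; apply/eqP; rewrite -subr_eq0 -cabs_eq0 eq_le cabs_ge0 andbT.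
  apply/ler_addgt0Pr => e e0; rewrite add0r.
  pose C := nrm x + nrm y + 1.
  have C0 : 0 < C by rewrite ltr_wpDl// addr_ge0 ?nrm_ge0.
  have eC0 : 0 < e / C by rewrite divr_gt0.
  near F => k.
  have h1 : nrm (L x - k x) <= e / C by near: k; exact: Lnear.
  have h2 : nrm (L y - k y) <= e / C by near: k; exact: Lnear.
  have -> : '[LC x, y] - '[x, LC y] = '[L x - k x, y] - '[x, L y - k y].
    by rewrite hdotBl hdotBr ((hs_saP k).2 x y); zmod.
  apply: le_trans (cabsB _ _) _.
  have h3 : cabs '[L x - k x, y] <= e / C * nrm y.
    by apply: le_trans (cauchy_schwarz _ _) _; rewrite ler_wpM2r ?nrm_ge0.
  have h4 : cabs '[x, L y - k y] <= nrm x * (e / C).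
    by apply: le_trans (cauchy_schwarz _ _) _; rewrite ler_wpM2l ?nrm_ge0.
  have : e / C * nrm y + nrm x * (e / C) + e / C = e.
    rewrite (mulrC (nrm x)) -mulrDr -[X in _ + X]mulr1 -mulrDr (addrC (nrm y)).
    by rewrite divfK// gt_eqF.
  lra.
have LCHS : hilbert_schmidt LC.
  rewrite -[LC](subrK (k1 : BH)); apply: hilbert_schmidtD.
    exact: (LCk0 k1 1 ltr01 k1F).1.
  exact: (hs_saP k1).1.
have [l lE] := hs_sa_pack LCHS LCsa.
apply/cvg_ex; exists l; apply/cvgrPdist_le => e e0.
have e30 : 0 < e / 3 by rewrite divr_gt0.
have [k0 k0F] := Fnear _ e30; near=> k.
have h1 : `|k0 - k| < e / 3 by near: k.
have h2 : `|l - k0| <= 2 * (e / 3).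
  by rewrite hs_sa_normE hs_sa_addE hs_sa_oppE lE; exact: (LCk0 k0 _ e30 k0F).2.
have -> : l - k = (l - k0) + (k0 - k) by zmod.
by apply: le_trans (ler_normD _ _) _; lra.
Unshelve. all: by end_near. Qed.

End HilbertSchmidtTheory.

HB.instance Definition _ (R : realType) (H : hilbertType R) :=
  Uniform_isComplete.Build (hs_sa H) (@hs_sa_cauchy_cvg R H).


(** * Orbits, polynomials of operators and spectra *)

Section UnitaryOrbit.
Context {R : realType} {H : hilbertType R}.
Local Notation BH := (clinear H H).
Implicit Types (u v A X Y : BH) (x y : H).

(** Adjointness is a relation here, so a unitary travels together with its inverse, and the pair is
    symmetric in the two. *)
Definition U2_pair u v := [/\ is_adjoint u v, cancel u v, cancel v u,
  hilbert_schmidt (u - clinear_id) & hilbert_schmidt (v - clinear_id)].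

Lemma U2_pairP u v : U2 u -> is_adjoint u v -> U2_pair u v.
Proof.
move=> [[w uw [uK wK]] uHS] uv; have -> : v = w by exact: is_adjoint_uniq uv uw.
have adj := is_adjointB uw is_adjoint_id.
by split; [exact: uw|exact: uK|exact: wK|exact: uHS|exact: (hs_adjoint adj uHS).1].
Qed.

Lemma orbit2P A X : orbit2 A X <->
  exists u v, U2_pair u v /\ X = clinear_comp u (clinear_comp A v).
Proof.
split=> [[u [v [uU uv XE]]]|[u [v [[uv uK vK uHS vHS] XE]]]].
  by exists u, v; split; [exact: U2_pairP|exact: XE].
exists u, v; split; [split|exact: uv|exact: XE]; last exact: uHS.
by exists v; [exact: uv|split; [exact: uK|exact: vK]].
Qed.

Lemma U2_pair_id : U2_pair clinear_id clinear_id.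
Proof.
have id0 : hilbert_schmidt (@clinear_id _ H - clinear_id).
  by rewrite subrr; exact: hilbert_schmidt0.
split; [exact: is_adjoint_id|by []|by []|exact: id0|exact: id0].
Qed.

Lemma U2_pair_sym u v : U2_pair u v -> U2_pair v u.
Proof.
move=> [uv uK vK uHS vHS].
by split; [exact: is_adjoint_sym|exact: vK|exact: uK|exact: vHS|exact: uHS].
Qed.

Lemma nrm_isometry u v x : is_adjoint u v -> cancel u v -> nrm (u x) = nrm x.
Proof.
move=> uv uK; apply/eqP; rewrite -(@eqrXn2 _ 2) ?nrm_ge0//.
by rewrite -(inj_eq (@complexI R)) -!hdot_nrm uv uK.
Qed.

Lemma U2_pair_comp u v u' v' : U2_pair u v -> U2_pair u' v' ->
  U2_pair (clinear_comp u u') (clinear_comp v' v) /\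
  hs_norm (clinear_comp u u' - clinear_id) <=
    hs_norm (u - clinear_id) + hs_norm (u' - clinear_id).
Proof.
move=> [uv uK vK uHS vHS] [uv' uK' vK' uHS' vHS'].
have u1 x : nrm (u x) <= 1 * nrm x by rewrite mul1r (nrm_isometry x uv uK).
have v1 x : nrm (v' x) <= 1 * nrm x.
  by rewrite mul1r (nrm_isometry x (is_adjoint_sym uv') vK').
have E : clinear_comp u u' - clinear_id =
    (u - clinear_id) + clinear_comp u (u' - clinear_id).
  apply: clinear_ext => x.
  by rewrite !clinE; zmod.
have E' : clinear_comp v' v - clinear_id =
    (v' - clinear_id) + clinear_comp v' (v - clinear_id).
  apply: clinear_ext => x.
  by rewrite !clinE; zmod.
have [h1 h2] := hs_compl ler01 u1 uHS'.
have [h3 h4] := hs_compl ler01 v1 vHS.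
split; [split|].
- exact: is_adjoint_comp.
- by move=> x /=; rewrite uK uK'.
- by move=> x /=; rewrite vK' vK.
- rewrite E; exact: hilbert_schmidtD uHS h1.
- rewrite E'; exact: hilbert_schmidtD vHS' h3.
rewrite E; apply: le_trans (ler_hs_normD uHS h1) _.
by rewrite lerD2l -[leRHS]mul1r; exact: h2.
Qed.

Definition conj2 u v A := clinear_comp u (clinear_comp A v).

Lemma conj2_sa u v A : is_adjoint u v -> self_adjoint A ->
  self_adjoint (conj2 u v A).
Proof.
move=> uv Asa.
exact: (is_adjoint_comp uv (is_adjoint_comp Asa (is_adjoint_sym uv))).
Qed.

Lemma conj2B u v A X : conj2 u v (A - X) = conj2 u v A - conj2 u v X.
Proof. by apply: clinear_ext => x; rewrite !(clinearDE, clinearNE) /= !(clinearDE, clinearNE, clinD, clinN). Qed.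

Lemma conj2_hs u v A : is_adjoint u v -> cancel u v -> self_adjoint A ->
  hilbert_schmidt A ->
  hilbert_schmidt (conj2 u v A) /\ hs_norm (conj2 u v A) <= hs_norm A.
Proof.
move=> uv uK Asa AHS.
have u1 x : nrm (u x) <= 1 * nrm x by rewrite mul1r (nrm_isometry x uv uK).
have [h1 h2] := hs_compr Asa (is_adjoint_sym uv) ler01 u1 AHS.
have [h3 h4] := hs_compl ler01 u1 h1; split; first exact: h3.
apply: le_trans h4 _; rewrite mul1r; apply: le_trans h2 _.
rewrite mul1r; exact: lexx.
Qed.

Lemma conj2K u v A : cancel u v -> conj2 v u (conj2 u v A) = A.
Proof. by move=> uK; apply: clinear_ext => x /=; rewrite !uK. Qed.

Lemma conj2_subHS u v A : self_adjoint A -> U2_pair u v ->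
  hilbert_schmidt (conj2 u v A - A).
Proof.
move=> Asa [uv uK vK uHS vHS].
have [C C0 AC] := clinear_nrm_bounded A.
have v1 x : nrm (v x) <= 1 * nrm x.
  by rewrite mul1r (nrm_isometry x (is_adjoint_sym uv) vK).
have -> : conj2 u v A - A = clinear_comp (clinear_comp (u - clinear_id) A) v
    + clinear_comp A (v - clinear_id).
  apply: clinear_ext => x.
  by rewrite /conj2 !clinE; zmod.
have adjuA := is_adjoint_comp (is_adjointB uv is_adjoint_id) Asa.
have [h1 _] := hs_compr (is_adjointB uv is_adjoint_id) Asa (ltW C0) AC uHS.
have u1 x : nrm (u x) <= 1 * nrm x by rewrite mul1r (nrm_isometry x uv uK).
have [h2 _] := hs_compr adjuA (is_adjoint_sym uv) ler01 u1 h1.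
have [h3 _] := hs_compl (ltW C0) AC vHS.
exact: hilbert_schmidtD h2 h3.
Qed.

Lemma orbit2_affine A X : self_adjoint A -> orbit2 A X ->
  exists k : hs_sa H, X = A + k.
Proof.
move=> Asa /orbit2P[u [v [uv ->]]].
have kHS := conj2_subHS Asa uv; have [adj _ _ _ _] := uv.
have [k kE] := hs_sa_pack kHS (is_adjointB (conj2_sa adj Asa) Asa).
by exists k; rewrite kE addrC subrK.
Qed.

Lemma orbit2_trans A X Y : orbit2 A X -> orbit2 X Y -> orbit2 A Y.
Proof.
move=> /orbit2P[u [v [uv ->]]] /orbit2P[u' [v' [uv' ->]]]; apply/orbit2P.
exists (clinear_comp u' u), (clinear_comp v v').
by split; [exact: (U2_pair_comp uv' uv).1|exact: clinear_ext].
Qed.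

Lemma orbit2_sym A X : orbit2 A X -> orbit2 X A.
Proof.
move=> /orbit2P[u [v [uv ->]]]; apply/orbit2P.
exists v, u; split; first exact: U2_pair_sym.
by have [_ uK _ _ _] := uv; apply: clinear_ext => x /=; rewrite !uK.
Qed.

End UnitaryOrbit.

(** * Polynomials of an operator *)

Section PolynomialEvaluation.
Context {R : realType} {H : hilbertType R}.
Local Notation BH := (clinear H H).
Implicit Types (X Y u v : BH) (p q : {poly R[i]}).

Definition opow X n : BH := iter n (clinear_comp X) clinear_id.

Definition peval X p : BH := \sum_(i < size p) p`_i *: opow X i.

Lemma peval_wide X p n : (size p <= n)%N ->
  peval X p = \sum_(i < n) p`_i *: opow X i.
Proof.
move=> pn; rewrite /peval (big_ord_widen _ (fun i => p`_i *: opow X i) pn) big_mkcond.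
by apply: eq_bigr => i _; case: ltnP => // /(nth_default 0) ->; rewrite scale0r.
Qed.

Lemma pevalD X p q : peval X (p + q) = peval X p + peval X q.
Proof.
pose n := maxn (size p) (size q).
rewrite (@peval_wide X (p + q) n) ?size_polyD// (@peval_wide X p n) ?leq_maxl//.
rewrite (@peval_wide X q n) ?leq_maxr// -big_split; apply: eq_bigr => i _.
by rewrite coefD scalerDl.
Qed.

Lemma pevalC X c : peval X c%:P = c *: clinear_id.
Proof.
by rewrite (@peval_wide X _ 1) ?size_polyC_leq1// big_ord_recl big_ord0 addr0 coefC.
Qed.

Lemma peval0 X : peval X 0 = 0.
Proof. by rewrite /peval size_poly0 big_ord0. Qed.

Lemma pevalMX X p : peval X (p * 'X) = clinear_comp X (peval X p).
Proof.
rewrite (@peval_wide X _ (size p).+1); last first.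
  by rewrite (leq_trans (size_polyMleq _ _))// size_polyX addn2.
rewrite big_ord_recl coefMX /= scale0r add0r; apply: clinear_ext => x.
rewrite clinear_compE !clinear_sumE clin_sum; apply: eq_bigr => i _.
by rewrite coefMX !clinE.
Qed.

Lemma peval_commX X p x : X (peval X p x) = peval X p (X x).
Proof.
elim/poly_ind: p x => [|p c IH] x.
  by rewrite peval0 !clinE.
by rewrite pevalD pevalMX pevalC !clinE IH.
Qed.

Lemma pevalM X p q : peval X (p * q) = clinear_comp (peval X p) (peval X q).
Proof.
elim/poly_ind: p => [|p c IH]; apply: clinear_ext => x.
  by rewrite mul0r peval0 !clinE.
have -> : (p * 'X + c%:P) * q = (p * q) * 'X + c%:P * q.
  by rewrite mulrDl mulrAC.
rewrite [in LHS]pevalD [in LHS]pevalMX IH !(pevalD, pevalMX, pevalC).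
rewrite !clinE; congr (_ + _).
rewrite (@peval_wide X _ (size q)); last first.
  by rewrite mul_polyC size_scale_leq.
rewrite /peval !clinear_sumE scaler_sumr; apply: eq_bigr => i _.
by rewrite !clinearZE coefCM scalerA.
Qed.

Lemma peval_comm X p q x : peval X p (peval X q x) = peval X q (peval X p x).
Proof.
by have := congr1 (fun a : BH => a x) (pevalM X p q); rewrite mulrC pevalM.
Qed.

Lemma pevalXsubC X c : peval X ('X - c%:P) = X - c *: clinear_id.
Proof.
have -> : 'X - c%:P = 1%:P * 'X + (- c)%:P :> {poly R[i]}.
  by rewrite mul1r polyCN.
rewrite pevalD pevalMX !pevalC scaleNr; congr (_ - _).
by apply: clinear_ext => x; rewrite !clinE scale1r.
Qed.

Lemma peval_adjoint X Y p : is_adjoint X Y ->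
  is_adjoint (peval X p) (peval Y (map_poly Num.conj p)).
Proof.
move=> XY; elim/poly_ind: p => [|p c IH].
  by rewrite map_poly0 !peval0; exact: is_adjoint0.
rewrite rmorphD rmorphM/= map_polyX map_polyC/= !pevalD !pevalMX !pevalC.
apply: is_adjointD; last by apply: is_adjointZ; exact: is_adjoint_id.
have -> : clinear_comp Y (peval Y (map_poly Num.conj p)) =
   clinear_comp (peval Y (map_poly Num.conj p)) Y.
  by apply: clinear_ext => x /=; rewrite peval_commX.
exact: is_adjoint_comp.
Qed.

Lemma peval_conj2 u v X p : cancel u v -> cancel v u ->
  peval (conj2 u v X) p = conj2 u v (peval X p).
Proof.
move=> uK vK; elim/poly_ind: p => [|p c IH]; apply: clinear_ext => x.
  by rewrite /conj2 !peval0 !clinE.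
by rewrite /conj2 !(pevalD, pevalMX, pevalC) IH !clinE uK vK.
Qed.

End PolynomialEvaluation.

(** * Approximate eigenvectors and reality of the spectrum *)

Section Spectrum.
Context {R : realType} {H : hilbertType R}.
Local Notation BH := (clinear H H).
Implicit Types (A B T : BH) (x y : H).

Lemma geometric_small (q C e : R) : 0 <= q < 1 -> 0 < e ->
  exists N, forall n, (N <= n)%N -> q ^+ n * C <= e.
Proof.
move=> /andP[q0 q1] e0; have K0 : 0 < `|C| + 1 by rewrite ltr_wpDl.
have /cvgrPdist_le/(_ (e / (`|C| + 1))) : (fun n => q ^+ n) @ \oo --> (0 : R).
  by apply: cvg_expr; rewrite ger0_norm.
rewrite divr_gt0// => /(_ isT)[N _ qN]; exists N => n Nn.
have := qN n Nn; rewrite sub0r normrN ger0_norm ?exprn_ge0// => qn.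
rewrite (le_trans (ler_norm _))// normrM ger0_norm ?exprn_ge0//.
rewrite (le_trans (ler_wpM2r (normr_ge0 C) qn))// mulrAC ler_pdivrMr//.
by rewrite ler_pM2l// lerDl.
Qed.

(* Richardson iteration [x := x + t (y - B' B x)]: the residual is multiplied by
   [1 - t B' B], which is a contraction for small [t] since [B] is bounded below. *)
Lemma normal_bounded_below_surj B B' (c : R) : is_adjoint B B' ->
  (forall x, B (B' x) = B' (B x)) -> 0 < c ->
  (forall x, c * nrm x <= nrm (B x)) -> forall y, exists x, B x = y.
Proof.
move=> BB' Bnormal c0 Bc; have [b b0 Bb] := clinear_nrm_bounded B.
have nrmB' x : nrm (B' x) = nrm (B x).
  apply/eqP; rewrite -(@eqrXn2 _ 2) ?nrm_ge0// -(inj_eq (@complexI R)).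
  by rewrite -!hdot_nrm (is_adjoint_sym BB') BB' Bnormal.
have Tc x : c ^+ 2 * nrm x <= nrm (B' (B x)).
  rewrite nrmB' (le_trans _ (Bc _))// expr2 -mulrA ler_wpM2l ?Bc//.
  exact: ltW.
(* [d] bounds [B] and is at least [c], which makes [q] nonnegative; with [t = d^(-2)] the quadratic
   term in the squared residual is at most half of the linear one. *)
pose d := Num.max b c; have bd : b <= d by rewrite le_max lexx.
have cd : c <= d by rewrite le_max lexx orbT.
have d0 : 0 < d by rewrite (lt_le_trans b0).
pose t := (d ^+ 2)^-1; pose q := 1 - c ^+ 2 / d ^+ 2.
have q01 : 0 <= q < 1.
  apply/andP; split.
    rewrite subr_ge0 ler_pdivrMr ?exprn_gt0// mul1r.
    by rewrite ler_pXn2r ?nnegrE ?(ltW c0) ?(ltW d0).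
  by rewrite ltrBlDr ltrDl divr_gt0// exprn_gt0.
have step r : nrm (r - t%:C *: B' (B r)) ^+ 2 <= q * nrm r ^+ 2.
  rewrite nrmB_sqr nrmZr hdotZr [Num.conj _]conjc_real -BB' hdot_nrm.
  rewrite -rmorphM/= exprMn.
  have t0 : 0 < t by rewrite invr_gt0 exprn_gt0.
  rewrite (gtr0_norm t0) nrmB'.
  have h1 : nrm (B (B r)) ^+ 2 <= d ^+ 2 * nrm (B r) ^+ 2.
    rewrite -exprMn ler_pXn2r ?nnegrE ?mulr_ge0 ?nrm_ge0 ?(ltW d0)//.
    by rewrite (le_trans (Bb _))// ler_wpM2r ?nrm_ge0.
  have h2 : t ^+ 2 * nrm (B (B r)) ^+ 2 <= t * nrm (B r) ^+ 2.
    have -> : t * nrm (B r) ^+ 2 = t ^+ 2 * (d ^+ 2 * nrm (B r) ^+ 2).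
      by rewrite /t; field; rewrite gt_eqF.
    by rewrite ler_wpM2l ?sqr_ge0.
  have h3 : c ^+ 2 * nrm r ^+ 2 <= nrm (B r) ^+ 2.
    rewrite -exprMn ler_pXn2r ?nnegrE ?mulr_ge0 ?nrm_ge0 ?(ltW c0)//.
  have h4 : t * (c ^+ 2 * nrm r ^+ 2) <= t * nrm (B r) ^+ 2.
    by rewrite ler_wpM2l// ltW.
  rewrite /q -/t; lra.
move=> y; pose F x := x + t%:C *: (y - B' (B x)).
pose x n := iter n F 0; pose r n := y - B' (B (x n)).
have rS n : r n.+1 = r n - t%:C *: B' (B (r n)).
  have xS : x n.+1 = x n + t%:C *: r n by [].
  by rewrite [LHS]/r xS !clinE /r; zmod.
have rle n : nrm (r n) ^+ 2 <= q ^+ n * nrm (r 0) ^+ 2.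
  elim: n => [|n IH]; first by rewrite expr0 mul1r.
  rewrite rS (le_trans (step _))// [q ^+ _.+1]exprS -mulrA ler_wpM2l//.
  by case/andP: q01.
have rlim (e : R) : 0 < e -> exists N, forall n, (N <= n)%N -> nrm (r n) <= e.
  move=> e0; have e20 : 0 < e ^+ 2 by rewrite exprn_gt0.
  have [N rN] := geometric_small (nrm (r 0) ^+ 2) q01 e20.
  exists N => n Nn; rewrite -(@ler_pXn2r _ 2) ?nnegrE ?nrm_ge0 ?(ltW e0)//.
  by rewrite (le_trans (rle n))// rN.
(* The residuals control the iterates: [B' (B (x N - x n)) = r n - r N], and [B' B] is bounded below
   by [c ^+ 2]. *)
have [|l xl] := @nrm_cauchy_seq _ _ x.
  move=> e e0; have [|N rN] := rlim (c ^+ 2 * e / 3).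
    by rewrite divr_gt0// mulr_gt0// exprn_gt0.
  exists N => n Nn; have := Tc (x N - x n).
  have -> : B' (B (x N - x n)) = r n - r N by rewrite !clinB /r; zmod.
  have := nrmB (r n) (r N); have := rN _ Nn; have := rN _ (leqnn N).
  have c20 : 0 < c ^+ 2 by rewrite exprn_gt0.
  have ce0 : 0 < c ^+ 2 * e by rewrite mulr_gt0.
  rewrite -(ltr_pM2l c20); lra.
(* The iteration solves [B' B l = y]; normality turns this into [B (B' l) = y]. *)
exists (B' l); rewrite Bnormal; apply/eqP; rewrite -subr_eq0 -nrm_eq0.
rewrite eq_le nrm_ge0 andbT; apply/ler_addgt0Pr => e e0; rewrite add0r.
have e20 : 0 < e / 2 by rewrite divr_gt0.
have eb0 : 0 < e / 2 / b ^+ 2 by rewrite divr_gt0// exprn_gt0.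
have [N1 lN] := xl _ eb0; have [N2 rN] := rlim _ e20.
pose n := maxn N1 N2.
have h1 := lN n (leq_maxl _ _); have h2 := rN n (leq_maxr _ _).
have -> : B' (B l) - y = B' (B (l - x n)) - r n by rewrite !clinB /r; zmod.
apply: le_trans (nrmB _ _) _; rewrite [leRHS]splitr lerD// nrmB'.
rewrite (le_trans (Bb _))// (le_trans (ler_wpM2l (ltW b0) (Bb _)))//.
by rewrite mulrA -expr2 -ler_pdivlMl ?exprn_gt0// mulrC.
Qed.

(** Weyl's criterion. Without approximate eigenvectors [A - l] is bounded below, and being normal it
    is then onto, with a bounded inverse. *)
Lemma spectrum_approx A l : self_adjoint A -> spectrum A l ->
  forall e : R, 0 < e -> exists2 x, nrm x = 1 & nrm (A x - l *: x) <= e.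
Proof.
move=> Asa lA e e0; apply: contrapT => nex; apply: lA.
pose B := A - l *: clinear_id; pose B' := A - Num.conj l *: clinear_id.
have BE x : B x = A x - l *: x by [].
have B'E x : B' x = A x - Num.conj l *: x by [].
have BB' : is_adjoint B B' by apply: is_adjointB => //; exact: is_adjointZ.
have Bnormal x : B (B' x) = B' (B x).
  by rewrite !BE !B'E !clinE !scalerBr !scalerA (mulrC l); zmod.
have Blow x : e * nrm x <= nrm (B x).
  have [->|x0] := eqVneq x 0; first by rewrite clin0 nrm0 mulr0.
  rewrite leNgt; apply/negP => Bx; apply: nex.
  have nx : 0 < nrm x by rewrite nrm_gt0.
  have nV : `|(nrm x)^-1| = (nrm x)^-1 by rewrite gtr0_norm// invr_gt0.
  exists ((nrm x)^-1%:C *: x); first by rewrite nrmZr nV mulVf ?gt_eqF.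
  rewrite -BE clinZ nrmZr nV ler_pdivrMl// mulrC; exact: ltW.
have Binj x y : B x = B y -> x = y.
  move=> xy; apply/eqP; rewrite -subr_eq0 -nrm_eq0 eq_le nrm_ge0 andbT.
  by rewrite -(ler_pM2l e0) mulr0 (le_trans (Blow _))// clinB xy subrr nrm0.
have [S SP] := choice (normal_bounded_below_surj BB' Bnormal e0 Blow).
have Slin : linear S by move=> c x y; apply: Binj; rewrite clinD clinZ !SP.
have Sp : S \in @clinear_pred _ H H.
  apply: (@nrm_clinear_pred _ _ _ _ e^-1) => // [|x].
    by rewrite invr_ge0 ltW.
  by rewrite -ler_pdivrMl ?invr_gt0// invrK (le_trans (Blow _))// SP.
by exists (CLinear Sp); split=> x; [apply: Binj; exact: SP|exact: SP].
Qed.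

Lemma sa_Im A x : self_adjoint A -> complex.Im '[A x, x] = 0.
Proof.
move=> Asa; have : '[A x, x] = Num.conj '[A x, x] by rewrite -hdotC Asa.
case: ('[A x, x]) => a b /= [] /eqP; rewrite -addr_eq0 -mulr2n mulrn_eq0/=.
by move=> /eqP.
Qed.

(** Since [<A x, x>] is real, the imaginary part of [<A x - l x, x>] is [- Im l |x|^2];
    Cauchy-Schwarz concludes. *)
Lemma sa_sub_low A (l : R[i]) x : self_adjoint A ->
  `|complex.Im l| * nrm x <= nrm (A x - l *: x).
Proof.
move=> Asa; have [->|x0] := eqVneq x 0; first by rewrite nrm0 mulr0 nrm_ge0.
have nx : 0 < nrm x by rewrite nrm_gt0.
rewrite -(ler_pM2r nx); apply: le_trans (cauchy_schwarz _ _).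
apply: le_trans (Im_le_cabs _).
rewrite hdotBl raddfB/= sa_Im// sub0r normrN hdotZl hdot_nrm.
by case: l => a b; rewrite /= mulr0 add0r normrM normrX (gtr0_norm nx) mulrA.
Qed.

Lemma spectrum_real A l : self_adjoint A -> spectrum A l ->
  l = (complex.Re l)%:C.
Proof.
move=> Asa lA; suff Iml : complex.Im l = 0 by case: l Iml {lA} => a b /= ->.
apply/normr0_eq0/eqP; rewrite eq_le normr_ge0 andbT.
apply/ler_addgt0Pr => e e0; rewrite add0r.
have [x x1 xe] := spectrum_approx Asa lA e0.
by apply: le_trans xe; rewrite -[leLHS]mulr1 -x1 sa_sub_low.
Qed.

End Spectrum.

(** * Submanifold implies finite spectrum *)

Section LocallyClosedBaire.
Context {R : realType} {E : completeNormedModType R}.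

(** The sequential form is the one that a sequence of nested balls can use directly. *)
Definition locally_closed_at (S : set E) (p : E) := exists2 d : R, 0 < d &
  forall (k : nat -> E) l, (forall n, S (k n)) -> (forall n, `|k n - p| <= d) ->
    k @ \oo --> l -> S l.

(** Inside [U], the set [S] is the preimage of the closed set [F] under the continuous map [phi],
    and a closed ball around [p] fits into [U]. *)
Lemma submanifold_locally_closed (S : set E) p :
  submanifold S -> S p -> locally_closed_at S p.
Proof.
move=> mS Sp.
have [U [V [F [phi [[oU Up] oV [cF _ _] [psi [phiU _ phiK phiC _]] phiS]]]]] :=
  mS p Sp.
(* Injectivity of [phi] on [U] turns the equality of images into a test for membership in [S]. *)
have SF x : U x -> F (phi x) -> S x.
  move=> Ux Fx; have Vx : V (phi x) by rewrite -phiU; exists x.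
  have : (V `&` F) (phi x) by [].
  rewrite -phiS => -[y [Uy Sy] yx].
  by rewrite -(phiK _ Ux) -yx phiK.
have /nbhs_normP[d /= d0 dU] : nbhs p U by exact: open_nbhs_nbhs.
have d20 : 0 < d / 2 by rewrite divr_gt0.
have dU' x : `|x - p| <= d / 2 -> U x.
  move=> xp; apply: dU; rewrite /= distrC (le_lt_trans xp)//.
  by rewrite ltr_pdivrMr// ltr_pMr// ltr1n.
exists (d / 2) => // k l Sk kp kl.
have lp : `|l - p| <= d / 2.
  apply/ler_addgt0Pr => e e0; near \oo => n.
  have lk : `|l - k n| <= e by near: n; move/cvgrPdist_le : kl; exact.
  have -> : l - p = (k n - p) + (l - k n) by zmod.
  by rewrite (le_trans (ler_normD _ _))// lerD.
apply: SF; first exact: dU'.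
have phil : {for l, continuous phi}.
  by apply: (is_Ck_continuous (phiC 0)); exact: dU'.
apply: (@closed_cvg _ _ \oo _ (fun n => phi (k n)) F cF).
  apply: nearW => n; have : (V `&` F) (phi (k n)) by rewrite -phiS; exists (k n) => //; split=> //; exact: dU'.
  by case.
apply: (@cvg_comp _ _ _ k phi \oo (nbhs l) (nbhs (phi l))); [exact: kl|exact: phil].
Unshelve. all: by end_near. Qed.

(** Baire's nested balls with all centres in [S]: halving both the radius and the displacement nests
    the closed balls, and local closedness keeps the limit of the centres in [S]. *)
Lemma locally_closed_baire (S : set E) p (G : nat -> set E) : S p ->
  locally_closed_at S p ->
  (forall n k (r : R), S k -> 0 < r -> exists k' r',
    [/\ S k', 0 < r', r' <= r / 2, `|k' - k| <= r / 2 &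
        forall l, `|l - k'| <= r' -> ~ G n l]) ->
  exists2 l, S l & forall n, ~ G n l.
Proof.
move=> Sp [d d0 Sd] step.
(* Made total for [choice]; the conditions carry content only for a centre in [S] and a positive
   radius. *)
have /choice[f fP] : forall st : nat * E * R, exists st' : E * R,
    S st.1.2 -> 0 < st.2 ->
    [/\ S st'.1, 0 < st'.2, st'.2 <= st.2 / 2, `|st'.1 - st.1.2| <= st.2 / 2 &
        forall l, `|l - st'.1| <= st'.2 -> ~ G st.1.1 l].
  move=> [[n k] r] /=; have [Sk|nSk] := pselect (S k); last by exists (k, r).
  have [r0|r0] := ltP 0 r; last by exists (k, r).
  by have [k' [r' P]] := step n k r Sk r0; exists (k', r').
(* Starting from [(p, d)] keeps every centre in the ball where [S] is sequentially closed. *)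
pose x := fix x n : E * R := if n is m.+1 then f (m, (x m).1, (x m).2) else (p, d).
have xP n : S (x n).1 /\ 0 < (x n).2.
  elim: n => // n [Sx x0]; have [] := fP (n, (x n).1, (x n).2) Sx x0.
  by [].
have xS n : [/\ (x n.+1).2 <= (x n).2 / 2,
    `|(x n.+1).1 - (x n).1| <= (x n).2 / 2 &
    forall l, `|l - (x n.+1).1| <= (x n.+1).2 -> ~ G n l].
  by have [Sx x0] := xP n; have [] := fP (n, (x n).1, (x n).2) Sx x0.
have nested n m : `|(x (n + m)%N).1 - (x n).1| + (x (n + m)%N).2 <= (x n).2.
  elim: m => [|m IH]; first by rewrite addn0 subrr normr0 add0r.
  rewrite addnS; have [h1 h2 _] := xS (n + m)%N.
  have : `|(x (n + m).+1).1 - (x n).1| <=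
      `|(x (n + m).+1).1 - (x (n + m)%N).1| + `|(x (n + m)%N).1 - (x n).1|.
    exact: ler_distD.
  lra.
have xle n m : (n <= m)%N -> `|(x m).1 - (x n).1| <= (x n).2.
  move=> nm; have := nested n (m - n)%N; rewrite subnKC//.
  by have [_ ] := xP m; lra.
have rle n : (x n).2 <= d * (2^-1) ^+ n.
  elim: n => [|n IH]; first by rewrite expr0 mulr1.
  by have [h1 _ _] := xS n; rewrite exprSr; lra.
have rlim (e : R) : 0 < e -> exists N, (x N).2 <= e.
  move=> e0; have [||N qN] := @geometric_small _ 2^-1 d e; [by lra|by []|].
  by exists N; rewrite (le_trans (rle N))// mulrC qN.
have [l xl] : exists l : E, (fun n => (x n).1) @ \oo --> l.
  apply/cvg_ex/cauchy_cvgP/cauchy_exP => e e0.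
  have [|N xN] := rlim (e / 2); first by rewrite divr_gt0.
  exists (x N).1; exists N => // n /= Nn; rewrite -ball_normE /= distrC.
  by rewrite (le_lt_trans (xle _ _ Nn))// (le_lt_trans xN)// ltr_pdivrMr// ltr_pMr// ltr1n.
have lx n : `|l - (x n).1| <= (x n).2.
  apply/ler_addgt0Pr => e e0; near \oo => m.
  have lm : `|l - (x m).1| <= e by near: m; move/cvgrPdist_le : xl; exact.
  have nm : (n <= m)%N by near: m; exists n.
  have -> : l - (x n).1 = ((x m).1 - (x n).1) + (l - (x m).1) by zmod.
  by rewrite (le_trans (ler_normD _ _))// lerD// xle.
exists l.
  apply: (Sd (fun n => (x n).1)) => // n; first by have [] := xP n.
  exact: (xle 0 n).
by move=> n; have [_ _] := xS n; apply.
Unshelve. all: by end_near. Qed.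

End LocallyClosedBaire.

(** * Clustered and separated sequences of reals *)

Section ClusteredPoints.
Context {R : realType}.

Lemma pos_lower_bound n (g : nat -> R) : (forall i, (i < n)%N -> 0 < g i) ->
  exists2 d, 0 < d & forall i, (i < n)%N -> d <= g i.
Proof.
elim: n => [|n IH] g0; first by exists 1.
have [|d d0 dg] := IH; first by move=> i ni; apply: g0; exact: leqW.
exists (Num.min d (g n)); first by rewrite lt_min d0 g0.
move=> i; rewrite ltnS leq_eqVlt => /predU1P[->|ni]; first by rewrite ge_min lexx orbT.
by rewrite ge_min dg.
Qed.

Lemma separation n (f : nat -> R) : injective f -> exists2 d, 0 < d &
  forall i j, (i < n)%N -> (j < n)%N -> i != j -> d <= `|f i - f j|.
Proof.
move=> finj.
have /choice[g gP] : forall j : nat, exists d, 0 < d /\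
    forall i, (i < n)%N -> i != j -> d <= `|f i - f j|.
  move=> j; pose h i := if i == j then 1 else `|f i - f j|.
  have [|d d0 dh] := @pos_lower_bound n h.
    move=> i _; rewrite /h; case: eqVneq => // ij.
    by rewrite normr_gt0 subr_eq0; apply: contra_neq ij => /finj.
  by exists d; split=> // i ni /negbTE ij; have := dh i ni; rewrite /h ij.
have [|d d0 dg] := @pos_lower_bound n g; first by move=> j _; exact: (gP j).1.
exists d => // i j ni nj ij; apply: le_trans (dg j nj) _.
exact: (gP j).2.
Qed.

(** Bolzano-Weierstrass: infinitely many points lie within [eta / 2] of an accumulation point. *)
Lemma infinite_bounded_cluster (S : set R) (eta : R) : infinite_set S ->
  bounded_set S -> 0 < eta -> exists f : nat -> R,
    [/\ injective f, forall n, S (f n) & forall n m, `|f n - f m| <= eta].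
Proof.
move=> Sinf Sbd eta0; have [p] := infinite_bounded_limit_point_nonempty Sinf Sbd.
move=> /limit_point_infinite_setP/(_ (ball p (eta / 2))) pinf.
have /pinf/infiniteP/pcard_leP/injfunPex[/= f funf injf] : nbhs p (ball p (eta / 2)).
  by apply: nbhsx_ballx; rewrite divr_gt0.
exists f; split=> [n m nm|n|n m]; first by apply: injf => //; rewrite in_setT.
  by have [] := funf n I.
have [+ _] := funf n I; have [+ _] := funf m I; rewrite -ball_normE/= => pm pn.
have -> : f n - f m = (p - f m) - (p - f n) by zmod.
by rewrite (le_trans (ler_normB _ _))//; lra.
Qed.

End ClusteredPoints.

(** * Rank-one operators and Householder reflections *)

Section RankOne.
Context {R : realType} {H : hilbertType R}.
Local Notation BH := (clinear H H).
Implicit Types (A u v : BH) (x y z g h : H).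

Fact rank1_subproof g h : (fun x => '[x, h] *: g) \in @clinear_pred _ H H.
Proof.
apply: (@nrm_clinear_pred _ _ _ _ (nrm h * nrm g)).
- by move=> a x y; rewrite hdotDl hdotZl scalerDl scalerA.
- by rewrite mulr_ge0 ?nrm_ge0.
move=> x; rewrite nrmZ mulrAC ler_wpM2r ?nrm_ge0//.
by rewrite mulrC cauchy_schwarz.
Qed.

Definition rank1 g h : BH := CLinear (rank1_subproof g h).

Lemma rank1E g h x : rank1 g h x = '[x, h] *: g. Proof. by []. Qed.

Lemma rank1_hs g h : hilbert_schmidt (rank1 g h) /\
  hs_norm (rank1 g h) <= nrm g * nrm h.
Proof.
apply/hs_normP; first by rewrite mulr_ge0 ?nrm_ge0.
move=> s sb; apply: (@le_trans _ _ (nrm g ^+ 2 * \sum_(e <- s) cabs '[h, e] ^+ 2)).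
  rewrite mulr_sumr; apply: ler_sum => e _.
  by rewrite rank1E nrmZ exprMn mulrC cabs_hdotC.
by rewrite exprMn ler_wpM2l ?sqr_ge0// (basis_bessel hilbert_basisP).
Qed.

(** The Householder reflection in the hyperplane orthogonal to [g]. It differs from the identity by
    a rank-one operator, hence lies in [U_2], and along [x - y] it exchanges orthonormal [x] and
    [y]. *)
Definition reflection g : BH :=
  clinear_id - (2 / nrm g ^+ 2)%:C *: rank1 g g.

Lemma reflectionE g x :
  reflection g x = x - ((2 / nrm g ^+ 2)%:C * '[x, g]) *: g.
Proof. by rewrite /reflection !clinE rank1E scalerA. Qed.

Lemma reflection_adjoint g : is_adjoint (reflection g) (reflection g).
Proof.
move=> x y; rewrite !reflectionE hdotBl hdotBr hdotZl hdotZr.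
have : Num.conj (2 / nrm g ^+ 2)%:C = (2 / nrm g ^+ 2)%:C by exact: conjc_real.
set s := (_ / _)%:C => sr; rewrite [Num.conj (_ * _)]rmorphM/= sr -hdotC.
by congr (_ - _); ring.
Qed.

Lemma reflectionK g : g != 0 -> involutive (reflection g).
Proof.
move=> g0 x; have ng : nrm g != 0 by rewrite nrm_eq0.
have : (2 / nrm g ^+ 2)%:C * (nrm g ^+ 2)%:C = 2.
  by rewrite -rmorphM/= divfK ?expf_eq0// rmorph_nat.
rewrite !reflectionE hdotBl hdotZl hdot_nrm.
set s := (_ / _)%:C; set n := (_ ^+ 2)%:C; set t := '[x, g] => sn.
rewrite -addrA -opprD -scalerDl.
have -> : s * t + s * (t - s * t * n) = 0.
  have -> : s * t + s * (t - s * t * n) = 2 * (s * t) - s * n * (s * t) by ring.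
  by rewrite sn subrr.
by rewrite scale0r subr0.
Qed.

Lemma reflection_U2 g : g != 0 -> U2_pair (reflection g) (reflection g).
Proof.
move=> g0; have rK := reflectionK g0.
have rHS : hilbert_schmidt (reflection g - clinear_id).
  have -> : reflection g - clinear_id = (- (2 / nrm g ^+ 2))%:C *: rank1 g g.
    by apply: clinear_ext => x; rewrite /reflection !clinE rmorphN scaleNr; zmod.
  exact: hilbert_schmidtZ (rank1_hs g g).1.
by split; [exact: reflection_adjoint|exact: rK|exact: rK|exact: rHS|exact: rHS].
Qed.

Lemma reflection_dist g x : 1 <= nrm g ->
  nrm (reflection g x - x) <= 2 * cabs '[x, g].
Proof.
move=> g1; have g0 : 0 < nrm g by rewrite (lt_le_trans ltr01).
have -> : reflection g x - x = - (((2 / nrm g ^+ 2)%:C * '[x, g]) *: g).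
  by rewrite reflectionE; zmod.
rewrite nrmN nrmZ cabsM cabs_real ger0_norm ?divr_ge0 ?sqr_ge0//.
have -> : 2 / nrm g ^+ 2 * cabs '[x, g] * nrm g = 2 * cabs '[x, g] / nrm g.
  by field; rewrite gt_eqF.
by rewrite ler_pdivrMr// ler_peMr// mulr_ge0 ?cabs_ge0.
Qed.

Lemma reflection_pair_dist x y z (k : R) : 1 <= nrm (x - y) ->
  cabs '[z, x] <= k -> cabs '[z, y] <= k ->
  nrm (reflection (x - y) z - z) <= 4 * k.
Proof.
move=> g1 zx zy; apply: le_trans (reflection_dist z g1) _.
by have := cabsB '[z, x] '[z, y]; rewrite -hdotBr; lra.
Qed.

(** For unit vectors with real inner product the swap is exact; the error is proportional to
    [<x, y> - <y, x>], which [k] controls. *)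
Lemma reflection_swap x y (k : R) : nrm x = 1 -> nrm y = 1 -> k <= 1 / 4 ->
  cabs '[x, y] <= k ->
  1 <= nrm (x - y) /\ nrm (reflection (x - y) y - x) <= 4 * k.
Proof.
move=> x1 y1 k4 xyk.
have gsq : nrm (x - y) ^+ 2 = 2 - 2 * complex.Re '[x, y].
  by rewrite nrmB_sqr x1 y1 expr1n.
have Re12 := Re_le_cabs '[x, y].
have g1 : 1 <= nrm (x - y).
  by rewrite -(@ler_pXn2r _ 2) ?nnegrE ?nrm_ge0// expr1n gsq; lra.
split=> //; have g0 : 0 < nrm (x - y) by rewrite (lt_le_trans ltr01).
pose s := 2 / nrm (x - y) ^+ 2.
have sn : s%:C * (nrm (x - y) ^+ 2)%:C = 2.
  by rewrite -rmorphM/= divfK ?expf_eq0 ?gt_eqF// rmorph_nat.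
have gC : (nrm (x - y) ^+ 2)%:C = 2 - '[x, y] - '[y, x].
  rewrite -hdot_nrm hdotBl !hdotBr !hdot_nrm x1 y1 expr1n rmorph1; ring.
have -> : reflection (x - y) y - x = (s%:C * ('[x, y] - '[y, x]) / 2) *: (x - y).
  rewrite reflectionE -/s hdotBr hdot_nrm y1 expr1n rmorph1.
  have -> : s%:C * ('[x, y] - '[y, x]) / 2 = - 1 - s%:C * ('[y, x] - 1).
    have E : '[x, y] - '[y, x] = 2 - (nrm (x - y) ^+ 2)%:C - 2 * '[y, x].
      by rewrite gC; ring.
    by rewrite E mulrBr mulrBr sn; field.
  by rewrite scalerBl scaleN1r; zmod.
rewrite nrmZ !cabsM; set q := cabs ('[x, y] - _).
have q2 : q <= 2 * k.
  by have := cabsB '[x, y] '[y, x]; rewrite -/q (cabs_hdotC y x); lra.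
have q0 : 0 <= q by exact: cabs_ge0.
have -> : cabs (2^-1 : R[i]) = 2^-1.
  by apply: (@complexI R); rewrite cabsE normfV normr_nat fmorphV rmorph_nat.
rewrite cabs_real ger0_norm ?divr_ge0 ?sqr_ge0//.
have -> : s * q / 2 * nrm (x - y) = q / nrm (x - y).
  by rewrite /s; field; rewrite gt_eqF.
rewrite ler_pdivrMr// (le_trans q2)//.
have k0 : 0 <= k by lra.
have : k <= k * nrm (x - y) by rewrite ler_peMr.
lra.
Qed.

(* Writing [A g = c g + h], the part of [v A v - A] carried by [c g] cancels since
   [v] fixes the line of [g] up to sign. *)
Lemma reflection_conj A g (c : R) : self_adjoint A -> 1 <= nrm g ->
  hilbert_schmidt (conj2 (reflection g) (reflection g) A - A) /\
  hs_norm (conj2 (reflection g) (reflection g) A - A) <=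
    8 * nrm (A g - c%:C *: g).
Proof.
move=> Asa g1; have g0 : 0 < nrm g by rewrite (lt_le_trans ltr01).
have [s sE] : exists s, s = 2 / nrm g ^+ 2 by exists (2 / nrm g ^+ 2).
have [h hE] : exists h, h = A g - c%:C *: g by exists (A g - c%:C *: g).
have Ag : A g = c%:C *: g + h by rewrite hE; zmod.
have s0 : 0 < s by rewrite sE divr_gt0 ?exprn_gt0.
have sn : s%:C * (nrm g ^+ 2)%:C = 2.
  by rewrite -rmorphM/= sE divfK ?expf_eq0 ?gt_eqF// rmorph_nat.
have hgr : '[h, g] = Num.conj '[h, g].
  rewrite -hdotC hE hdotBl hdotBr Asa hdotZl hdotZr.
  by congr (_ - _ * _); exact/esym/conjc_real.
pose d := complex.Re '[h, g].
have hd : '[h, g] = d%:C.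
  move: hgr; rewrite /d; case: ('[h, g]) => a b /= [] /eqP.
  by rewrite -addr_eq0 -mulr2n mulrn_eq0/= => /eqP ->.
have E : conj2 (reflection g) (reflection g) A - A =
    (- s)%:C *: (rank1 g h + rank1 h g) + (s ^+ 2 * d)%:C *: rank1 g g.
  apply: clinear_ext => x.
  rewrite [LHS]clinearBE /conj2 !clinear_compE !reflectionE !clinE !rank1E -sE hdotBl hdotZl !Asa Ag.
  rewrite !hdotDr !hdotZr [Num.conj c%:C]conjc_real hdot_nrm (hdotC g h) -hgr hd.
  rewrite !scalerDr !scalerA.
  have -> : (s ^+ 2 * d)%:C = s%:C ^+ 2 * d%:C by rewrite rmorphM rmorphXn.
  have -> : (- s)%:C = - s%:C by rewrite rmorphN.
  set p := '[x, g]; set q := '[x, h]; set n := (_ ^+ 2)%:C in sn *.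
  set a := s%:C in sn *; set b := d%:C; set e := c%:C.
  have E1 : a * (e * p + q - a * p * (e * n + b)) = - (a * p * e) + a * q - a ^+ 2 * b * p.
    have -> : a * (e * p + q - a * p * (e * n + b)) =
      a * p * e + a * q - a ^+ 2 * b * p - a * n * (a * p * e) by ring.
    by rewrite sn; ring.
  by rewrite E1 !(scalerDl, scaleNr, scalerDr, scalerN, scalerA) !mulNr !scaleNr; zmod.
have [h1 h2] := rank1_hs g h; have [h3 h4] := rank1_hs h g.
have [h5 h6] := rank1_hs g g.
have h7 := hilbert_schmidtD h1 h3; have h8 := ler_hs_normD h1 h3.
have h9 := hilbert_schmidtZ (- s) h7; have h10 := hs_normZ (- s) h7.
have h11 := hilbert_schmidtZ (s ^+ 2 * d) h5.
have h12 := hs_normZ (s ^+ 2 * d) h5.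
split; first by rewrite E; exact: hilbert_schmidtD h9 h11.
rewrite E -hE; apply: le_trans (ler_hs_normD h9 h11) _; rewrite h10 h12.
rewrite normrN (gtr0_norm s0) normrM (ger0_norm (sqr_ge0 s)).
have dle : `|d| <= nrm h * nrm g.
  by rewrite -cabs_real -hd cauchy_schwarz.
have sg : s * nrm g ^+ 2 = 2 by rewrite sE divfK// expf_eq0 gt_eqF.
have n0 := nrm_ge0 h.
have sg1 : s * nrm g <= 2.
  by rewrite -sg ler_wpM2l ?(ltW s0)// expr2 ler_peMr// ltW.
set p := hs_norm _ in h8 *; set q := hs_norm _ in h6 *.
have t1 : s * p <= 2 * (s * nrm g) * nrm h.
  have -> : 2 * (s * nrm g) * nrm h = s * (nrm g * nrm h + nrm h * nrm g) by ring.
  rewrite ler_wpM2l ?(ltW s0)//; apply: le_trans h8 _; exact: lerD h2 h4.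
have t2 : s ^+ 2 * `|d| * q <= 2 * (s * nrm g) * nrm h.
  have -> : 2 * (s * nrm g) * nrm h = s ^+ 2 * (nrm h * nrm g) * (nrm g * nrm g).
    by rewrite -{1}sg; ring.
  apply: ler_pM => //; first by rewrite mulr_ge0 ?sqr_ge0.
    exact: hs_norm_ge0.
  by rewrite ler_wpM2l ?sqr_ge0.
have t3 : s * nrm g * nrm h <= 2 * nrm h by rewrite ler_wpM2r.
lra.
Qed.

(* The pairs are [e 0, e 1], [e 2, e 3], etc.; [v] nearly exchanges the two vectors
   of each of the first [M] pairs. *)
Lemma swap_pairs A (e : nat -> H) (c : nat -> R) (kappa eta : R) M :
  self_adjoint A -> 0 <= kappa <= 1 / 4 ->
  (forall i, (i < M.*2)%N -> nrm (e i) = 1) ->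
  (forall i j, (i < M.*2)%N -> (j < M.*2)%N -> i != j -> cabs '[e i, e j] <= kappa) ->
  (forall i, (i < M)%N ->
    nrm (A (e i.*2 - e i.*2.+1) - (c i)%:C *: (e i.*2 - e i.*2.+1)) <= eta) ->
  exists v v', [/\ U2_pair v v', hs_norm (conj2 v v' A - A) <= 8 * eta * M%:R,
    forall z (k : R), 0 <= k -> (forall i, (i < M.*2)%N -> cabs '[z, e i] <= k) ->
      nrm (v z - z) <= 4 * k * M%:R &
    forall i, (i < M)%N -> nrm (v (e i.*2.+1) - e i.*2) <= 4 * kappa * M%:R].
Proof.
move=> Asa /andP[k0 k4]; elim: M => [|M IH] e1 ek eA.
  exists clinear_id, clinear_id; split.
  - exact: U2_pair_id.
  - have -> : conj2 clinear_id clinear_id A - A = 0 by rewrite /conj2 [X in X - _](_ : _ = A) ?subrr//; exact: clinear_ext.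
    by rewrite hs_norm0 mulr0; exact: lexx.
  - by move=> z k _ _; rewrite clinear_idE subrr nrm0 mulr0.
  - by [].
have M2 i : (i < M.*2)%N -> (i < M.+1.*2)%N.
  by move=> iM; rewrite doubleS ltnW// ltnS ltnW.
have [|||v [v' [vP vA vz ve]]] := IH.
- by move=> i /M2; exact: e1.
- by move=> i j /M2 + /M2; exact: ek.
- by move=> i iM; apply: eA; exact: ltnW.
pose g := e M.*2 - e M.*2.+1.
have l1 : (M.*2 < M.+1.*2)%N by rewrite doubleS.
have l2 : (M.*2.+1 < M.+1.*2)%N by rewrite doubleS.
have neq12 : M.*2 != M.*2.+1 by rewrite neq_ltn leqnn.
have k12 := ek _ _ l1 l2 neq12.
have [g1 gswap] := reflection_swap (e1 _ l1) (e1 _ l2) k4 k12.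
have g0 : g != 0 by rewrite -nrm_gt0 (lt_le_trans ltr01).
have rdist z (k : R) : 0 <= k -> (forall i, (i < M.+1.*2)%N -> cabs '[z, e i] <= k) ->
    nrm (reflection g z - z) <= 4 * k.
  by move=> kk0 zk; apply: reflection_pair_dist; [|exact: zk|exact: zk].
have rP := reflection_U2 g0; have [radj rK _ rHS _] := rP.
have [rA1 rA2] := reflection_conj (c M) Asa g1.
have [vadj vK v'K vHS v'HS] := vP.
have rnrm z : nrm (reflection g z) = nrm z.
  exact: nrm_isometry radj rK.
exists (clinear_comp (reflection g) v), (clinear_comp v' (reflection g)); split.
- exact: (U2_pair_comp rP vP).1.
(* Conjugation does not increase the Hilbert-Schmidt norm, so each new reflection adds at most
   [8 * eta]. *)
- have -> : conj2 (clinear_comp (reflection g) v) (clinear_comp v' (reflection g)) A - A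
      = conj2 (reflection g) (reflection g) (conj2 v v' A - A) +
        (conj2 (reflection g) (reflection g) A - A).
    rewrite conj2B; set X := conj2 _ _ A; set Y := conj2 _ _ A.
    rewrite [X in _ = X - _ + _](_ : _ = X); last exact: clinear_ext.
    by zmod.
  have vAHS := conj2_subHS Asa vP.
  have vAsa : self_adjoint (conj2 v v' A - A).
    by apply: is_adjointB => //; exact: conj2_sa.
  have [h1 h2] := conj2_hs radj rK vAsa vAHS.
  apply: le_trans (ler_hs_normD h1 rA1) _.
  rewrite -[M.+1%:R]natr1 mulrDr mulr1; apply: lerD; first exact: le_trans h2 vA.
  by apply: le_trans rA2 _; rewrite ler_wpM2l// eA.
- move=> z k kk0 zk; rewrite clinear_compE.
  have -> : reflection g (v z) - z = reflection g (v z - z) + (reflection g z - z).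
    by rewrite clinB; zmod.
  apply: le_trans (nrmD _ _) _; rewrite rnrm -[M.+1%:R]natr1 mulrDr mulr1 lerD//.
    by apply: vz => // i /M2; exact: zk.
  exact: rdist.
- move=> i; rewrite ltnS leq_eqVlt => /predU1P[->|iM]; rewrite clinear_compE.
    (* For the new pair, the earlier reflections barely move its vectors, which are almost
       orthogonal to all previous ones. *)
    have -> : reflection g (v (e M.*2.+1)) - e M.*2 =
        reflection g (v (e M.*2.+1) - e M.*2.+1) + (reflection g (e M.*2.+1) - e M.*2).
      by rewrite clinB; zmod.
    apply: le_trans (nrmD _ _) _; rewrite rnrm -[M.+1%:R]natr1 mulrDr mulr1 lerD//.
      apply: vz => // j jM; apply: ek => //; first exact: M2.
      by rewrite gtn_eqF// ltnW// ltnS.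
  have -> : reflection g (v (e i.*2.+1)) - e i.*2 =
      reflection g (v (e i.*2.+1) - e i.*2) + (reflection g (e i.*2) - e i.*2).
    by rewrite clinB; zmod.
  apply: le_trans (nrmD _ _) _; rewrite rnrm -[M.+1%:R]natr1 mulrDr mulr1 lerD ?ve//.
  have iM2 : (i.*2 < M.*2)%N by rewrite ltn_double.
  apply: reflection_pair_dist; first exact: g1.
    by apply: ek => //; [exact: M2|rewrite ltn_eqF].
  by apply: ek => //; [exact: M2|rewrite ltn_eqF// ltnW].
Qed.

End RankOne.

(** * Conjugates of an operator with infinite spectrum *)

Section InfiniteSpectrum.
Context {R : realType} {H : hilbertType R}.
Local Notation BH := (clinear H H).
Implicit Types (A u v : BH) (x y z : H).

(** Schur's test on the Gram matrix: its rows have absolute sum at most [1 + M kappa <= 2]. Then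
    [S^2 = <z, w>^2 <= |z|^2 |w|^2 <= 2 |z|^2 S], and [S] cancels. *)
Lemma near_orthonormal_bessel (e : nat -> H) M (kappa : R) :
  (forall i, (i < M)%N -> nrm (e i) = 1) ->
  (forall i j, (i < M)%N -> (j < M)%N -> i != j -> cabs '[e i, e j] <= kappa) ->
  0 <= kappa -> kappa * M%:R <= 1 ->
  forall z, \sum_(i < M) cabs '[z, e i] ^+ 2 <= 2 * nrm z ^+ 2.
Proof.
move=> e1 ek k0 kM z; pose c (i : 'I_M) := '[z, e i].
pose S := \sum_(i < M) cabs (c i) ^+ 2; rewrite -/S.
have S0 : 0 <= S by apply: sumr_ge0 => i _; exact: sqr_ge0.
pose w := \sum_(i < M) c i *: e i.
have zw : '[z, w] = S%:C.
  rewrite hdot_sumr rmorph_sum; apply: eq_bigr => i _.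
  by rewrite hdotZr mulrC [RHS]cabs_sqr.
pose d (i j : 'I_M) : R := (i == j)%:R + kappa.
have d0 i j : 0 <= d i j by rewrite addr_ge0// ler0n.
have dsum i : \sum_j d i j = 1 + M%:R * kappa.
  rewrite big_split/= sumr_const card_ord mulr_natl; congr (_ + _).
  rewrite (bigD1 i)//= eqxx big1 ?addr0// => j /negbTE.
  by rewrite eq_sym => ->.
have dC i j : d i j = d j i by rewrite /d eq_sym.
have ww : nrm w ^+ 2 <= (1 + M%:R * kappa) * S.
  have -> : nrm w ^+ 2 = cabs '[w, w].
    by rewrite hdot_nrm cabs_real ger0_norm// sqr_ge0.
  have -> : '[w, w] = \sum_i \sum_j c i * (Num.conj (c j) * '[e i, e j]).
    rewrite {1}/w hdot_suml; apply: eq_bigr => i _.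
    rewrite hdotZl hdot_sumr mulr_sumr; apply: eq_bigr => j _.
    by rewrite hdotZr.
  have cabs_sum I (r : seq I) (f : I -> R[i]) :
      cabs (\sum_(i <- r) f i) <= \sum_(i <- r) cabs (f i).
    elim/big_rec2: _ => [|i s t _ st]; first by rewrite cabs0.
    by rewrite (le_trans (cabsD _ _))// lerD2l.
  (* Each product of coefficients is split by the inequality of means, after which only row sums of
     [d] remain. *)
  apply: (@le_trans _ _ (\sum_i \sum_j
    ((cabs (c i) ^+ 2 / 2) * d i j + (cabs (c j) ^+ 2 / 2) * d i j))).
    apply: le_trans (cabs_sum _ _ _) _; apply: ler_sum => i _.
    apply: le_trans (cabs_sum _ _ _) _; apply: ler_sum => j _.
    rewrite !cabsM cabs_conj -mulrDl mulrA; apply: ler_pM; rewrite ?cabs_ge0//.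
    - by rewrite mulr_ge0 ?cabs_ge0.
    - by have := sqr_ge0 (cabs (c i) - cabs (c j)); lra.
    rewrite /d; case: (eqVneq i j) => [->|ij]; last by rewrite add0r ek.
    by rewrite hdot_nrm e1// expr1n rmorph1 /cabs normr1/= lerDl.
  under eq_bigr do rewrite big_split/=.
  rewrite big_split/= [X in _ + X]exchange_big/=.
  under [X in _ + X]eq_bigr do under eq_bigr do rewrite dC.
  rewrite -mulr2n; under eq_bigr do rewrite -mulr_sumr dsum.
  rewrite -mulr_suml -mulr_suml -/S.
  by rewrite -mulr_natr; have := lexx ((1 + M%:R * kappa) * S); lra.
have [S_eq0|Sneq0] := eqVneq S 0; first by rewrite S_eq0 mulr_ge0// sqr_ge0.
have Sgt0 : 0 < S by rewrite lt_def Sneq0.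
have Sle : S ^+ 2 <= nrm z ^+ 2 * nrm w ^+ 2.
  rewrite -exprMn ler_pXn2r ?nnegrE ?mulr_ge0 ?nrm_ge0//.
  by have := cauchy_schwarz z w; rewrite zw cabs_real ger0_norm.
have ww2 : nrm w ^+ 2 <= 2 * S.
  by apply: le_trans ww _; rewrite ler_wpM2r// mulrC; lra.
have := le_trans Sle (ler_wpM2l (sqr_ge0 _) ww2).
by rewrite mulrCA expr2 mulrA (ler_pM2r Sgt0).
Qed.

(** Quantitative orthogonality of eigenvectors: moving [A] across the inner product leaves
    [(l - m) <x, y>] as a difference of two residual terms. *)
Lemma approx_eigen_orthogonal A (l m e : R) x y : self_adjoint A ->
  nrm (A x - l%:C *: x) <= e -> nrm (A y - m%:C *: y) <= e ->
  `|l - m| * cabs '[x, y] <= e * (nrm x + nrm y).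
Proof.
move=> Asa xe ye.
have E : (l - m)%:C * '[x, y] = '[x, A y - m%:C *: y] - '[A x - l%:C *: x, y].
  rewrite hdotBl hdotBr hdotZl hdotZr [Num.conj _]conjc_real Asa rmorphB/=.
  ring.
rewrite -cabs_real -cabsM E (le_trans (cabsB _ _))// mulrDr lerD//.
  by rewrite (le_trans (cauchy_schwarz _ _))// mulrC ler_wpM2r ?nrm_ge0.
by rewrite (le_trans (cauchy_schwarz _ _))// ler_wpM2r ?nrm_ge0.
Qed.

(** If [u A u'] is close to [v A v'], then [u'] sends the first vector of each pair to an
    approximate eigenvector for the second spectral value, so almost orthogonally to that vector.
    Every pair then adds at least 1 to a sum that [|u - 1|_2] bounds. *)
Lemma far_conjugate A (N eta : R) : self_adjoint A ->
  infinite_set (spectrum A) -> 0 < eta ->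
  exists v v' (delta : R), [/\ U2_pair v v', hs_norm (conj2 v v' A - A) <= eta,
    0 < delta & forall u u', U2_pair u u' -> hs_norm (u - clinear_id) <= N ->
      hs_norm (conj2 u u' A - conj2 v v' A) <= delta -> False].
Proof.
move=> Asa Ainf eta0; have [C C0 AC] := clinear_nrm_bounded A.
pose Sp := (@complex.Re R) @` spectrum A.
have SpE l : Sp l -> spectrum A l%:C.
  by move=> [c cA <-]; rewrite -(spectrum_real Asa cA).
have SpC l : Sp l -> `|l| <= C + 1.
  move=> /SpE lA; have [x x1 xl] := spectrum_approx Asa lA ltr01.
  have := AC x; have := nrmB (A x) (A x - l%:C *: x).
  by rewrite subKr nrmZr x1; lra.
have Spinf : infinite_set Sp.
  move=> Spfin; apply: Ainf.
  have -> : spectrum A = (fun l : R => l%:C) @` Sp.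
    apply/seteqP; split=> [c cA|_ [l /SpE lA <-]//].
    by exists (complex.Re c); [exists c|rewrite -(spectrum_real Asa cA)].
  exact: finite_image.
have Spbd : bounded_set Sp.
  exists (C + 1); split; first exact: num_real.
  by move=> r Cr l /SpC lC; rewrite /= (le_trans lC)// ltW.
(* Each of the [M] pairs will contribute at least 1 to a sum bounded by [2 * N ^+ 2]. *)
have [M MN] : exists M : nat, 2 * N ^+ 2 < M%:R.
  by exists (Num.bound (2 * N ^+ 2)); apply: archi_boundP; rewrite mulr_ge0// sqr_ge0.
have M0 : 0 < M%:R :> R by apply: le_lt_trans MN; rewrite mulr_ge0// sqr_ge0.
(* Spectral values this close cost [8 * (eta / (16 * M)) * M = eta / 2]; the other half of [eta] is
   left for the inexactness of the eigenvectors. *)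
have eta16 : 0 < eta / (16 * M%:R) by rewrite divr_gt0// mulr_gt0.
have [l [linj lS leta]] := infinite_bounded_cluster Spinf Spbd eta16.
have [d d0 dl] := separation M.*2 linj.
pose D := C + 1.
have D0 : 0 < D by rewrite addr_gt0.
(* With [eps = K^-1] each summand secures one condition: [kappa <= 1 / 4] for the swaps,
   [kappa * M <= 1] for the Bessel bound, the remaining half of [eta], and an orthogonality error
   small against the gap [d]. *)
pose K := 8 / d + 4 * M%:R / d + 32 * M%:R / eta + (12 + 64 * D * M%:R / d) / d + 1.
pose K1 := 8 / d; pose K2 := 4 * M%:R / d; pose K3 := 32 * M%:R / eta.
pose K4 := (12 + 64 * D * M%:R / d) / d.
have K1_0 : 0 <= K1 by rewrite divr_ge0// ltW.
have K2_0 : 0 <= K2 by rewrite divr_ge0 ?(ltW d0)// mulr_ge0// ltW.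
have K3_0 : 0 <= K3 by rewrite divr_ge0 ?(ltW eta0)// mulr_ge0// ltW.
have K4_0 : 0 <= K4.
  rewrite divr_ge0 ?(ltW d0)// addr_ge0// divr_ge0 ?(ltW d0)//.
  by rewrite !mulr_ge0// ltW.
have KE : K = K1 + K2 + K3 + K4 + 1 by [].
have Kgt0 : 0 < K by rewrite KE; lra.
pose eps := K^-1; have eps0 : 0 < eps by rewrite invr_gt0.
have epsK T : T <= K -> eps * T <= 1 by move=> TK; rewrite mulrC ler_pdivrMr// mul1r.
have c1 : eps * K1 <= 1 by apply: epsK; rewrite KE; lra.
have c2 : eps * K2 <= 1 by apply: epsK; rewrite KE; lra.
have c3 : eps * K3 <= 1 by apply: epsK; rewrite KE; lra.
have c4 : eps * K4 <= 1 by apply: epsK; rewrite KE; lra.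
clearbody eps; clear K KE Kgt0 epsK K1_0 K2_0 K3_0 K4_0.
have {}c3 : 16 * eps * M%:R <= eta / 2.
  move: c3; rewrite /K3 mulrA ler_pdivrMr// mul1r; lra.
have {}c4 : 12 * eps + 64 * D * M%:R * eps / d <= d.
  move: c4; rewrite /K4 mulrA ler_pdivrMr// mul1r.
  by congr (_ <= _); field; rewrite gt_eqF.
pose kappa := 2 * eps / d.
have kappa0 : 0 <= kappa by rewrite divr_ge0 ?(ltW d0)// mulr_ge0// ltW.
have {}c1 : kappa <= 1 / 4.
  have -> : kappa = eps * K1 / 4 by rewrite /kappa /K1; field; rewrite gt_eqF.
  lra.
have {}c2 : kappa * M%:R <= 1.
  have -> : kappa * M%:R = eps * K2 / 2 by rewrite /kappa /K2; field; rewrite gt_eqF.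
  lra.
have /choice[e eP] : forall i, exists x, nrm x = 1 /\ nrm (A x - (l i)%:C *: x) <= eps.
  move=> i; have [x x1 xe] := spectrum_approx Asa (SpE _ (lS i)) eps0.
  by exists x.
have e1 i : nrm (e i) = 1 by case: (eP i).
have eA i : nrm (A (e i) - (l i)%:C *: e i) <= eps by case: (eP i).
have ek i j : (i < M.*2)%N -> (j < M.*2)%N -> i != j -> cabs '[e i, e j] <= kappa.
  move=> iM jM ij; have := approx_eigen_orthogonal Asa (eA i) (eA j).
  rewrite !e1 => h; rewrite ler_pdivlMr// mulrC.
  have := ler_wpM2r (cabs_ge0 '[e i, e j]) (dl i j iM jM ij); lra.
have dbl i : (i < M)%N -> (i.*2 < M.*2)%N /\ (i.*2.+1 < M.*2)%N.
  by move=> iM; rewrite ltn_double iM -doubleS leq_double.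
have gA i : (i < M)%N -> nrm (A (e i.*2 - e i.*2.+1) - (l i.*2)%:C *: (e i.*2 - e i.*2.+1))
    <= 2 * eps + eta / (16 * M%:R).
  move=> _; have -> : A (e i.*2 - e i.*2.+1) - (l i.*2)%:C *: (e i.*2 - e i.*2.+1) =
     (A (e i.*2) - (l i.*2)%:C *: e i.*2) - ((A (e i.*2.+1) - (l i.*2.+1)%:C *: e i.*2.+1)
     + (l i.*2.+1 - l i.*2)%:C *: e i.*2.+1).
    by rewrite clinB scalerBr rmorphB/= scalerBl; zmod.
  apply: le_trans (nrmB _ _) _.
  have := nrmD (A (e i.*2.+1) - (l i.*2.+1)%:C *: e i.*2.+1)
    ((l i.*2.+1 - l i.*2)%:C *: e i.*2.+1).
  rewrite nrmZr e1; have := eA i.*2; have := eA i.*2.+1.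
  have := leta i.*2.+1 i.*2; lra.
have [||v [v' [vP vA _ ve]]] := @swap_pairs R H A e (fun i => l i.*2) kappa _ M Asa _ _ ek gA.
- by rewrite kappa0.
- by [].
exists v, v', eps; split; [exact: vP| |exact: eps0|].
  apply: le_trans vA _.
  have -> : 8 * (2 * eps + eta / (16 * M%:R)) * M%:R = 16 * eps * M%:R + eta / 2.
    by field; rewrite gt_eqF.
  lra.
move=> u u' uP uN uv.
have [uadj uK u'K uHS u'HS] := uP; have [vadj vK v'K vHS v'HS] := vP.
have u'1 x : nrm (u' x) = nrm x by exact: nrm_isometry (is_adjoint_sym uadj) u'K.
have v'1 x : nrm (v' x) = nrm x by exact: nrm_isometry (is_adjoint_sym vadj) v'K.
have diffHS : hilbert_schmidt (conj2 u u' A - conj2 v v' A).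
  have -> : conj2 u u' A - conj2 v v' A = (conj2 u u' A - A) - (conj2 v v' A - A) by zmod.
  exact: hilbert_schmidtB (conj2_subHS Asa uP) (conj2_subHS Asa vP).
have diffsa : self_adjoint (conj2 u u' A - conj2 v v' A).
  exact: is_adjointB (conj2_sa uadj Asa) (conj2_sa vadj Asa).
have diffop x : nrm ((conj2 u u' A - conj2 v v' A) x) <= eps * nrm x.
  apply: le_trans (hs_norm_op x diffsa diffHS) _.
  by rewrite ler_wpM2r ?nrm_ge0//; exact: uv.
pose N0 := hs_norm (u - clinear_id).
have N0N : 2 * N0 ^+ 2 < M%:R.
  apply: le_lt_trans MN; rewrite ler_wpM2l//.
  have N00 : 0 <= N0 by exact: hs_norm_ge0.
  by rewrite lerXn2r// nnegrE// (le_trans N00).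
(* Near-orthonormality supplies [K = 2] in [hs_bessel], used for the adjoint [u' - 1] of [u - 1]. *)
have bes : \sum_(i < M) nrm ((u' - clinear_id) (e i.*2)) ^+ 2 <= 2 * N0 ^+ 2.
  apply: (hs_bessel (is_adjointB uadj is_adjoint_id) uHS) => z.
  apply: (@near_orthonormal_bessel (fun i => e i.*2) M kappa) => //.
  by move=> i j iM jM ij; apply: ek; rewrite ?ltn_double// -!muln2 eqn_pmul2r.
clear uN uv diffHS diffsa uHS u'HS vHS v'HS vA vP uP.
suff : M%:R <= \sum_(i < M) nrm ((u' - clinear_id) (e i.*2)) ^+ 2.
  by move=> h; have := le_lt_trans (le_trans h bes) N0N; rewrite ltxx.
rewrite -[X in X%:R]card_ord -sum1_card natr_sum; apply: ler_sum => i _.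
have [iM iM1] := dbl i (ltn_ord i).
rewrite clinearBE clinear_idE; set x := e i.*2; set y := e i.*2.+1.
set m := l i.*2.+1; pose w := u' x.
have mD : `|m| <= D by exact/SpC/lS.
pose tau := 4 * kappa * M%:R.
have r1 : nrm (v' x - y) <= tau.
  have -> : v' x - y = v' (x - v y) by rewrite clinB vK.
  by rewrite v'1 nrmC; exact: ve.
have yeps : nrm (A y - m%:C *: y) <= eps by exact: eA.
have q1 : nrm (A (v' x) - m%:C *: v' x) <= eps + 2 * D * tau.
  have -> : A (v' x) - m%:C *: v' x = (A y - m%:C *: y) + (A (v' x - y) - m%:C *: (v' x - y)).
    by rewrite clinB scalerBr; zmod.
  apply: le_trans (nrmD _ _) _; rewrite lerD//.
  apply: le_trans (nrmB _ _) _; rewrite nrmZr.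
  have := AC (v' x - y); have := ler_wpM2r (nrm_ge0 (v' x - y)) mD.
  have := ler_wpM2l (ltW D0) r1; rewrite /D; have := nrm_ge0 (v' x - y); lra.
pose p := 2 * eps + 2 * D * tau.
(* [A u' = u' (u A u')], where [u A u'] is within [eps] of [v A v'], and [v' x] is close to [y]; so
   [w] inherits the spectral value [m] of [y]. *)
have q2 : nrm (A w - m%:C *: w) <= p.
  have -> : A w - m%:C *: w = u' ((conj2 u u' A - conj2 v v' A) x + v (A (v' x) - m%:C *: v' x)).
    by rewrite /conj2 !clinE uK v'K /w; zmod.
  rewrite u'1; apply: le_trans (nrmD _ _) _.
  rewrite (nrm_isometry _ vadj vK); have := diffop x; rewrite e1 /p; lra.
have epsp : eps <= p.
  have : 0 <= D * tau by rewrite mulr_ge0 ?(ltW D0)// mulr_ge0// mulr_ge0.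
  rewrite /p; lra.
have q3 := approx_eigen_orthogonal Asa q2 (le_trans (eA i.*2) epsp).
rewrite -/x u'1 !e1 in q3.
have dm : d <= `|m - l i.*2| by apply: dl => //; rewrite gtn_eqF.
have q4 : cabs '[w, x] <= 1 / 2.
  have := ler_wpM2r (cabs_ge0 '[w, x]) dm => q5.
  have q6 : 4 * p <= d.
    have -> : 4 * p = 8 * eps + 64 * D * M%:R * eps / d.
      by rewrite /p /tau /kappa; field; rewrite gt_eqF.
    lra.
  rewrite -(ler_pM2l d0); lra.
have w1 : nrm w = 1 by rewrite u'1 e1.
have -> : u' x - x = w - x by [].
(* Unit vectors with inner product at most 1/2 in modulus are at distance at least 1. *)
rewrite nrmB_sqr w1 e1 expr1n; have := Re_le_cabs '[w, x]; lra.
Qed.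

End InfiniteSpectrum.

Section FiniteSpectrumOfSubmanifold.
Context {R : realType} {H : hilbertType R}.
Local Notation BH := (clinear H H).
Implicit Types (A u v : BH).

Lemma orbit2_refl A : orbit2 A A.
Proof.
apply/orbit2P; exists clinear_id, clinear_id.
by split; [exact: U2_pair_id|exact: clinear_ext].
Qed.

Lemma hs_sa_dist A (k l : hs_sa H) : `|k - l| = hs_norm ((A + k) - (A + l)).
Proof.
rewrite hs_sa_normE hs_sa_addE hs_sa_oppE; congr hs_norm.
by rewrite opprD addrACA subrr add0r.
Qed.

(** The sets [G n] must be avoided near every point of the orbit, not only near [A]; conjugating by
    the unitary that reaches the point transports [far_conjugate] there. *)
Lemma submanifold_finite_spectrum A : self_adjoint A ->
  submanifold [set k : hs_sa H | orbit2 A (A + k)] -> finite_set (spectrum A).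
Proof.
move=> Asa mS; apply: contrapT => Ainf.
pose S := [set k : hs_sa H | orbit2 A (A + k)].
have S0 : S 0 by rewrite /S /= addr0; exact: orbit2_refl.
pose G (n : nat) : set (hs_sa H) := [set l : hs_sa H | exists u u',
  [/\ U2_pair u u', A + l = conj2 u u' A & hs_norm (u - clinear_id) <= n%:R]].
have [] := @locally_closed_baire R (hs_sa H) S 0 G S0
  (submanifold_locally_closed mS S0).
  move=> n k r Sk r0.
  have [w [w' [wP kE]]] := (orbit2P A (A + k)).1 Sk.
  have r20 : 0 < r / 2 by rewrite divr_gt0.
  (* Going back from [w A w'] to [A] replaces [u] by [w' u], whose distance to the identity exceeds
     that of [u] by at most [|w' - 1|_2]. *)
  have [v [v' [d [vP vA d0 vd]]]] :=
    far_conjugate (n%:R + hs_norm (w' - clinear_id)) Asa Ainf r20.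
  have SX : orbit2 A (conj2 w w' (conj2 v v' A)).
    apply: (@orbit2_trans _ _ _ (conj2 v v' A)); apply/orbit2P.
      by exists v, v'; split; [exact: vP|].
    by exists w, w'; split; [exact: wP|].
  have [k' k'E] := orbit2_affine Asa SX.
  have [wadj wK w'K wHS w'HS] := wP.
  have vAsa : self_adjoint (conj2 v v' A - A).
    by case: vP => vadj _ _ _ _; apply: is_adjointB => //; exact: conj2_sa.
  exists k', (Num.min d (r / 2)); split.
  - by rewrite /S /= -k'E; exact: SX.
  - by rewrite lt_min d0.
  - by rewrite ge_min lexx orbT.
  - rewrite (hs_sa_dist A) -k'E kE -/(conj2 w w' A) -conj2B.
    have [_ h] := conj2_hs wadj wK vAsa (conj2_subHS Asa vP).
    exact: le_trans h vA.
  move=> l lk' [u [u' [uP lE uN]]].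
  have [w'uP w'uN] := U2_pair_comp (U2_pair_sym wP) uP.
  apply: (vd _ _ w'uP).
    by apply: le_trans w'uN _; rewrite addrC lerD2r; exact: uN.
  have -> : conj2 (clinear_comp w' u) (clinear_comp u' w) A - conj2 v v' A =
      conj2 w' w (l - k' : hs_sa H).
    have -> : (l - k' : hs_sa H) = (A + l) - (A + k') :> BH.
      by rewrite opprD addrACA subrr add0r.
    rewrite lE -k'E conj2B conj2K//; congr (_ - _).
    exact: clinear_ext.
  have [lHS lsa] := hs_saP (l - k').
  have [_ h] := conj2_hs (is_adjoint_sym wadj) w'K lsa lHS.
  apply: le_trans h _; rewrite -hs_sa_normE.
  by apply: le_trans lk' _; rewrite ge_min lexx.
move=> l Sl nG; have [u [u' [uP lE]]] := (orbit2P A (A + l)).1 Sl.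
apply: (nG (Num.bound (hs_norm (u - clinear_id)))); exists u, u'; split.
- exact: uP.
- exact: lE.
- by apply: ltW; apply: archi_boundP; exact: hs_norm_ge0.
Qed.

End FiniteSpectrumOfSubmanifold.

(** * Finite spectrum implies submanifold *)

Section AnnihilatingPolynomial.
Context {R : realType} {H : hilbertType R}.
Local Notation BH := (clinear H H).
Implicit Types (A B : BH) (x y : H).

(** With [b] the norm of [B], suppose that [B - b] and [B + b] are both invertible. Then [B^2 - b^2]
    is bounded below, while [|(B^2 - b^2) x|^2 <= b^2 (b^2 - |B x|^2)] on the unit ball; this keeps
    [|B x|] away from its supremum [b]. *)
Lemma sa_spectrum0 B : self_adjoint B ->
  (forall l, spectrum B l -> l = 0) -> B = 0.
Proof.
move=> Bsa B0; apply: contrapT => Bneq0.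
have [C0 C00 BC] := clinear_nrm_bounded B.
pose S := [set nrm (B x) | x in [set x : H | nrm x <= 1]].
have Ssup : has_sup S.
  split; first by exists (nrm (B 0)), 0 => //; rewrite /= nrm0.
  exists C0 => _ [x /= x1 <-]; apply: le_trans (BC x) _.
  by rewrite ler_piMr// ltW.
pose b := sup S.
have bub x : nrm x <= 1 -> nrm (B x) <= b.
  by move=> x1; apply: ub_le_sup; [exact: Ssup.2|exists x].
have Bb x : nrm (B x) <= b * nrm x.
  have [->|x0] := eqVneq x 0; first by rewrite clin0 nrm0 mulr0.
  have nx : 0 < nrm x by rewrite nrm_gt0.
  have nV : `|(nrm x)^-1| = (nrm x)^-1 by rewrite gtr0_norm// invr_gt0.
  have := bub ((nrm x)^-1%:C *: x); rewrite clinZ !nrmZr nV mulVf ?gt_eqF//.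
  by move=> /(_ (lexx _)); rewrite ler_pdivrMl// mulrC.
have b0 : 0 < b.
  rewrite ltNge; apply/negP => b0; apply: Bneq0; apply: clinear_ext => x.
  apply/eqP; rewrite clinear0E -nrm_eq0 eq_le nrm_ge0 andbT.
  by apply: le_trans (Bb x) _; rewrite mulr_le0_ge0 ?nrm_ge0.
have inv (c : R) : c != 0 -> exists T : BH, cancel (B - c%:C *: clinear_id) T.
  move=> c0; have : ~ spectrum B c%:C.
    by move=> /B0 [] /eqP; rewrite (negbTE c0).
  by move=> /contrapT[T [TK _]]; exists T.
have [T1 T1K] := inv b (lt0r_neq0 b0).
have [|T2 T2K] := inv (- b); first by rewrite oppr_eq0 lt0r_neq0.
have [D1 D10 T1D] := clinear_nrm_bounded T1.
have [D2 D20 T2D] := clinear_nrm_bounded T2.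
(* [D1 * D2] bounds the inverse of [B^2 - b^2], so this constant yields
   [|B x|^2 <= L (b^2 - |B x|^2)]. *)
pose L := (D1 * D2) ^+ 2 * b ^+ 4.
have L0 : 0 < L by rewrite mulr_gt0 ?exprn_gt0 ?mulr_gt0.
have low x : nrm x <= 1 -> nrm (B x) ^+ 2 <= L / (1 + L) * b ^+ 2.
  move=> x1; have xE : x = T2 (T1 (B (B x) - (b ^+ 2)%:C *: x)).
    rewrite -{1}(T2K x) -(T1K ((B - (- b)%:C *: clinear_id) x)); congr (T2 (T1 _)).
    rewrite !clinE rmorphN rmorphXn/= !scaleNr !opprK. rewrite ?scalerA expr2.
    by zmod.
  have nx : nrm x <= D1 * D2 * nrm (B (B x) - (b ^+ 2)%:C *: x).
    rewrite {1}xE (le_trans (T2D _))// mulrC -mulrA (mulrC D2) mulrA.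
    by rewrite ler_wpM2r// ltW.
  have nsq : nrm (B (B x) - (b ^+ 2)%:C *: x) ^+ 2 <= b ^+ 2 * (b ^+ 2 - nrm (B x) ^+ 2).
    rewrite nrmB_sqr hdotZr [Num.conj _]conjc_real Bsa hdot_nrm -rmorphM/=.
    rewrite nrmZr ger0_norm ?sqr_ge0// exprMn.
    have h1 : nrm (B (B x)) ^+ 2 <= b ^+ 2 * nrm (B x) ^+ 2.
      by rewrite -exprMn lerXn2r ?nnegrE ?mulr_ge0 ?nrm_ge0 ?(ltW b0).
    have h2 : (b ^+ 2) ^+ 2 * nrm x ^+ 2 <= (b ^+ 2) ^+ 2.
      by rewrite ler_piMr ?sqr_ge0// expr_le1 ?nrm_ge0.
    lra.
  have h3 : nrm x ^+ 2 <= (D1 * D2) ^+ 2 * (b ^+ 2 * (b ^+ 2 - nrm (B x) ^+ 2)).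
    have h : nrm x ^+ 2 <= (D1 * D2 * nrm (B (B x) - (b ^+ 2)%:C *: x)) ^+ 2.
      by rewrite lerXn2r ?nnegrE ?mulr_ge0 ?nrm_ge0 ?(ltW D10) ?(ltW D20).
    by apply: le_trans h _; rewrite exprMn; apply: ler_wpM2l nsq; exact: sqr_ge0.
  have h4 : nrm (B x) ^+ 2 <= b ^+ 2 * nrm x ^+ 2.
    by rewrite -exprMn lerXn2r ?nnegrE ?mulr_ge0 ?nrm_ge0 ?(ltW b0).
  have h5 : nrm (B x) ^+ 2 <= L * (b ^+ 2 - nrm (B x) ^+ 2).
    apply: le_trans h4 _; have := ler_wpM2l (sqr_ge0 b) h3; rewrite /L; lra.
  rewrite mulrAC ler_pdivlMr ?addr_gt0//; lra.
pose g := L / (1 + L).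
have g1 : 0 <= g < 1.
  apply/andP; split; first by rewrite divr_ge0// ?addr_ge0// ltW.
  by rewrite ltr_pdivrMr ?addr_gt0// mul1r ltrDr.
case/andP: g1 => g0 g1.
have sg1 : Num.sqrt g < 1 by rewrite -sqrtr1 ltr_sqrt.
suff : b <= Num.sqrt g * b.
  by rewrite leNgt gtr_pMl// sg1.
apply: ge_sup; first exact: Ssup.1.
move=> _ [x /= x1 <-].
rewrite -(@ler_pXn2r _ 2) ?nnegrE ?nrm_ge0 ?mulr_ge0 ?sqrtr_ge0 ?(ltW b0)//.
by rewrite exprMn sqr_sqrtr// low.
Qed.

Lemma peval_prod_invertible A (r : seq R[i]) : (forall z, z \in r -> ~ spectrum A z) ->
  exists T : BH, cancel (peval A (\prod_(z <- r) ('X - z%:P))) T /\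
    cancel T (peval A (\prod_(z <- r) ('X - z%:P))).
Proof.
elim: r => [|z r IH] rA.
  exists clinear_id; rewrite big_nil -[1]/(1%:P) pevalC scale1r.
  by split.
have [T [TK KT]] : exists T : BH, cancel (A - z *: clinear_id) T /\
    cancel T (A - z *: clinear_id).
    by have /contrapT := rA z (mem_head _ _).
have [|U [UK KU]] := IH; first by move=> y yr; apply: rA; rewrite inE yr orbT.
exists (clinear_comp U T); rewrite big_cons pevalM pevalXsubC.
by split=> x; rewrite !clinear_compE ?TK ?UK ?KU ?KT.
Qed.

(** The product [N' N] is self-adjoint even if [s] has non-real entries. For nonzero [l] the roots
    of [n' n - l] avoid the spectrum of [A], so [l] is no spectral value of [N' N]. The extra root
    [0] makes [n' n - l] a nonzero polynomial also when [s] is empty. *)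
Lemma finite_spectrum_peval0 A (s : seq R[i]) : self_adjoint A ->
  (forall z, spectrum A z -> z \in s) ->
  peval A (\prod_(z <- 0 :: s) ('X - z%:P)) = 0.
Proof.
move=> Asa As; set n := \prod_(z <- _) _.
pose n' := map_poly Num.conj n; pose N := peval A n; pose N' := peval A n'.
have NN' : is_adjoint N N' by exact: peval_adjoint.
pose W := clinear_comp N' N.
have Wsa : self_adjoint W by exact: (is_adjoint_comp (is_adjoint_sym NN') NN').
have WE : W = peval A (n' * n) by rewrite pevalM.
have W0 : W = 0.
  apply: sa_spectrum0 => // l lW; apply: contrapT => /eqP l0; apply: lW.
  pose p := n' * n - l%:P.
  have n0 : n.[0] = 0 by rewrite /n big_cons hornerM hornerXsubC subrr mul0r.
  have p0 : p != 0.
    apply/eqP => /(congr1 (horner^~ 0)).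
    rewrite /p hornerD hornerN hornerC hornerM n0 mulr0 horner0 sub0r => /eqP.
    by rewrite oppr_eq0 (negbTE l0).
  have [r pr] := closed_field_poly_normal p.
  have a0 : lead_coef p != 0 by rewrite lead_coef_eq0.
  have rA z : z \in r -> ~ spectrum A z.
    move=> zr /As zs; have : root p z.
      by rewrite pr rootZ// root_prod_XsubC.
    rewrite /root /p hornerD hornerN hornerC hornerM.
    have -> : n.[z] = 0.
      by apply/eqP; rewrite -[_ == 0]/(root n z) root_prod_XsubC inE zs orbT.
    by rewrite mulr0 sub0r oppr_eq0 (negbTE l0).
  have [T [TK KT]] := peval_prod_invertible rA.
  have E x : (W - l *: clinear_id) x =
      lead_coef p *: peval A (\prod_(z <- r) ('X - z%:P)) x.
    have -> : W - l *: clinear_id = peval A p.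
      by rewrite /p pevalD -polyCN pevalC WE scaleNr.
    by rewrite {1}pr -mul_polyC pevalM pevalC !clinE.
  exists ((lead_coef p)^-1 *: T); split=> x.
    by rewrite E !clinE TK scalerA mulVf// scale1r.
  by rewrite E !clinE KT scalerA mulfV// scale1r.
apply: clinear_ext => x; apply/eqP; rewrite clinear0E -nrm_eq0 -sqrf_eq0.
rewrite -(inj_eq (@complexI R)) -hdot_nrm NN' -[N' _]/(W x) W0 clinear0E.
by rewrite hdot0r.
Qed.

Lemma finite_spectrum_annihilator A : self_adjoint A -> finite_set (spectrum A) ->
  exists2 t : seq R, uniq t & peval A (\prod_(r <- t) ('X - (r%:C)%:P)) = 0.
Proof.
move=> Asa /finite_seqP[s sE].
have As z : spectrum A z -> z \in s by rewrite sE.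
have := finite_spectrum_peval0 Asa As.
move: (0 :: s) => {sE As} {}s sx.
have [t ut tE] : exists2 t : seq R, uniq t & forall x,
    peval A (\prod_(z <- s) ('X - z%:P)) x = 0 ->
    peval A (\prod_(r <- t) ('X - (r%:C)%:P)) x = 0.
  elim: s {sx} => [|c s [t ut tE]].
    by exists [::] => // x; rewrite !big_nil.
  pose G := peval A (\prod_(r <- t) ('X - (r%:C)%:P)).
  have sG x : peval A (\prod_(z <- c :: s) ('X - z%:P)) x = 0 ->
      A (G x) - c *: G x = 0.
    rewrite big_cons pevalM clinear_compE peval_comm => /tE.
    by rewrite peval_comm pevalXsubC !clinE.
  have [cI|cI] := eqVneq (complex.Im c) 0; last first.
    exists t => // x /sG Gx; apply/eqP; rewrite -nrm_eq0.
    have := sa_sub_low c (G x) Asa; rewrite Gx nrm0 pmulr_rle0 ?normr_gt0//.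
    by move=> h; rewrite eq_le h nrm_ge0.
  have cE : c = (complex.Re c)%:C by case: c cI {sG} => a b /= ->.
  set r := complex.Re c in cE; have [rt|rt] := boolP (r \in t); last first.
    exists (r :: t); first by rewrite /= rt.
    move=> x /sG; rewrite big_cons pevalM clinear_compE pevalXsubC -cE.
    by rewrite !clinE.
  exists t => // x /sG; rewrite -/(G x).
  have -> : G x = (A - c *: clinear_id)
      (peval A (\prod_(i <- rem r t) ('X - (i%:C)%:P)) x).
    by rewrite /G (big_rem r rt)/= pevalM clinear_compE pevalXsubC -cE.
  set y := peval A _ x; rewrite clinearBE clinearZE clinear_idE.
  set z := A y - c *: y => zE; apply/eqP; rewrite -nrm_eq0 -sqrf_eq0.
  rewrite -(inj_eq (@complexI R)) -hdot_nrm {2}/z hdotBr hdotZr -Asa.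
  have -> : Num.conj c = c by rewrite cE; exact: conjc_real.
  by rewrite -hdotZl -hdotBl zE hdot0l.
by exists t => //; apply: clinear_ext => x; apply: tE; rewrite sx.
Qed.

End AnnihilatingPolynomial.

(** * Jordan products and compressions of Hilbert-Schmidt operators *)

Section JordanProduct.
Context {R : realType} {H : hilbertType R}.
Local Notation BH := (clinear H H).
Implicit Types (a b p : BH) (k l : hs_sa H).

(** Unlike composition this preserves self-adjointness, and it agrees with composition on commuting
    operators. *)
Definition jordan a b : BH := (2^-1 : R)%:C *: (clinear_comp a b + clinear_comp b a).

Lemma jordanE a b x : jordan a b x = (2^-1 : R)%:C *: (a (b x) + b (a x)).
Proof. by []. Qed.

Lemma half_double (x : H) : (2^-1 : R)%:C *: (x + x) = x.
Proof.
have -> : x + x = (2 : R)%:C *: x by rewrite rmorph_nat scaler_nat mulr2n.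
by rewrite scalerA -rmorphM mulVf ?pnatr_eq0// rmorph1 scale1r.
Qed.

Lemma jordan_comm a b : (forall x, a (b x) = b (a x)) ->
  jordan a b = clinear_comp a b.
Proof. by move=> ab; apply: clinear_ext => x; rewrite jordanE -ab half_double. Qed.

Lemma self_adjointZr (r : R) a : self_adjoint a -> self_adjoint (r%:C *: a).
Proof.
move=> asa; have := is_adjointZ r%:C asa.
by rewrite (_ : Num.conj r%:C = r%:C)//; exact: conjc_real.
Qed.

Lemma jordan_sa a b : self_adjoint a -> self_adjoint b -> self_adjoint (jordan a b).
Proof.
move=> asa bsa; apply: self_adjointZr.
have := is_adjointD (is_adjoint_comp asa bsa) (is_adjoint_comp bsa asa).
by rewrite [X in is_adjoint _ X]addrC.
Qed.

Lemma jordan_hs b (C : R) k : self_adjoint b -> 0 <= C ->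
  (forall x, nrm (b x) <= C * nrm x) ->
  [/\ hilbert_schmidt (jordan b k), self_adjoint (jordan b k) &
      hs_norm (jordan b k) <= C * `|k|].
Proof.
move=> bsa C0 bC; have [kHS ksa] := hs_saP k.
have [h1 h2] := hs_compl C0 bC kHS.
have [h3 h4] := hs_compr ksa bsa C0 bC kHS.
have h5 := hilbert_schmidtD h1 h3.
have h6 := le_trans (ler_hs_normD h1 h3) (lerD h2 h4).
split; [exact: hilbert_schmidtZ h5|exact: jordan_sa bsa ksa|].
rewrite /jordan (hs_normZ _ h5) ger0_norm ?invr_ge0// hs_sa_normE.
rewrite ler_pdivrMl ?ltr0n// mulr_natl mulr2n; exact: h6.
Qed.

Lemma hs_sa_linear_ex (f : BH -> BH) (C : R) : 0 <= C ->
  (forall k, [/\ hilbert_schmidt (f k), self_adjoint (f k) & hs_norm (f k) <= C * `|k|]) ->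
  (forall (r : R) k l, f (r%:C *: (k : BH) + (l : BH)) = r%:C *: f k + f l) ->
  exists L : clinear (hs_sa H) (hs_sa H), forall k, L k = f k :> BH.
Proof.
move=> C0 fC fl; have /choice[g gE] : forall k : hs_sa H, exists l : hs_sa H, l = f k :> BH.
  by move=> k; have [h1 h2 _] := fC k; exact: hs_sa_pack h1 h2.
have gl : linear g.
  move=> r k l; apply: hs_sa_inj; rewrite (gE (r *: k + l)).
  apply: etrans (fl r k l) _; rewrite -(gE k) -(gE l); exact: erefl.
have gC k : `|g k| <= C * `|k|.
  have [_ _ h] := fC k; rewrite hs_sa_normE (gE k); exact: h.
by exists (mk_clinear gl C0 gC) => k; exact: gE k.
Qed.

Lemma jordanl_ex b : self_adjoint b ->
  exists L : clinear (hs_sa H) (hs_sa H), forall k, L k = jordan b k :> BH.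
Proof.
move=> bsa; have [C C0 bC] := clinear_nrm_bounded b.
apply: (@hs_sa_linear_ex _ C (ltW C0)) => [k|r k l].
  exact: jordan_hs bsa (ltW C0) bC.
apply: clinear_ext => x; rewrite /jordan !clinE !scalerDr !scalerA mulrC.
by zmod.
Qed.

Lemma jordan2_ex : exists2 J : hs_sa H -> hs_sa H -> hs_sa H,
  forall k l, J k l = jordan k l :> BH &
  bilinear_bounded J /\ forall k l, `|J k l| <= `|k| * `|l|.
Proof.
have jP k l := jordan_hs l (hs_saP k).2 (normr_ge0 k) (hs_sa_op k).
have /choice[J0 J0E] : forall kl : hs_sa H * hs_sa H, exists j : hs_sa H,
    j = jordan kl.1 kl.2 :> BH.
  by move=> [k l]; have [h1 h2 _] := jP k l; exact: hs_sa_pack h1 h2.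
pose J k l := J0 (k, l).
have JE k l : J k l = jordan k l :> BH by exact: J0E (k, l).
have Jn k l : `|J k l| <= `|k| * `|l|.
  by have [_ _ h] := jP k l; rewrite hs_sa_normE (JE k l); exact: h.
clearbody J; exists J; [exact: JE|split; [split=> [l r k k'|k r l l'|]|exact: Jn]].
- apply: hs_sa_inj; rewrite (JE (r *: k + k') l).
  transitivity (r%:C *: jordan k l + jordan k' l).
    apply: clinear_ext => x; rewrite /jordan hs_sa_addE hs_sa_scaleE.
    by rewrite !clinE !scalerDr !scalerA mulrC; zmod.
  by rewrite -(JE k l) -(JE k' l); exact: erefl.
- apply: hs_sa_inj; rewrite (JE k (r *: l + l')).
  transitivity (r%:C *: jordan k l + jordan k l').
    apply: clinear_ext => x; rewrite /jordan hs_sa_addE hs_sa_scaleE.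
    by rewrite !clinE !scalerDr !scalerA mulrC; zmod.
  by rewrite -(JE k l) -(JE k l'); exact: erefl.
exists 1; first exact: ltr01.
move=> k l; rewrite mul1r; exact: Jn.
Qed.

Section Compression.
Variables (p : BH) (psa : self_adjoint p).

Definition compress a : BH := clinear_comp p (clinear_comp a p).

Lemma compress_hs (C : R) k : 0 <= C -> (forall x, nrm (p x) <= C * nrm x) ->
  [/\ hilbert_schmidt (compress k), self_adjoint (compress k) &
      hs_norm (compress k) <= C ^+ 2 * `|k|].
Proof.
move=> C0 pC; have [kHS ksa] := hs_saP k.
have [h1 h2] := hs_compr ksa psa C0 pC kHS.
have [h3 h4] := hs_compl C0 pC h1.
split; [exact: h3|exact: is_adjoint_comp psa (is_adjoint_comp ksa psa)|].
apply: le_trans h4 _; rewrite expr2 -mulrA; exact: (ler_wpM2l C0 h2).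
Qed.

Lemma compression_ex :
  exists L : clinear (hs_sa H) (hs_sa H), forall k, L k = compress k :> BH.
Proof.
have [C C0 pC] := clinear_nrm_bounded p.
apply: (@hs_sa_linear_ex _ (C ^+ 2) (sqr_ge0 C)) => [k|r k l].
  exact: compress_hs (ltW C0) pC.
by apply: clinear_ext => x; rewrite /compress !clinE.
Qed.

End Compression.

End JordanProduct.

(** * Lagrange interpolation polynomials *)

Section LagrangePolynomials.
Context {F : fieldType}.
Implicit Types (t : seq F) (r s : F).

Definition lagrange_num t r : {poly F} := \prod_(s <- rem r t) ('X - s%:P).

Definition lagrange_poly t r : {poly F} :=
  ((lagrange_num t r).[r])^-1 *: lagrange_num t r.

Lemma lagrange_numE t r : r \in t ->
  \prod_(s <- t) ('X - s%:P) = ('X - r%:P) * lagrange_num t r.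
Proof. by move=> rt; rewrite (big_rem r rt). Qed.

Lemma lagrange_num_neq0 t r : uniq t -> (lagrange_num t r).[r] != 0.
Proof.
move=> ut; rewrite -[_ == 0]/(root (lagrange_num t r) r) root_prod_XsubC.
by rewrite mem_rem_uniqF.
Qed.

Lemma lagrange_poly_eval t r s : uniq t -> r \in t -> s \in t ->
  (lagrange_poly t r).[s] = (s == r)%:R.
Proof.
move=> ut rt st; rewrite hornerZ; case: eqVneq => [->|sr].
  by rewrite mulVf// lagrange_num_neq0.
have -> : (lagrange_num t r).[s] = 0; last by rewrite mulr0.
apply/eqP; rewrite -[_ == 0]/(root (lagrange_num t r) s) root_prod_XsubC.
by rewrite mem_rem_uniq// inE sr.
Qed.

(** The difference has degree below [size t] and vanishes at every point of [t]. The member [r0]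
    excludes the empty list, whose sum is [0]. *)
Lemma lagrange_poly_sum t r0 : uniq t -> r0 \in t ->
  \sum_(r <- t) lagrange_poly t r = 1.
Proof.
move=> ut r0t; apply/eqP; rewrite -subr_eq0; apply/eqP.
apply: (@roots_geq_poly_eq0 _ _ t).
- apply/allP => s st; rewrite /root hornerD hornerN hornerC horner_sum.
  rewrite (bigD1_seq s)//= lagrange_poly_eval// eqxx big_seq_cond big1 ?addr0 ?subrr//.
  by move=> r /andP[rt rs]; rewrite lagrange_poly_eval// eq_sym (negbTE rs).
- exact: ut.
have n0 : (0 < size t)%N by case: (t) r0t.
apply: leq_trans (size_polyD _ _) _; rewrite geq_max; apply/andP; split; last first.
  by rewrite size_polyN size_poly1.
apply: leq_trans (size_sum _ _ _) _; rewrite big_seq; elim/big_ind: _ => //.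
  by move=> m n mt nt; rewrite geq_max mt nt.
move=> r rt; apply: leq_trans (size_scale_leq _ _) _.
by rewrite size_prod_XsubC size_rem// prednK.
Qed.

(** Identifies [m'(r)] with the normalizing constant of the Lagrange polynomial, nonzero for
    distinct roots. *)
Lemma deriv_prod_XsubC t r : r \in t ->
  (\prod_(s <- t) ('X - s%:P))^`().[r] = (lagrange_num t r).[r].
Proof.
move=> rt; rewrite (lagrange_numE rt) derivM derivXsubC mul1r hornerD hornerM.
by rewrite hornerXsubC subrr mul0r addr0.
Qed.

End LagrangePolynomials.

(** * Real polynomials of an operator and spectral projections *)

Section RealPolynomialEvaluation.
Context {R : realType} {H : hilbertType R}.
Local Notation BH := (clinear H H).
Implicit Types (X A u v : BH) (q : {poly R}) (x : H).

(** Real coefficients keep polynomials of self-adjoint operators self-adjoint. *)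
Definition rpeval X q : BH := peval X (map_poly (real_complex R) q).

Lemma rpeval0 X : rpeval X 0 = 0.
Proof. by rewrite /rpeval map_poly0 peval0. Qed.

Lemma rpevalD X p q : rpeval X (p + q) = rpeval X p + rpeval X q.
Proof. by rewrite /rpeval rmorphD/= pevalD. Qed.

Lemma rpevalC X (c : R) : rpeval X c%:P = c%:C *: clinear_id.
Proof. by rewrite /rpeval map_polyC/= pevalC. Qed.

Lemma rpevalM X p q : rpeval X (p * q) = clinear_comp (rpeval X p) (rpeval X q).
Proof. by rewrite /rpeval rmorphM/= pevalM. Qed.

Lemma rpevalX X x : rpeval X 'X x = X x.
Proof.
rewrite /rpeval map_polyX; have := pevalXsubC X 0.
by rewrite subr0 => ->; rewrite scale0r subr0.
Qed.

Lemma rpeval_sum X I (r : seq I) (f : I -> {poly R}) :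
  rpeval X (\sum_(i <- r) f i) = \sum_(i <- r) rpeval X (f i).
Proof.
by elim/big_rec2: _ => [|i a b _ <-]; [exact: rpeval0|rewrite rpevalD].
Qed.

Lemma rpeval_comm X p q x : rpeval X p (rpeval X q x) = rpeval X q (rpeval X p x).
Proof. exact: peval_comm. Qed.

Lemma rpeval_commX X q x : X (rpeval X q x) = rpeval X q (X x).
Proof. exact: peval_commX. Qed.

Lemma rpeval_sa X q : self_adjoint X -> self_adjoint (rpeval X q).
Proof.
move=> Xsa; have := @peval_adjoint R H X X (map_poly (real_complex R) q) Xsa.
suff -> : map_poly Num.conj (map_poly (real_complex R) q) =
  map_poly (real_complex R) q by [].
by rewrite -map_poly_comp; apply: eq_map_poly => c; exact: conjc_real.
Qed.

Lemma rpeval_conj2 u v X q : cancel u v -> cancel v u ->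
  rpeval (conj2 u v X) q = conj2 u v (rpeval X q).
Proof. exact: peval_conj2. Qed.

Lemma rpeval_eigen X q (r : R) (a : BH) : (forall x, X (a x) = r%:C *: a x) ->
  forall x, rpeval X q (a x) = q.[r]%:C *: a x.
Proof.
move=> Xa; elim/poly_ind: q => [|q c IH] x.
  by rewrite rpeval0 horner0 scale0r.
rewrite rpevalD rpevalM rpevalC !clinE rpevalX Xa clinZ IH hornerMXaddC.
by rewrite scalerA -scalerDl rmorphD rmorphM mulrC.
Qed.

Section SpectralProjections.
Variables (t : seq R) (X : BH).
Hypotheses (ut : uniq t) (Xsa : self_adjoint X).
Hypothesis Xt : rpeval X (\prod_(r <- t) ('X - r%:P)) = 0.

(** As a polynomial in [X] with coefficients depending on [t] only, it commutes with [X], and its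
    change under a perturbation of [X] is an instance of [polynomial_increment]. *)
Definition sproj r : BH := rpeval X (lagrange_poly t r).

Lemma sproj_sa r : self_adjoint (sproj r).
Proof. exact: rpeval_sa. Qed.

Lemma sproj_eigen r x : r \in t -> X (sproj r x) = r%:C *: sproj r x.
Proof.
move=> rt; apply/eqP; rewrite -subr_eq0 -[X in X - _]rpevalX.
have -> : r%:C *: sproj r x = rpeval X r%:P (sproj r x).
  by rewrite rpevalC clinearZE clinear_idE.
have -> : rpeval X 'X (sproj r x) - rpeval X r%:P (sproj r x) =
    rpeval X ('X - r%:P) (sproj r x).
  by rewrite -polyCN rpevalD !clinE !rpevalC !clinE rmorphN scaleNr.
rewrite -[rpeval _ _ _]/(clinear_comp (rpeval X ('X - r%:P)) (sproj r) x).
rewrite -rpevalM /lagrange_poly -scalerAr -(lagrange_numE rt) -mul_polyC rpevalM.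
by rewrite Xt clinear_compE clinear0E clin0.
Qed.

Lemma sproj_comm r x : X (sproj r x) = sproj r (X x).
Proof. exact: rpeval_commX. Qed.

Lemma sproj_mul r s x : r \in t -> s \in t ->
  sproj s (sproj r x) = if r == s then sproj r x else 0.
Proof.
move=> rt st; rewrite (rpeval_eigen _ (fun y => sproj_eigen y rt)).
rewrite lagrange_poly_eval//; case: eqP => _; first by rewrite rmorph1 scale1r.
by rewrite rmorph0 scale0r.
Qed.

Lemma sproj_sum r0 x : r0 \in t -> \sum_(r <- t) sproj r x = x.
Proof.
move=> r0t; rewrite -clinear_sumE -rpeval_sum (lagrange_poly_sum ut r0t).
by rewrite -[1]/(1%:P) rpevalC rmorph1 scale1r clinear_idE.
Qed.

End SpectralProjections.

End RealPolynomialEvaluation.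

(** Quantitative strict differentiability at [0]: on the ball of radius [rho] the remainder is
    Lipschitz with constant proportional to [rho]. This is the Leibniz step from [q] to
    [q * 'X + c]. *)
Lemma bilinear_increment {R : realType} {E : normedModType R}
    (JA JQ L : clinear E E) (J2 : E -> E -> E) (K : E -> E) (C : R) :
  bilinear_bounded J2 -> (forall k l, `|J2 k l| <= `|k| * `|l|) -> K 0 = 0 -> 0 <= C ->
  (forall (rho : R) k l, 0 <= rho <= 1 -> `|k| <= rho -> `|l| <= rho ->
    `|K k - K l - L (k - l)| <= C * rho * `|k - l|) ->
  forall (rho : R) k l, 0 <= rho <= 1 -> `|k| <= rho -> `|l| <= rho ->
    `|JA (K k) + JQ k + J2 (K k) k - (JA (K l) + JQ l + J2 (K l) l) -
      (clinear_comp JA L + JQ) (k - l)| <=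
    (`|JA| * C + 2 * (`|L| + C)) * rho * `|k - l|.
Proof.
move=> J2b J2n K0 C0 Kd.
have KLip (rho : R) (k l : E) : 0 <= rho <= 1 -> `|k| <= rho -> `|l| <= rho ->
    `|K k - K l| <= (`|L| + C) * `|k - l|.
  move=> rho01 kr lr.
  have -> : K k - K l = (K k - K l - L (k - l)) + L (k - l) by rewrite subrK.
  apply: le_trans (ler_normD _ _) _; rewrite mulrDl addrC; apply: lerD.
    exact: clinear_norm_le.
  apply: le_trans (Kd rho k l rho01 kr lr) _; apply: ler_wpM2r; first exact: normr_ge0.
  by apply: ler_piMr; [exact: C0|case/andP: rho01].
move=> rho k l rho01 kr lr.
have -> : JA (K k) + JQ k + J2 (K k) k - (JA (K l) + JQ l + J2 (K l) l) -
    (clinear_comp JA L + JQ) (k - l) =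
    JA (K k - K l - L (k - l)) + (J2 (K k - K l) k + J2 (K l) (k - l)).
  rewrite !clinE (bilinearBl J2b) (bilinearBr J2b).
  by zmod.
have h1 : `|JA (K k - K l - L (k - l))| <= `|JA| * (C * rho * `|k - l|).
  apply: le_trans (clinear_norm_le _ _) _; apply: ler_wpM2l; first exact: normr_ge0.
  exact: Kd.
have h2 : `|J2 (K k - K l) k| <= (`|L| + C) * `|k - l| * rho.
  apply: le_trans (J2n _ _) _; apply: ler_pM; [exact: normr_ge0|exact: normr_ge0| |exact: kr].
  exact: KLip rho01 kr lr.
have h3 : `|J2 (K l) (k - l)| <= (`|L| + C) * rho * `|k - l|.
  apply: le_trans (J2n _ _) _; apply: ler_wpM2r; first exact: normr_ge0.
  have rho0 : `|0 : E| <= rho by rewrite normr0; case/andP: rho01.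
  have := KLip rho l 0 rho01 lr rho0; rewrite K0 !subr0 => h.
  apply: le_trans h _; apply: ler_wpM2l; last exact: lr.
  by apply: addr_ge0; [exact: normr_ge0|exact: C0].
apply: le_trans (ler_normD _ _) _.
apply: le_trans (lerD h1 (le_trans (ler_normD _ _) (lerD h2 h3))) _.
move: `|JA| `|L| `|k - l| => n1 n2 n3.
by rewrite le_eqVlt; apply/orP; left; apply/eqP; ring.
Qed.

Section PolynomialIncrement.
Context {R : realType} {H : hilbertType R}.
Local Notation BH := (clinear H H).
Implicit Types (k l : hs_sa H) (x : H).
Variables (A : BH) (t : seq R).
Hypotheses (Asa : self_adjoint A) (ut : uniq t).
Hypothesis At : rpeval A (\prod_(r <- t) ('X - r%:P)) = 0.

Let P r := sproj t A r.

(* [A + k] commutes with its polynomials, so multiplying by it can be written with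
   Jordan products, which stay inside the self-adjoint operators. *)
Let increment_step (q : {poly R}) (c : R) (K JA JQ : hs_sa H -> hs_sa H)
    (J2 : hs_sa H -> hs_sa H -> hs_sa H) k :
  K k = rpeval (A + k) q - rpeval A q :> BH ->
  JA (K k) = jordan A (K k) :> BH ->
  JQ k = jordan (rpeval A q) k :> BH ->
  J2 (K k) k = jordan (K k) k :> BH ->
  JA (K k) + JQ k + J2 (K k) k =
    rpeval (A + k) (q * 'X + c%:P) - rpeval A (q * 'X + c%:P) :> BH.
Proof.
move=> KE JAE JQE J2E; rewrite !hs_sa_addE JAE JQE J2E.
have [L LE] : exists L : BH, L = K k by exists (K k).
have [k' k'E] : exists k' : BH, k' = k by exists (k : BH).
have [Q QE] : exists Q : BH, Q = rpeval A q by exists (rpeval A q).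
have AQ x : A (Q x) = Q (A x) by rewrite QE rpeval_commX.
rewrite -LE -k'E -QE in KE *.
have XE x : rpeval (A + k') q x = Q x + L x by rewrite KE !clinE; zmod.
have XQ x : A (Q x) + A (L x) + k' (Q x) + k' (L x) =
    Q (A x) + Q (k' x) + L (A x) + L (k' x).
  have := rpeval_commX (A + k') q x; rewrite !XE !clinE => XQ.
  transitivity (A (Q x) + A (L x) + (k' (Q x) + k' (L x))); first by zmod.
  by rewrite XQ; zmod.
apply: clinear_ext => x.
rewrite !rpevalD !rpevalM !rpevalC !clinearDE !jordanE !clinE !rpevalX -QE.
rewrite [rpeval (A + k') q _]XE !clinE -!scalerDr -[RHS]half_double; congr (_ *: _).
have {}XQ : A (L x) + k' (Q x) + k' (L x) = Q (k' x) + L (A x) + L (k' x).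
  apply: (addrI (A (Q x))); rewrite !addrA XQ AQ; zmod.
transitivity ((A (L x) + k' (Q x) + k' (L x)) + (L (A x) + Q (k' x) + L (k' x))).
  by zmod.
by rewrite XQ; zmod.
Qed.

(** [L] is the derivative at [0]. Only its diagonal blocks are recorded: there [A] acts as the
    scalar [r], so the derivative of [q] is multiplication by [q'(r)]. The remainder estimate serves
    both the chart, with [q = m], and the spectral projections, with [q] a Lagrange polynomial. *)
Lemma polynomial_increment (q : {poly R}) :
  exists (K : hs_sa H -> hs_sa H) (L : clinear (hs_sa H) (hs_sa H)) (C : R),
  [/\ smooth_on setT K, forall k, K k = rpeval (A + k) q - rpeval A q :> BH,
    forall r k x, r \in t -> P r (L k (P r x)) = q^`().[r]%:C *: P r (k (P r x)),
    0 <= C & forall (rho : R) k l, 0 <= rho <= 1 -> `|k| <= rho -> `|l| <= rho ->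
      `|K k - K l - L (k - l)| <= C * rho * `|k - l|].
Proof.
have [J2 J2E [J2b J2n]] := @jordan2_ex R H.
have [JA JAE] := jordanl_ex Asa.
elim/poly_ind: q => [|q c [K [L [C [KC KE KL C0 Kd]]]]].
  exists (fun=> 0), 0, 0; split.
  - by move=> n; exact: is_Ck_cst.
  - by move=> k; rewrite !rpeval0 subrr; exact: erefl.
  - move=> r k x _; rewrite derivC horner0 scale0r.
    have -> : ((0 : clinear (hs_sa H) (hs_sa H)) k) (P r x) = 0 by [].
    exact: clin0.
  - exact: lexx.
  - by move=> rho k l _ _ _; rewrite clinear0E !subr0 !mul0r normr0; exact: lexx.
have [JQ JQE] := jordanl_ex (rpeval_sa q Asa).
have K0 : K 0 = 0.
  apply: hs_sa_inj; rewrite (KE 0).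
  have -> : A + (0 : hs_sa H) = A by exact: addr0.
  exact: subrr.
exists (fun k => JA (K k) + JQ k + J2 (K k) k), (clinear_comp JA L + JQ),
  (`|JA| * C + 2 * (`|L| + C)); split.
- move=> n; apply: is_CkD; first apply: is_CkD.
  + exact: is_Ck_post.
  + exact: is_Ck_clinear.
  + apply: is_Ck_bilinear J2b _ _; first exact: KC.
    exact: (is_Ck_clinear _ _ clinear_id).
- move=> k; exact: increment_step (KE k) (JAE (K k)) (JQE k) (J2E (K k) k).
- move=> r k x rt.
  have PA y : P r (A y) = r%:C *: P r y by rewrite -sproj_comm sproj_eigen.
  have AP y : A (P r y) = r%:C *: P r y by rewrite sproj_eigen.
  have QP y : rpeval A q (P r y) = q.[r]%:C *: P r y by exact: rpeval_eigen.
  have PQ y : P r (rpeval A q y) = q.[r]%:C *: P r y by rewrite -QP rpeval_comm.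
  have -> : (clinear_comp JA L + JQ) k = JA (L k) + JQ k by exact: erefl.
  rewrite hs_sa_addE (JAE (L k)) (JQE k) clinearDE !jordanE.
  rewrite !(clinD, clinZ) AP QP !clinZ PA PQ !half_double.
  rewrite (KL r k x rt) derivD derivC addr0 derivM derivX mulr1 hornerD hornerM hornerX.
  by rewrite scalerA -scalerDl rmorphD rmorphM mulrC.
- by rewrite addr_ge0 ?mulr_ge0 ?addr_ge0.
move=> rho k l rho01 kr lr.
exact: (bilinear_increment JA JQ J2b J2n K0 C0 Kd rho01 kr lr).
Qed.

End PolynomialIncrement.

(** * Inverse square roots near the identity, and commutants *)

Section InverseSquareRoot.
Context {R : realType} {E : completeNormedModType R}.
Variable (J : E -> E -> E).
Hypotheses (Jb : bilinear_bounded J) (Jn : forall k l, `|J k l| <= `|k| * `|l|).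

(* For commuting operators and [J] the product, a fixed point [z] satisfies
   [(1 + z)^2 (1 + h) = 1]. *)
Definition inv_sqrt_step (h z : E) : E :=
  - (2^-1 *: (h + (J z h + J z h) + J z z + J (J z z) h)).

Lemma inv_sqrt_fixpoint (D : set E) h : closed D -> D 0 -> `|h| <= 1 / 4 ->
  (forall z, D z -> D (inv_sqrt_step h z)) ->
  exists z, [/\ D z, `|z| <= 1 / 4 & inv_sqrt_step h z = z].
Proof.
move=> cD D0 h4 DF.
have normF z : `|z| <= 1 / 4 -> `|inv_sqrt_step h z| <= 1 / 4.
  move=> z4; rewrite normrN normrZ ger0_norm ?invr_ge0//.
  have h0 := normr_ge0 h; have z0 := normr_ge0 z.
  have b1 : `|J z h| <= 1 / 4 * (1 / 4).
    by rewrite (le_trans (Jn _ _))// ler_pM.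
  have b2 : `|J z z| <= 1 / 4 * (1 / 4).
    by rewrite (le_trans (Jn _ _))// ler_pM.
  have b3 : `|J (J z z) h| <= 1 / 4 * (1 / 4) * (1 / 4).
    by rewrite (le_trans (Jn _ _))// ler_pM.
  have := ler_normD (h + (J z h + J z h) + J z z) (J (J z z) h).
  have := ler_normD (h + (J z h + J z h)) (J z z).
  have := ler_normD h (J z h + J z h).
  have := ler_normD (J z h) (J z h).
  lra.
have [|||||z [Dz z4] zE] := @contraction_fixpoint R E
    (D `&` [set z | `|z| <= 1 / 4]) (inv_sqrt_step h) (9 / 16).
- apply: closedI => //.
  apply: (@closed_comp _ _ (fun x : E => `|x|) [set t | t <= 1 / 4]).
    by move=> x _; exact: norm_continuous.
  exact: closed_le.
- by exists 0; split; rewrite //= normr0; lra.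
- by move=> z [Dz z4]; split; [exact: DF|exact: normF].
- by lra.
- move=> z w [_ /= z4] [_ /= w4]; have dE : inv_sqrt_step h z - inv_sqrt_step h w =
     - (2^-1 *: ((J (z - w) h + J (z - w) h) + (J (z - w) z + J w (z - w)) +
     J (J (z - w) z + J w (z - w)) h)).
    rewrite /inv_sqrt_step -opprD -scalerBr; congr (- (_ *: _)).
    have -> : J (z - w) z + J w (z - w) = J z z - J w w.
      by rewrite (bilinearBl Jb) (bilinearBr Jb); zmod.
    by rewrite !(bilinearBl Jb); zmod.
  rewrite dE normrN normrZ ger0_norm ?invr_ge0//.
  have d0 := normr_ge0 (z - w); have h0 := normr_ge0 h.
  have b1 : `|J (z - w) h| <= `|z - w| * (1 / 4).
    by rewrite (le_trans (Jn _ _))// ler_wpM2l.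
  have b2 : `|J (z - w) z + J w (z - w)| <= `|z - w| * (1 / 2).
    apply: le_trans (ler_normD _ _) _.
    have : `|J (z - w) z| <= `|z - w| * (1 / 4).
      by rewrite (le_trans (Jn _ _))// ler_wpM2l.
    have : `|J w (z - w)| <= 1 / 4 * `|z - w|.
      by rewrite (le_trans (Jn _ _))// ler_wpM2r.
    lra.
  have b3 : `|J (J (z - w) z + J w (z - w)) h| <= `|z - w| * (1 / 2) * (1 / 4).
    by rewrite (le_trans (Jn _ _))// ler_pM.
  have := ler_normD (J (z - w) h + J (z - w) h + (J (z - w) z + J w (z - w)))
    (J (J (z - w) z + J w (z - w)) h).
  have := ler_normD (J (z - w) h + J (z - w) h) (J (z - w) z + J w (z - w)).
  have := ler_normD (J (z - w) h) (J (z - w) h).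
  lra.
by exists z.
Qed.

End InverseSquareRoot.

Lemma lipschitz_continuous {R : realType} {E : normedModType R} (f : E -> R) (D : R) :
  0 < D -> (forall z w, `|f z - f w| <= D * `|z - w|) -> continuous f.
Proof.
move=> D0 fD z; apply/cvgrPdist_le => e e0; near=> w.
apply: le_trans (fD z w) _; rewrite -ler_pdivlMl//; near: w.
have /cvgrPdist_le : (id : E -> E) @ z --> z by exact: cvg_id.
by apply; rewrite mulr_gt0// invr_gt0.
Unshelve. all: by end_near. Qed.

Section Commutant.
Context {R : realType} {H : hilbertType R}.
Local Notation BH := (clinear H H).
Implicit Types (a b c : BH) (k z h : hs_sa H) (x : H).

Definition commutes a b := forall x, a (b x) = b (a x).

Lemma commutes_jordan a a' b : commutes a b -> commutes a' b ->
  commutes (jordan a a') b.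
Proof. by move=> ab a'b x; rewrite !jordanE !clinE !(ab,a'b). Qed.

Lemma closed_commutes b : closed [set z : hs_sa H | commutes z b].
Proof.
have [C C0 bC] := clinear_nrm_bounded b.
pose f x z := nrm (z (b x) - b (z x)).
have -> : [set z : hs_sa H | commutes z b] =
    \bigcap_(x in [set: H]) [set z | f x z <= 0].
  apply/seteqP; split=> [z zb x _|z zb x].
    by rewrite /= /f zb subrr nrm0.
  apply/eqP; rewrite -subr_eq0 -nrm_eq0 eq_le nrm_ge0 andbT.
  exact: zb.
apply: closed_bigI => x _.
apply: (@closed_comp _ _ (f x) [set t | t <= 0]); last exact: closed_le.
move=> z0 _; pose D := nrm (b x) + C * nrm x + 1.
have D0 : 0 < D by rewrite ltr_wpDl// addr_ge0 ?mulr_ge0 ?nrm_ge0// ltW.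
suff fD z w : `|f x z - f x w| <= D * `|z - w|.
  exact: (lipschitz_continuous D0 fD).
have zw : nrm ((z - w : hs_sa H) (b x) - b ((z - w : hs_sa H) x)) <= D * `|z - w|.
  apply: le_trans (nrmB _ _) _.
  have h1 := hs_sa_op (z - w) (b x); have h2 := hs_sa_op (z - w) x.
  have h3 := bC ((z - w : hs_sa H) x); have h4 := ler_wpM2l (ltW C0) h2.
  have h5 := normr_ge0 (z - w); move: h1 h2 h3 h4 h5; rewrite /D.
  move: `|z - w| => d; lra.
have E : z (b x) - b (z x) = (w (b x) - b (w x)) +
    ((z - w : hs_sa H) (b x) - b ((z - w : hs_sa H) x)).
  have E' y : (z - w : hs_sa H) y = z y - w y by exact: erefl.
  by rewrite !E' clinB; zmod.
pose d := nrm ((z - w : hs_sa H) (b x) - b ((z - w : hs_sa H) x)).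
have h1 : f x w <= f x z + d.
  by rewrite /f E -{1}[w (b x) - b (w x)](addrK ((z - w : hs_sa H) (b x) -
    b ((z - w : hs_sa H) x))) nrmB.
have h2 : f x z <= f x w + d by rewrite /f E nrmD.
rewrite -/d in zw; rewrite ler_norml; apply/andP; split.
  by rewrite lerNl opprB lerBlDl (le_trans h1)// lerD2l.
by rewrite lerBlDl (le_trans h2)// lerD2l.
Qed.

Lemma hs_sa_sumE I (r : seq I) (f : I -> hs_sa H) x :
  (\sum_(i <- r) f i : hs_sa H) x = \sum_(i <- r) f i x.
Proof. by elim/big_rec2: _ => // i y k _ <-. Qed.

(** The final equation is [(1 + z)^2 (1 + h) = 1] expanded. Restricting the fixed point to the
    commutant of [h] turns its Jordan products into compositions; restricting it to the commutant of
    [b] gives the other relation. *)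
Lemma inv_sqrt_commutes h (b : BH) : commutes h b -> `|h| <= 1 / 4 ->
  exists z, [/\ `|z| <= 1 / 4, commutes z b, commutes z h &
    forall x, z x + z x + h x + (z (h x) + z (h x)) + z (z x) + z (z (h x)) = 0].
Proof.
move=> hb h4; have [J JE [Jb Jn]] := @jordan2_ex R H.
pose D := [set z : hs_sa H | commutes z b] `&` [set z : hs_sa H | commutes z h].
have FE z x : inv_sqrt_step J h z x = - ((2^-1 : R)%:C *: (h x +
    (jordan z h x + jordan z h x) + jordan z z x + jordan (jordan z z) h x)).
  have -> : inv_sqrt_step J h z x = - ((2^-1 : R)%:C *: (h x +
    (J z h x + J z h x) + J z z x + J (J z z) h x)) by exact: erefl.
  by rewrite (JE z h) (JE (J z z) h) (JE z z).
have Fcomm z c : commutes h c -> commutes z c -> commutes (inv_sqrt_step J h z) c.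
  move=> hc zc x; rewrite !FE.
  have Jhc := commutes_jordan zc hc; have Jzc := commutes_jordan zc zc.
  have Jzhc := commutes_jordan Jzc hc.
  have cE v : c (- ((2^-1 : R)%:C *: v)) = - ((2^-1 : R)%:C *: c v).
    by rewrite clinN clinZ.
  by rewrite cE !(hc, Jhc, Jzc, Jzhc) 4!clinD.
have hh : commutes h h by [].
have [|||z [[zb zh] z4 zE]] := @inv_sqrt_fixpoint R (hs_sa H) J Jb Jn D h _ _ h4.
- by apply: closedI; exact: closed_commutes.
- have c0 c : commutes (0 : hs_sa H) c by move=> x; exact/esym/clin0.
  by split; exact: c0.
- by move=> z [zb zh]; split; exact: Fcomm.
exists z; split; [exact: z4|exact: zb|exact: zh|move=> x].
have zzh : commutes (jordan z z) h by exact: commutes_jordan.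
have := FE z x; rewrite zE (jordan_comm zh) (jordan_comm zzh) (jordan_comm (a := z) (b := z))//.
rewrite !clinear_compE => zxE.
have : z x + z x = - (h x + (z (h x) + z (h x)) + z (z x) + z (z (h x))).
  rewrite {1 2}zxE -opprD -scalerDr; congr (- _); exact: half_double.
move=> ->; zmod.
Qed.

End Commutant.

Section UnitaryFromIntertwiner.
Context {R : realType} {H : hilbertType R}.
Local Notation BH := (clinear H H).
Implicit Types (A X s : BH) (x : H).

(* The unitary is [s (s^* s)^(-1/2)]; it is onto because it is an isometry at
   distance less than one from the identity. *)
Lemma orbit2_intertwiner A X (S S' : BH) (h : hs_sa H) :
  is_adjoint S S' -> hilbert_schmidt S -> hs_norm S <= 1 / 4 -> `|h| <= 1 / 4 ->
  commutes h A ->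
  (forall x, X (x + S x) = A x + S (A x)) ->
  (forall x, x + S x + S' (x + S x) = x + h x) -> orbit2 A X.
Proof.
move=> SS' SHS S4 h4 hA XS sh; pose s : BH := clinear_id + S.
pose s' : BH := clinear_id + S'.
have sE x : s x = x + S x by [].
have s'E x : s' x = x + S' x by [].
have ss' : is_adjoint s s' by apply: is_adjointD => //; exact: is_adjoint_id.
have [z [z4 zA zh zE]] := inv_sqrt_commutes hA h4.
have [zHS zsa] := hs_saP z.
pose w : BH := clinear_id + z.
have wE x : w x = x + z x by [].
have wsa : self_adjoint w by apply: is_adjointD => //; exact: is_adjoint_id.
pose u := clinear_comp s w; pose u' := clinear_comp w s'.
have uu' : is_adjoint u u' by exact: is_adjoint_comp ss' wsa.
have s's x : s' (s x) = x + h x by rewrite s'E sE sh.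
have uK : cancel u u'.
  move=> x; rewrite !clinear_compE s's wE clinD !wE !clinE -!zh.
  have := zE x; set a := z x; set b := h x; set c := z b; set d := z a.
  set e := z _ => E; transitivity (x + (a + a + b + (c + c) + d + e)).
    by zmod.
  by rewrite E addr0.
have SopR x : nrm (S x) <= 1 / 4 * nrm x.
  apply: le_trans (hs_norm_op x SS' SHS) _.
  by apply: ler_wpM2r; [exact: nrm_ge0|exact: S4].
have [SzHS Szn] := hs_compl (ltac:(lra) : 0 <= 1 / 4 :> R) SopR zHS.
have uE : u - clinear_id = S + z + clinear_comp S z.
  by apply: clinear_ext => x; rewrite /u /s /w !clinE; zmod.
have SzHS' := hilbert_schmidtD SHS zHS.
have uHS : hilbert_schmidt (u - clinear_id).
  by rewrite uE; exact: hilbert_schmidtD SzHS' SzHS.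
(* [u - 1 = S + z + S z], whence [1/4 + 1/4 + 1/16 = 9/16]. *)
have un : hs_norm (u - clinear_id) <= 9 / 16.
  rewrite uE; apply: le_trans (ler_hs_normD SzHS' SzHS) _.
  have h1 := ler_hs_normD SHS zHS; have h2 := z4; rewrite hs_sa_normE in h2.
  move: h1 Szn S4 h2; move: (hs_norm (S + z)) (hs_norm S) (hs_norm z)
    (hs_norm (clinear_comp S z)) => p q r t'; lra.
have adju := is_adjointB uu' (@is_adjoint_id _ H).
have u'op x : nrm (u' x - x) <= 9 / 16 * nrm x.
  have [u'HS u'n] := hs_adjoint adju uHS.
  have := hs_norm_op x (is_adjoint_sym adju) u'HS.
  have -> : (u' - clinear_id) x = u' x - x by [].
  move=> h1; apply: le_trans h1 _; apply: ler_wpM2r; first exact: nrm_ge0.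
  exact: le_trans u'n un.
have u'0 y : u' y = 0 -> y = 0.
  move=> u'y; have := u'op y; rewrite u'y sub0r nrmN => yy.
  apply/eqP; rewrite -nrm_eq0 eq_le nrm_ge0 andbT.
  by have := nrm_ge0 y; lra.
have u'K : cancel u' u.
  move=> x; apply/eqP; rewrite -subr_eq0; apply/eqP/u'0.
  by rewrite clinB uK subrr.
apply/orbit2P; exists u, u'; split.
  split; [exact: uu'|exact: uK|exact: u'K|exact: uHS|].
  exact: (hs_adjoint adju uHS).1.
apply: clinear_ext => x; rewrite -{1}(u'K x) !clinear_compE.
have Xs y : X (s y) = s (A y) by exact: XS.
by rewrite Xs; congr (s _); rewrite !wE clinD zA.
Qed.

End UnitaryFromIntertwiner.

Lemma increment_bound {R : realType} {E : normedModType R} (K : E -> E)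
    (L : clinear E E) (C : R) : K 0 = 0 -> 0 <= C ->
  (forall (rho : R) k l, 0 <= rho <= 1 -> `|k| <= rho -> `|l| <= rho ->
    `|K k - K l - L (k - l)| <= C * rho * `|k - l|) ->
  forall k, `|k| <= 1 -> `|K k| <= (`|L| + C) * `|k|.
Proof.
move=> K0 C0 Kd k k1.
have := Kd 1 k 0; rewrite K0 !subr0 normr0 ler01 lexx mulr1 => /(_ isT k1 isT) h.
rewrite -(subrK (L k) (K k)) mulrDl addrC; apply: le_trans (ler_normD _ _) _.
exact: lerD (clinear_norm_le _ _) h.
Qed.

Lemma sum_clinear_bound {R : realType} {E : normedModType R} (I : Type) (t : seq I)
    (C : I -> clinear E E) (y : I -> E) (M : I -> R) (n : R) :
  (forall i, `|y i| <= M i * n) ->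
  `|\sum_(i <- t) C i (y i)| <= (\sum_(i <- t) `|C i| * M i) * n.
Proof.
move=> yM; apply: le_trans (ler_norm_sum _ _ _) _; rewrite mulr_suml.
apply: ler_sum => i _; apply: le_trans (clinear_norm_le _ _) _.
by rewrite -mulrA ler_wpM2l.
Qed.

(** * The orbit near a point as the zero set of a polynomial *)

Section OrbitCriterion.
Context {R : realType} {H : hilbertType R}.
Local Notation BH := (clinear H H).
Implicit Types (k l : hs_sa H) (x : H).
Variables (A : BH) (t : seq R) (r0 : R).
Hypotheses (Asa : self_adjoint A) (ut : uniq t) (r0t : r0 \in t).
Let m : {poly R} := \prod_(r <- t) ('X - r%:P).
Hypothesis At : rpeval A m = 0.

Let p r := sproj t A r.

Lemma orbit2_rpeval0 X : orbit2 A X -> rpeval X m = 0.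
Proof.
move=> /orbit2P[u [v [[_ uK vK _ _] ->]]]; rewrite rpeval_conj2// At.
by apply: clinear_ext => x; rewrite /conj2 !clinE.
Qed.

Let sproj_increment r : exists K : hs_sa H -> hs_sa H,
  (forall k, K k = sproj t (A + k) r - p r :> BH) /\
  exists2 C : R, 0 <= C & forall k, `|k| <= 1 -> `|K k| <= C * `|k|.
Proof.
have [K [L [C [_ KE _ C0 Kd]]]] := polynomial_increment Asa At (lagrange_poly t r).
exists K; split; first exact: KE.
exists (`|L| + C); first by apply: addr_ge0; [exact: normr_ge0|exact: C0].
have K0 : K 0 = 0.
  apply: hs_sa_inj; rewrite (KE 0).
  have -> : A + (0 : hs_sa H) = A by exact: addr0.
  exact: subrr.
exact: (increment_bound K0 C0 Kd).
Qed.

Let psum x : \sum_(r <- t) p r x = x.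
Proof. exact: (sproj_sum A ut x r0t). Qed.

Let pp r x : r \in t -> p r (p r x) = p r x.
Proof. by move=> rt; rewrite /p sproj_mul// eqxx. Qed.

(* [s = sum_r q_r p_r], with [q_r] the spectral projections of [A + k], intertwines
   [A] and [A + k]. *)
Let intertwiner k (K C : R -> hs_sa H) : rpeval (A + k) m = 0 ->
  (forall r, K r = sproj t (A + k) r - p r :> BH) ->
  (forall r, C r = compress (p r) (K r) :> BH) ->
  let S := \sum_(r <- t) clinear_comp (K r) (p r) in
  let S' := \sum_(r <- t) clinear_comp (p r) (K r) in
  let h := \sum_(r <- t) C r in
  [/\ is_adjoint S S', commutes h A, forall x, (A + k) (x + S x) = A x + S (A x)
    & forall x, x + S x + S' (x + S x) = x + h x].
Proof.
move=> Xt KE CE S S' h; set X := A + k in Xt KE *.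
have Xsa : self_adjoint X by exact: is_adjointD Asa (hs_saP k).2.
have KxE r x : K r x = sproj t X r x - p r x.
  by have /(congr1 (fun f : BH => f x)) := KE r; rewrite clinearBE.
have CxE r x : C r x = p r (K r (p r x)).
  by have /(congr1 (fun f : BH => f x)) := CE r.
have SE x : x + S x = \sum_(r <- t) sproj t X r (p r x).
  rewrite clinear_sumE -{1}(psum x) -big_split; apply: eq_big_seq => r rt.
  by rewrite clinear_compE KxE (pp x rt); exact: subrKC.
have S'E y : S' y = \sum_(r <- t) (p r (sproj t X r y) - p r y).
  rewrite clinear_sumE; apply: eq_big_seq => r rt.
  by rewrite clinear_compE KxE clinB pp.
have hE x : h x = \sum_(r <- t) (p r (sproj t X r (p r x)) - p r x).
  rewrite hs_sa_sumE; apply: eq_big_seq => r rt.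
  by rewrite CxE KxE clinB !pp.
have psa r : self_adjoint (p r) by exact: sproj_sa.
split.
- by apply: is_adjoint_sum => r _; exact: is_adjoint_comp (hs_saP (K r)).2 (psa r).
- move=> x; rewrite !hs_sa_sumE clin_sum; apply: eq_big_seq => r rt.
  by rewrite !CxE sproj_eigen// -[p r (A x)]sproj_comm [A (p r x)]sproj_eigen// 2!clinZ.
- move=> x; rewrite SE [RHS]SE clin_sum; apply: eq_big_seq => r rt.
  by rewrite (sproj_eigen Xt)// -[p r (A x)]sproj_comm sproj_eigen// clinZ.
move=> x; rewrite S'E hE !sumrB !psum !subrKC.
apply: eq_big_seq => r rt; congr (p r _).
rewrite SE clin_sum (bigD1_seq r)//= sproj_mul// eqxx big_seq_cond big1 ?addr0//.
by move=> s /andP[st sr]; rewrite sproj_mul// (negbTE sr).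
Qed.

Lemma orbit2_of_rpeval0 : exists2 d : R, 0 < d &
  forall k, `|k| <= d -> rpeval (A + k) m = 0 -> orbit2 A (A + k).
Proof.
have /choice[K KP] := sproj_increment.
have psa r : self_adjoint (p r) by exact: sproj_sa.
have /choice[C CE] r := compression_ex (psa r).
have /choice[M MP] : forall r, exists M : R, 0 <= M /\
    forall k, `|k| <= 1 -> `|K r k| <= M * `|k|.
  by move=> r; have [_ [M M0 KM]] := KP r; exists M.
have /choice[D DP] : forall r, exists D : R, 0 <= D /\ forall x, nrm (p r x) <= D * nrm x.
  by move=> r; have [D D0 pD] := clinear_nrm_bounded (p r); exists D; split; [exact: ltW|].
(* [M1 * |k|] bounds [h] and [M2 * |k|] bounds [S]. The radius below makes both at most 1/4 and
   forces [|k| <= 1], where the bounds [MP] hold. *)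
pose M1 := \sum_(r <- t) `|C r| * M r; pose M2 := \sum_(r <- t) D r * M r.
have M10 : 0 <= M1 by apply: sumr_ge0 => r _; apply: mulr_ge0; [exact: normr_ge0|exact: (MP r).1].
have M20 : 0 <= M2 by apply: sumr_ge0 => r _; apply: mulr_ge0; [exact: (DP r).1|exact: (MP r).1].
have N0 : 0 < 4 * (M1 + M2 + 1) by rewrite mulr_gt0// ltr_wpDl// addr_ge0.
exists ((4 * (M1 + M2 + 1))^-1); first by rewrite invr_gt0.
move=> k kd Xt.
have small (a : R) : 0 <= a -> a <= M1 + M2 + 1 -> a * `|k| <= 1 / 4.
  move=> a0 aM; apply: le_trans (ler_wpM2l a0 kd) _.
  rewrite ler_pdivrMr// mulrA divfK ?pnatr_eq0// mul1r; exact: aM.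
have k1 : `|k| <= 1.
  have := small 1 ler01; rewrite mul1r lerDr => /(_ (addr_ge0 M10 M20)) h.
  by apply: le_trans h _; rewrite ler_pdivrMr// mul1r ler1n.
have [] := @intertwiner k (fun r => K r k) (fun r => C r (K r k)) Xt.
- by move=> r; exact: (KP r).1.
- by move=> r; exact: CE.
move=> SS' hA XS sE.
have KHS r := (hs_saP (K r k)).1.
have KpHS r := hs_compr (hs_saP (K r k)).2 (psa r) (DP r).1 (DP r).2 (KHS r).
have [SHS Sn] := hs_sum t (P := xpredT) (fun r _ => (KpHS r).1).
apply: orbit2_intertwiner SS' SHS _ _ hA XS sE.
- apply: (le_trans Sn); apply: (le_trans _ (small M2 M20 _)).
    rewrite mulr_suml; apply: ler_sum => r _; apply: le_trans (KpHS r).2 _.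
    rewrite -mulrA; apply: ler_wpM2l; [exact: (DP r).1|exact: (MP r).2 k k1].
  by rewrite -addrA [M1 + _]addrC -addrA ler_wpDr// addr_ge0.
- have b := @sum_clinear_bound R (hs_sa H) R t C (fun r => K r k) M `|k|
    (fun r => (MP r).2 k k1).
  apply: le_trans b (small M1 M10 _).
  by rewrite -addrA ler_wpDr// addr_ge0.
Qed.

End OrbitCriterion.

(** The condition that [submanifold] imposes at a single point, isolated so that it can be
    translated to [0]. *)
Definition has_chart {R : realType} {E : normedModType R} (S : set E) (a : E) :=
  exists (U V F : set E) (phi : E -> E),
  [/\ open U /\ U a, open V, closed_subspace F, diffeomorphism U V phi
    & phi @` (U `&` S) = V `&` F].

(** * Straightening a zero set by complementary projections *)

Section ChartFromCompressions.
Context {R : realType} {E : completeNormedModType R} {I : eqType}.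
Variables (t : seq I) (C : I -> clinear E E) (c : I -> R).
Variables (K : E -> E) (L : clinear E E) (B d : R) (S : set E).
Hypotheses (ut : uniq t)
  (CC : forall r s x, r \in t -> s \in t -> C s (C r x) = if r == s then C r x else 0).
Hypotheses (Ksmooth : smooth_on setT K) (K0 : K 0 = 0) (B0 : 0 <= B)
  (Kd : forall (rho : R) k l, 0 <= rho <= 1 -> `|k| <= rho -> `|l| <= rho ->
    `|K k - K l - L (k - l)| <= B * rho * `|k - l|).
Hypotheses (c0 : forall r, r \in t -> c r != 0)
  (CL : forall r k, r \in t -> c r *: C r (L k) = C r k).
Hypotheses (d0 : 0 < d)
  (S1 : forall k, `|k| <= d -> (forall r, r \in t -> C r (K k) = 0) -> S k)
  (S2 : forall k, S k -> forall r, r \in t -> C r (K k) = 0).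

Let F := [set k | forall r, r \in t -> C r k = 0].

(** Adding [q] replaces the block [C r k] by [c r *: C r (K k)], which carries [S] into [F]; by [CL]
    the linear part of [q] cancels, hence its small Lipschitz constant near [0]. *)
Let q k := \sum_(r <- t) (c r *: C r (K k) - C r k).

Let F_closed : closed_subspace F.
Proof.
split=> [|r _|a x y Fx Fy r rt]; last 2 first.
- exact: clin0.
- by rewrite clinD clinZ Fx// Fy// scaler0 addr0.
have -> : F = \bigcap_(r in [set r | r \in t]) [set k | `|C r k| <= 0].
  by apply/seteqP; split=> k Fk r rt; have := Fk r rt; rewrite /= normr_le0 => /eqP.
apply: closed_bigI => r _.
apply: (@closed_comp _ _ (fun k => `|C r k|) [set u | u <= 0]); last exact: closed_le.
move=> x _; apply: (@continuous_comp _ _ _ (C r) (fun z : E => `|z|)).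
  exact: (clinearP (C r)).2.
exact: norm_continuous.
Qed.

Let q_smooth : smooth_on setT q.
Proof.
have -> : q = (fun k => (\sum_(r <- t) c r *: C r) (K k) + (- \sum_(r <- t) C r) k).
  apply/funext => k; rewrite clinearNE !clinear_sumE -sumrN -big_split.
  by apply: eq_bigr => r _; rewrite clinearZE.
by move=> n; apply: is_CkD; [exact: is_Ck_post|exact: is_Ck_clinear].
Qed.

Let phi_comp s k : s \in t -> C s (k + q k) = c s *: C s (K k).
Proof.
move=> st; rewrite clinD clin_sum (bigD1_seq s)//= clinB clinZ !CC// eqxx.
rewrite big_seq_cond big1 ?addr0 ?subrKC// => r /andP[rt rs].
by rewrite clinB clinZ !CC// (negbTE rs) scaler0 subr0.
Qed.

Let q_lip : exists2 M : R, 0 <= M & forall (rho : R) k l, 0 <= rho <= 1 ->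
  `|k| <= rho -> `|l| <= rho -> `|q k - q l| <= M * rho * `|k - l|.
Proof.
exists (\sum_(r <- t) `|c r *: C r| * B).
  by apply: sumr_ge0 => r _; rewrite mulr_ge0.
move=> rho k l rho01 kr lr.
have -> : q k - q l = \sum_(r <- t) (c r *: C r) (K k - K l - L (k - l)).
  rewrite -sumrB; apply: eq_big_seq => r rt.
  rewrite clinearZE 2!(clinB (C r)) 2!scalerBr CL// clinB.
  by zmod.
rewrite -(mulrA _ rho); apply: sum_clinear_bound => r.
rewrite mulrA; exact: Kd.
Qed.

Lemma chart_from_compressions : has_chart S 0.
Proof.
have [M M0 qM] := q_lip.
(* The three bounds serve [q_lip] (at most 1), [S1] (at most [d]) and the Lipschitz constant 1/2
   that [local_diffeomorphism] asks for. *)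
pose rho := Num.min (Num.min 1 d) (2 * (M + 1))^-1.
have N0 : 0 < 2 * (M + 1) by rewrite mulr_gt0// ltr_wpDl.
have rho0 : 0 < rho by rewrite !lt_min ltr01 d0 invr_gt0.
have rho1 : rho <= 1 by rewrite !ge_min lexx.
have rhod : rho <= d by rewrite !ge_min lexx !orbT.
have rhoM : M * rho <= 2^-1.
  have : rho <= (2 * (M + 1))^-1 by rewrite !ge_min lexx !orbT.
  rewrite -[_^-1]mul1r ler_pdivlMr// mulrDr mulrDr.
  by have := mulr_ge0 (ltW rho0) M0; lra.
have q0 : q 0 = 0.
  by rewrite /q big1// => r _; rewrite K0 !clin0 scaler0 subr0.
have qr x y : `|x| < rho -> `|y| < rho -> `|q x - q y| <= 2^-1 * `|x - y|.
  move=> xr yr; apply: le_trans (qM rho x y _ (ltW xr) (ltW yr)) _.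
    by rewrite (ltW rho0).
  by rewrite ler_wpM2r.
have [oU U0 oV D] := local_diffeomorphism rho0 q_smooth q0 qr.
exists [set x | `|x| < rho /\ `|x + q x| < rho / 2], [set y | `|y| < rho / 2], F,
  (fun x => x + q x).
split=> //; have [psi [phiU _ _ _ _]] := D.
apply/seteqP; split=> [_ [x [[xr xV] Sx] <-]|y [yV Fy]].
  by split=> // r rt; rewrite phi_comp// S2// scaler0.
have : [set y : E | `|y| < rho / 2] y by [].
rewrite -phiU => -[x [xr xV] xy]; exists x => //; split=> //.
apply: S1 => [|r rt]; first exact: le_trans (ltW xr) rhod.
have := Fy r rt; rewrite -xy phi_comp// => /eqP.
by rewrite scaler_eq0 (negbTE (c0 rt)) => /eqP.
Qed.

End ChartFromCompressions.

(** * Operators in a commutant are determined by their diagonal blocks *)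

Section OrbitChart.
Context {R : realType} {H : hilbertType R}.
Local Notation BH := (clinear H H).
Implicit Types (k l M : hs_sa H) (x : H).
Variables (A : BH) (t : seq R) (r0 : R).
Hypotheses (Asa : self_adjoint A) (ut : uniq t) (r0t : r0 \in t).
Let m : {poly R} := \prod_(r <- t) ('X - r%:P).
Hypothesis At : rpeval A m = 0.

Let p r := sproj t A r.

(* [(r - s) p_r M p_s = p_r [A, M] p_s = p_r (M k - k M) p_s]. *)
Let commutant_block k M r s x : r \in t -> s \in t ->
  commutes (A + k) M -> (forall r x, r \in t -> p r (M (p r x)) = 0) ->
  p r (M (p s x)) = ((r - s)^-1)%:C *: p r (M (k (p s x)) - k (M (p s x))).
Proof.
(* For [r = s] both sides vanish: the left by hypothesis, the right because [0^-1] is [0]. *)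
move=> rt st MX Md; have [->|rs] := eqVneq r s.
  by rewrite Md// subrr invr0 rmorph0 scale0r.
have -> : p r (M (k (p s x)) - k (M (p s x))) = (r - s)%:C *: p r (M (p s x)).
  have := MX (p s x); rewrite !clinearDE => MXs.
  have -> : M (k (p s x)) - k (M (p s x)) = A (M (p s x)) - M (A (p s x)).
    move: MXs; rewrite (clinD M) => MXs.
    apply: (addrI (k (M (p s x)) + M (A (p s x)))).
    transitivity (M (A (p s x)) + M (k (p s x))); first by zmod.
    by rewrite -MXs; zmod.
  rewrite clinB -[p r (A _)]sproj_comm [A (p r _)]sproj_eigen//.
  by rewrite [A (p s x)]sproj_eigen// 2!clinZ -scalerBl -rmorphB.
by rewrite scalerA -rmorphM mulVf ?subr_eq0// rmorph1 scale1r.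
Qed.

(** [M] is the sum of its blocks, each bounded by a constant times [|M| * |k|]; for small [k] this
    gives [|M| <= |M| / 2]. *)
Lemma small_commutant_eq0 : exists2 d : R, 0 < d &
  forall k M, `|k| <= d -> commutes (A + k) M ->
    (forall r x, r \in t -> p r (M (p r x)) = 0) -> M = 0.
Proof.
have psa r : self_adjoint (p r) by exact: sproj_sa.
have /choice[D DP] : forall r, exists D : R, 0 <= D /\ forall x, nrm (p r x) <= D * nrm x.
  by move=> r; have [D D0 pD] := clinear_nrm_bounded (p r); exists D; split; [exact: ltW|].
pose w r s := `|(r - s)^-1| * (D r * D s * 2).
have w0 r s : 0 <= w r s.
  apply: mulr_ge0; first exact: normr_ge0.
  by apply: mulr_ge0; [apply: mulr_ge0; exact: (DP _).1|exact: ler0n].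
pose W := \sum_(r <- t) \sum_(s <- t) w r s.
have W0 : 0 <= W by apply: sumr_ge0 => r _; apply: sumr_ge0.
have W1 : 0 < W + 1 by exact: ltr_wpDl.
exists (2 * (W + 1))^-1; first by rewrite invr_gt0 mulr_gt0.
move=> k M kd MX Md.
pose N : BH := clinear_comp M k - clinear_comp k M.
have [kHS ksa] := hs_saP k; have [MHS Msa] := hs_saP M.
have [h1 h2] := hs_compl (normr_ge0 M) (hs_sa_op M) kHS.
have [h3 h4] := hs_compl (normr_ge0 k) (hs_sa_op k) MHS.
have NHS : hilbert_schmidt N by exact: hilbert_schmidtB h1 h3.
have Nn : hs_norm N <= 2 * (`|M| * `|k|).
  apply: le_trans (ler_hs_normB h1 h3) _; rewrite mulr_natl mulr2n; apply: lerD.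
    exact: h2.
  rewrite mulrC; exact: h4.
pose b r s : BH := ((r - s)^-1)%:C *: clinear_comp (p r) (clinear_comp N (p s)).
have Nadj : is_adjoint N (clinear_comp k M - clinear_comp M k).
  exact: is_adjointB (is_adjoint_comp Msa ksa) (is_adjoint_comp ksa Msa).
have bP r s : hilbert_schmidt (b r s) /\ hs_norm (b r s) <= w r s * (`|M| * `|k|).
  have [h5 h6] := hs_compr Nadj (psa s) (DP s).1 (DP s).2 NHS.
  have [h7 h8] := hs_compl (DP r).1 (DP r).2 h5.
  split; first exact: hilbert_schmidtZ h7.
  rewrite /b (hs_normZ _ h7) /w -mulrA; apply: ler_wpM2l; first exact: normr_ge0.
  apply: (le_trans h8); rewrite -(mulrA (D r * D s)) -(mulrA (D r)); apply: ler_wpM2l; first exact: (DP r).1.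
  apply: (le_trans h6); apply: ler_wpM2l; [exact: (DP s).1|exact: Nn].
have ME : M = \sum_(r <- t) \sum_(s <- t) b r s :> BH.
  apply: clinear_ext => x; rewrite clinear_sumE.
  rewrite -[LHS](sproj_sum A ut _ r0t); apply: eq_big_seq => r rt.
  rewrite clinear_sumE -{1}(sproj_sum A ut x r0t) 2!clin_sum.
  apply: eq_big_seq => s st; exact: commutant_block.
have Mn : `|M| <= W * (`|M| * `|k|).
  rewrite {1}hs_sa_normE ME /W mulr_suml.
  have bsum r := hs_sum t (P := xpredT) (fun s _ => (bP r s).1).
  have [_ h] := hs_sum t (P := xpredT) (fun r _ => (bsum r).1).
  apply: (le_trans h); apply: ler_sum => r _; apply: (le_trans (bsum r).2).
  rewrite mulr_suml; apply: ler_sum => s _; exact: (bP r s).2.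
apply/eqP; rewrite -normr_le0.
have := normr_ge0 M; move: kd Mn W0; rewrite -[_^-1]mul1r ler_pdivlMr ?mulr_gt0//.
move: `|M| `|k| (normr_ge0 k) => a e e0 kd Mn W0 a0.
have : a * (e * (2 * (W + 1))) <= a * 1 by apply: ler_wpM2l.
have := mulr_ge0 a0 e0; nra.
Qed.

End OrbitChart.

Lemma has_chart_translate {R : realType} {E : normedModType R} (S : set E) (a : E) :
  has_chart [set k | S (k + a)] 0 -> has_chart S a.
Proof.
move=> [U [V [F [phi [[oU U0] oV Fsub [psi [phiU psiV phiK phiC psiC]] phiS]]]]].
pose sh k : E := k - a.
have shC n (W : set E) : is_Ck n W sh.
  by apply: is_CkD; [exact: (@is_Ck_clinear _ n _ _ _ clinear_id)|exact: is_Ck_cst].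
have shK k : sh (k + a) = k by rewrite /sh addrK.
exists (sh @^-1` U), V, F, (phi \o sh); split.
- split; last by rewrite /sh /= subrr.
  apply: open_comp oU => k _.
  exact: (is_Ck_continuous (shC 0 setT)).
- by [].
- by [].
- exists (fun y => psi y + a); split.
  + apply/seteqP; split=> [_ [k Uk <-]|y Vy]; first by rewrite -phiU; exists (sh k).
    by move: Vy; rewrite -phiU => -[k Uk <-]; exists (k + a); rewrite /= shK.
  + apply/seteqP; split=> [_ [y Vy <-]|k Uk] /=.
      by rewrite shK -psiV; exists y.
    have : U (sh k) by []; rewrite -psiV => -[y Vy yk]; exists y => //.
    by rewrite yk subrK.
  + by move=> k Uk; rewrite /= phiK// subrK.
  + by move=> n; apply: is_Ck_comp (phiC n) => //; exact: shC.
  + by move=> n; apply: is_CkD; [exact: psiC|exact: is_Ck_cst].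
rewrite -phiS; apply/seteqP; split=> [_ [k [Uk Sk] <-]|_ [k [Uk Sk] <-]].
  by exists (sh k) => //; split=> //; rewrite /= subrK.
by exists (k + a); rewrite /= ?shK//; split=> //; rewrite /= shK.
Qed.

(** * Charts at all points of the orbit *)

Section OrbitSubmanifold.
Context {R : realType} {H : hilbertType R}.
Local Notation BH := (clinear H H).
Implicit Types (k l : hs_sa H) (x : H).
Variables (t : seq R) (r0 : R).
Hypotheses (ut : uniq t) (r0t : r0 \in t).
Let m : {poly R} := \prod_(r <- t) ('X - r%:P).

Lemma orbit_chart0 (A : BH) : self_adjoint A -> rpeval A m = 0 ->
  has_chart [set k : hs_sa H | orbit2 A (A + k)] 0.
Proof.
move=> Asa At; pose p r := sproj t A r.
have psa r : self_adjoint (p r) by exact: sproj_sa.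
have /choice[C CE] r := compression_ex (psa r).
have [K [L [B [KC KE KL B0 Kd]]]] := polynomial_increment Asa At m.
have {}KE k : K k = rpeval (A + k) m :> BH by rewrite KE At; exact: subr0.
have CxE r k x : C r k x = p r (k (p r x)).
  by have /(congr1 (fun f : BH => f x)) := CE r k.
have pp r s x : r \in t -> s \in t -> p s (p r x) = if r == s then p r x else 0.
  exact: sproj_mul.
have [d1 d10 orb] := orbit2_of_rpeval0 Asa ut r0t At.
have [d2 d20 com] := small_commutant_eq0 Asa ut r0t At.
apply: (@chart_from_compressions R (hs_sa H) R t C (fun r => (m^`().[r])^-1) K L B
  (Num.min d1 d2)) ut _ KC _ B0 Kd _ _ _ _ _.
- move=> r s k rt st; apply: hs_sa_inj; apply: clinear_ext => x.
  rewrite !CxE pp//; have [->|rs] := eqVneq r s.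
    by rewrite !CxE pp// eqxx.
  exact: erefl.
- apply: hs_sa_inj; rewrite (KE 0).
  have -> : A + (0 : hs_sa H) = A by exact: addr0.
  exact: At.
- move=> r rt; rewrite invr_eq0 deriv_prod_XsubC//; exact: lagrange_num_neq0.
- move=> r k rt; apply: hs_sa_inj; apply: clinear_ext => x.
  rewrite hs_sa_scaleE clinearZE !CxE KL// scalerA -rmorphM mulVf ?rmorph1 ?scale1r//.
  by rewrite deriv_prod_XsubC//; exact: lagrange_num_neq0.
- by rewrite lt_min d10 d20.
- move=> k; rewrite le_min => /andP[kd1 kd2] CK; apply: orb kd1 _.
  rewrite -(KE k) (com k (K k) kd2 _ _); first exact: erefl.
    by move=> x; rewrite KE; exact: rpeval_commX.
  by move=> r x rt; rewrite -CxE CK.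
move=> k Sk r rt; have -> : K k = 0; last exact: clin0.
apply: hs_sa_inj; rewrite (KE k); exact: (orbit2_rpeval0 At Sk).
Qed.

(** A chart at the base point suffices: [A + a] has the same orbit and is annihilated by the same
    [m], so [orbit_chart0] applies to it. *)
Lemma orbit_submanifold (A : BH) : self_adjoint A -> rpeval A m = 0 ->
  submanifold [set k : hs_sa H | orbit2 A (A + k)].
Proof.
move=> Asa At a Sa; apply: has_chart_translate; rewrite -/(has_chart _ _).
have Xsa : self_adjoint (A + a) by exact: is_adjointD Asa (hs_saP a).2.
have Xt : rpeval (A + a) m = 0 by exact: (orbit2_rpeval0 At Sa).
have := orbit_chart0 Xsa Xt; congr (has_chart _ _); apply/seteqP.
have E k : A + a + k = A + (k + a : hs_sa H).
  by rewrite hs_sa_addE [in RHS](addrC (k : BH)) addrA.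
split=> k /=; rewrite E => Sk; first exact: orbit2_trans Sa Sk.
exact: orbit2_trans (orbit2_sym Sa) Sk.
Qed.

End OrbitSubmanifold.

Theorem theorem6p5 (R : realType) (H : hilbertType R)
  (Hinf : infinite_dimensional H) (A : clinear H H) (Asa : self_adjoint A) :
  affine_submanifold A (orbit2 A) <-> finite_set (spectrum A).
Proof.
split=> [[_ mS]|fA]; first exact: submanifold_finite_spectrum Asa mS.
split=> [X|]; first exact: orbit2_affine Asa.
have [t ut At] := finite_spectrum_annihilator Asa fA.
have {}At : rpeval A (\prod_(r <- t) ('X - r%:P)) = 0.
  rewrite -At /rpeval rmorph_prod; congr peval.
  by apply: eq_bigr => r _; exact: map_polyXsubC.
(* With no root at all, [m = 1] and the identity operator is zero; the polynomial [X] then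
   annihilates [A] and supplies the root that the orbit lemmas ask for. *)
case: t ut At => [_ id0|r0 t ut At].
  have A0 : rpeval A (\prod_(r <- [:: 0]) ('X - r%:P)) = 0.
    apply: clinear_ext => x; rewrite big_seq1 subr0 rpevalX clinear0E -[x]clinear_idE.
    have -> : clinear_id = 0 :> clinear H H.
      by rewrite -id0 big_nil -[1]/(1%:P) rpevalC rmorph1 scale1r.
    by rewrite clinear0E clin0.
  exact: (@orbit_submanifold R H [:: 0] 0 isT (mem_head 0 [::]) A Asa A0).
exact: (@orbit_submanifold R H (r0 :: t) r0 ut (mem_head r0 t) A Asa At).
Qed.
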